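(* For every fixed integer $g\ge0$ and every $\varepsilon>0$ there is a constant $C(g,\varepsilon)$ and a deterministic algorithm in the $\mathsf{LOCAL}$ model that, on every finite simple graph $G$ of Euler genus at most $g$, computes in $C(g,\varepsilon)$ rounds a dominating set of $G$ of size at most $(25+\varepsilon)$ times the minimum size of a dominating set of $G$.
   Context: A dominating set of a graph $G=(V,E)$ is a set $D\subseteq V$ such that every vertex is in $D$ or has a neighbor in $D$. A graph has Euler genus at most $g$ if it embeds without crossings in a closed surface of Euler genus at most $g$ (the Euler genus of a surface with Euler characteristic $\chi$ is $2-\chi$; Euler genus $0$ is the sphere). $\mathsf{LOCAL}$ model: the input graph is the communication network; the vertices have pairwise distinct identifiers, and initially each vertex knows its own identifier. Computation proceeds in synchronous rounds; in each round every vertex may send a message to each of its neighbors, receive messages from its neighbors, and perform arbitrary local computation. There is no limit on message size or local computation. At the end each vertex decides whether it belongs to the output set. *)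

(* Defs.v *)
From HB Require Import structures.
From mathcomp Require Import all_boot all_order all_algebra.
From mathcomp Require Import all_classical all_reals all_analysis.
Set Implicit Arguments.
Unset Strict Implicit.
Unset Printing Implicit Defensive.
Import Order.TTheory GRing.Theory Num.Theory.
Import numFieldNormedType.Exports.
Local Open Scope classical_set_scope.
Local Open Scope ring_scope.

Record sgraph := SGraph {
  vertex :> finType;
  adj : rel vertex;
  adj_sym : symmetric adj;
  adj_irr : irreflexive adj }.
Arguments adj {s}.

Definition dominating (G : sgraph) (D : {set G}) : bool :=
  [forall v, (v \in D) || [exists u in D, adj v u]].

Definition domination_number (G : sgraph) : nat :=
  #|[arg min_(D < [set: G]%SET | dominating D) #|D|]%N|.

(** Geometric realization, in barycentric coordinates, of the simplicial complex
    on [W] whose simplices are the nonempty subsets of the members of [F]; the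
    coordinate at [w : W] has index [enum_rank w]. *)
Definition realization (R : realType) (W : finType) (F : {set {set W}}) :
    set 'rV[R]_#|W| :=
  [set x | [/\ forall w, 0 <= x ord0 (enum_rank w),
               \sum_w x ord0 (enum_rank w) = 1 &
               exists2 s, s \in F &
                 forall w, x ord0 (enum_rank w) != 0 -> w \in s]].
Arguments realization R {W} F.

(** [F] is the set of triangles of a triangulated closed connected surface on the
    vertex set [W]: the link of each vertex is a cycle (listed by [c]), which also
    forces each edge to lie in exactly two triangles. By Rado's theorem every
    closed surface has such a triangulation. *)
Definition closed_surface (W : finType) (F : {set {set W}}) : Prop :=
  [/\ (0 < #|W|)%N,
      forall t, t \in F -> #|t| = 3%N,
      forall w, exists c : seq W,
        [/\ (2 < size c)%N, uniq c &
            forall x y, ([set w; x; y]%SET \in F) =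
              (x \in c) && ((y == next c x) || (y == prev c x))] &
      forall x y, connect
        (fun u v => [exists t in F, (u \in t) && (v \in t)]) x y].

Definition edges_of (W : finType) (F : {set {set W}}) : {set {set W}} :=
  [set e : {set W} | (#|e| == 2%N) && [exists t in F, e \subset t]]%SET.

Definition euler_characteristic (W : finType) (F : {set {set W}}) : int :=
  #|W|%:Z - #|edges_of F|%:Z + #|F|%:Z.

Definition euler_genus (W : finType) (F : {set {set W}}) : int :=
  2 - euler_characteristic F.

Definition graph_complex (G : sgraph) : {set {set G}} :=
  [set s : {set G} | [exists v, s == [set v]] ||
                     [exists u, exists v, adj u v && (s == [set u; v])]]%SET.

(** A crossing-free drawing of [G] is a continuous injection of the realization
    of [G], a compact space, into the Hausdorff space that is the surface. *)
Definition embeds_in (R : realType) (G : sgraph) (W : finType)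
    (F : {set {set W}}) : Prop :=
  exists f : 'rV[R]_#|G| -> 'rV[R]_#|W|,
    let X := realization R (graph_complex G) in
    [/\ {within X, continuous f},
        {in X &, injective f} &
        f @` X `<=` realization R F].

Definition euler_genus_at_most (R : realType) (g : nat) (G : sgraph) : Prop :=
  exists (W : finType) (F : {set {set W}}),
    [/\ closed_surface F, euler_genus F <= g%:Z & embeds_in R G F].

(** A vertex of degree [d] addresses its neighbors through its ports
    [0, ..., d - 1]. In a round it sends [alg_send s i] through each port [i], and
    then updates its state from the list of received messages, in port order.
    The initial state depends only on the identifier. Sending nothing can be
    encoded by an element of [alg_message]. *)
Record local_algorithm := LocalAlgorithm {
  alg_state : Type;
  alg_message : Type;
  alg_init : nat -> alg_state;
  alg_send : alg_state -> nat -> alg_message;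
  alg_update : alg_state -> seq alg_message -> alg_state;
  alg_output : alg_state -> bool }.

Definition port_numbering (G : sgraph) (port : G -> seq G) : Prop :=
  forall v, uniq (port v) /\ forall u, (u \in port v) = adj v u.

Definition local_round (A : local_algorithm) (G : sgraph) (port : G -> seq G)
    (s : G -> alg_state A) : G -> alg_state A :=
  fun v => alg_update (s v)
    [seq alg_send (s u) (index v (port u)) | u <- port v].

Definition local_output (A : local_algorithm) (rounds : nat) (G : sgraph)
    (port : G -> seq G) (ident : G -> nat) : {set G} :=
  [set v | alg_output
    (iter rounds (local_round port) (fun u => alg_init A (ident u)) v)]%SET.
Arguments local_output A rounds {G} port ident.

(* Main.v *)
(** Topology is used once, to show that a graph [G] drawn on a surface is a minor
    of the 1-skeleton of a triangulation of that surface.  The midpoint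
    subdivision acts on barycentric coordinates by an explicit continuous map, so
    the drawing extends to all iterated subdivisions of the given triangulation,
    whose vertex stars become arbitrarily small in the original coordinates.  The
    vertices whose open star meets the image of a connected set span a connected
    subgraph, and disjoint compact sets have disjoint such vertex sets once the
    subdivision is fine; applied to the stars of the vertices of [G] and to the
    middle thirds of its edges this gives the branch sets.

    Homology over [F_2] then bounds the density of every minor [H] of the
    1-skeleton by [3 (|V| + g)], and by [2 (|V| + g)] if [H] is bipartite: the cycle
    space of [H] has a subspace of codimension at most [g] spanned by the
    boundaries of the faces of [H]; each edge lies in at most two of these, and each
    nonzero one is a nonempty even subgraph, hence has at least 3 (or 4) edges.

    The algorithm takes (1) the vertices whose neighborhood is not dominated by 8
    other vertices, then (2) the vertices still having many undominated neighbors,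
    and (3) runs a primal-dual packing, doubling dual weights until they saturate,
    on the remaining instance, whose degrees are bounded.  Compared with an optimal
    solution of size [gamma] on a connected component, phases 1 and 2 pick at most
    [gamma + 2 g] and [9 gamma + 2 g] vertices outside that solution, and phase 3
    picks at most [14 gamma + 2 g], hence [25 gamma + 6 g] in total.  Components of
    large radius have large [gamma], so that the additive error is absorbed by
    [eps]; in the others, each vertex sees its whole component and all of them agree
    on an optimal solution. *)

Require Import Defs.
From mathcomp Require Import all_boot all_order all_algebra.
From mathcomp Require Import all_classical all_reals all_analysis.
From mathcomp Require Import zify lra.
Set Implicit Arguments.
Unset Strict Implicit.
Unset Printing Implicit Defensive.
Import mathcomp.boot.fintype mathcomp.boot.finset.
Import Order.TTheory GRing.Theory Num.Theory numFieldNormedType.Exports.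
Local Open Scope ring_scope.

(** * Euler's inequality for minors of triangulated surfaces *)

(** A drawing is never given faces, since speaking of them would call for a theorem of Jordan type.
    Their place is taken by classes of triangles, joined across every edge that is neither
    contracted nor chosen to represent an edge of the minor; linear algebra counts the classes with
    nonzero boundary. Density is wanted for minors rather than for subgraphs because the counting
    contracts each vertex onto one that dominates it, which trades the unknown number of vertices
    for the size of an optimal solution. The additive error is a constant for each component, and a
    graph of bounded genus may have arbitrarily many components. Hence every estimate is made inside
    a set [U] closed under adjacency, and the choice between exact and approximate solution has to
    be unanimous on each component. The constants come from density 3. Nine neighbors in the
    contracted graph, against a total of [6 |X| + 3 |D| + 6 g], leave [|X| <= |D| + 2 g]: hence the
    8. A load of 7 splits into 1 for the own weight, 3 for the saturated vertex, and a surplus of 3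
    that cancels the coefficient of the dominated weight; 14 is its double. *)

Section FunctionMatrices.
Variable K : fieldType.

Definition mxof (I J : finType) (f : I -> J -> K) : 'M[K]_(#|I|, #|J|) :=
  \matrix_(i, j) f (enum_val i) (enum_val j).

Definition rvof (J : finType) (f : J -> K) : 'rV[K]_#|J| :=
  \row_j f (enum_val j).

Lemma sum_enum_val (I : finType) (V : nmodType) (f : I -> V) :
  \sum_(i < #|I|) f (enum_val i) = \sum_i f i.
Proof. by rewrite -big_enum_val; apply: eq_bigl. Qed.

Lemma mul_mxof (I J L : finType) (f : I -> J -> K) (h : J -> L -> K) :
  mxof f *m mxof h = mxof (fun i l => \sum_j f i j * h j l).
Proof.
apply/matrixP => i l; rewrite !mxE -[RHS]sum_enum_val.
by apply: eq_bigr => j _; rewrite !mxE.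
Qed.

Lemma mul_rvof (J L : finType) (f : J -> K) (h : J -> L -> K) :
  rvof f *m mxof h = rvof (fun l => \sum_j f j * h j l).
Proof.
apply/rowP => l; rewrite !mxE -[RHS]sum_enum_val.
by apply: eq_bigr => j _; rewrite !mxE.
Qed.

Lemma rvofP (J : finType) (u : 'rV[K]_#|J|) :
  rvof (fun j => u ord0 (enum_rank j)) = u.
Proof. by apply/rowP => j; rewrite mxE enum_valK. Qed.

Lemma rvof0P (J : finType) (f : J -> K) : rvof f = 0 <-> forall j, f j = 0.
Proof.
split=> [/rowP h j|h]; last by apply/rowP => j; rewrite !mxE h.
by have := h (enum_rank j); rewrite !mxE enum_rankK.
Qed.

(** A left kernel of constant vectors is at most a line. In both uses the constancy expresses
    connectedness: of the dual graph for [face_edge], of the 1-skeleton for the transpose of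
    [edge_vertex]. *)
Lemma rank_of_constant_kernel (I J : finType) (f : I -> J -> K) :
  (forall u : I -> K, (forall j, \sum_i u i * f i j = 0) ->
     forall i i', u i = u i') ->
  (#|I| <= \rank (mxof f) + 1)%N.
Proof.
move=> hc; have : (\rank (kermx (mxof f)) <= 1)%N.
  suff /mxrankS h : (kermx (mxof f) <= (const_mx 1 : 'rV[K]_#|I|))%MS.
    exact: leq_trans h (rank_leq_row _).
  apply/row_subP => k; have := row_sub k (kermx (mxof f)).
  move: (row k _) => u /sub_kermxP; rewrite -[u]rvofP mul_rvof => /rvof0P/hc hu.
  case: (pickP (mem 'I_#|I|)) => [i0 _|h0].
    apply/sub_rVP; exists (u ord0 i0); apply/rowP => i; rewrite !mxE mulr1.
    by rewrite (hu _ (enum_val i0)) enum_valK.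
  suff -> : rvof (fun j => u ord0 (enum_rank j)) = 0 by exact: sub0mx.
  by apply/rowP => i; have := h0 i.
by rewrite mxrank_ker leq_subLR.
Qed.

Lemma rank_leq_nonzero_rows (m n : nat) (A : 'M[K]_(m, n)) :
  (\rank A <= #|[set i | row i A != 0%R]|)%N.
Proof.
set S := [set _ | _]; pose B : 'M[K]_(#|S|, n) := \matrix_i row (enum_val i) A.
suff /mxrankS h : (A <= B)%MS by exact: leq_trans h (rank_leq_row _).
apply/row_subP => i; have [->|nz] := eqVneq (row i A) 0; first exact: sub0mx.
have iS : i \in S by rewrite inE.
have -> : row i A = row (enum_rank_in iS i) B by rewrite rowK enum_rankK_in.
exact: row_sub.
Qed.

(* The rank hypothesis says that boundaries have codimension at most [g] in the
   cycles; the cycle space of [H] lifts along [lift] into the cycles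
   supported on [M], and the boundaries among those lifts come from face
   functions which are constant along [comp]. *)
Lemma nonzero_faces_bound (T E V Y H : finType) (d2 : T -> E -> K)
    (d1 : E -> V -> K) (dh : H -> Y -> K) (r : H -> E) (M : pred E)
    (comp : T -> T) (lift : H -> E -> K) (root : Y -> V -> K) (g : nat) :
  (forall t v, \sum_e d2 t e * d1 e v = 0) ->
  (#|E| <= \rank (mxof d1) + \rank (mxof d2) + g)%N ->
  (forall h h', lift h (r h') = (h == h')%:R) ->
  (forall h v, \sum_e lift h e * d1 e v = \sum_y dh h y * root y v) ->
  (forall h e, ~~ M e -> lift h e = 0) ->
  (forall phi : T -> K, (forall e, ~~ M e -> \sum_t phi t * d2 t e = 0) ->
     forall t, phi t = phi (comp t)) ->
  (#|H| <= #|Y| + g +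
     #|[set k | [exists h, (\sum_(t | comp t == k) d2 t (r h))%R != 0%R]]|)%N.
Proof.
move=> hz hrank hLR hLD hLM hcomp.
(* Acting on row vectors, [R] restricts edge chains to the representatives [r h], [C] expands
   functions on classes to functions on faces, and [N] restricts to the edges outside [M]. *)
pose D2 := mxof d2; pose D1 := mxof d1; pose DH := mxof dh.
pose L := mxof lift.
pose R := mxof (fun e h => (e == r h)%:R : K).
pose C := mxof (fun k t => (comp t == k)%:R : K).
pose N := mxof (fun (e e' : E) => ((e == e') && ~~ M e)%:R : K).
have D21 : D2 *m D1 = 0.
  by rewrite mul_mxof; apply/matrixP => i j; rewrite !mxE hz.
have LR : L *m R = 1%:M.
  rewrite mul_mxof; apply/matrixP => i j; rewrite !mxE.
  rewrite (bigD1 (r (enum_val j))) //= eqxx mulr1 [X in _ + X]big1 => [|e /negPf ->].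
    by rewrite addr0 hLR (inj_eq enum_val_inj).
  by rewrite mulr0.
have LN : L *m N = 0.
  rewrite mul_mxof; apply/matrixP => i j; rewrite !mxE big1 // => e _.
  by case: (boolP (M e)) => [|/hLM->]; rewrite ?mul0r // andbF mulr0.
have LD : L *m D1 = DH *m mxof root.
  by rewrite !mul_mxof; apply/matrixP => i j; rewrite !mxE hLD.
pose ZL := kermx DH *m L.
pose B := (ZL :&: D2)%MS.
have ZLk : (ZL <= kermx D1)%MS.
  by apply/sub_kermxP; rewrite -mulmxA LD mulmxA mulmx_ker mul0mx.
have D2k : (D2 <= kermx D1)%MS by apply/sub_kermxP.
have rkZL : \rank ZL = \rank (kermx DH).
  apply/eqP; rewrite eqn_leq mxrankM_maxl /=.
  by rewrite -{1}[kermx DH]mulmx1 -LR mulmxA mxrankM_maxl.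
(* Lifted cycles and boundaries both lie in the kernel of [D1], where the boundaries have
   codimension at most [g]; intersecting with them costs at most [g] dimensions. *)
have rB : (\rank (kermx DH) <= \rank B + g)%N.
  have := mxrank_sum_cap ZL D2; have : (\rank (ZL + D2)%MS <= \rank (kermx D1))%N.
    by apply: mxrankS; rewrite addsmx_sub ZLk D2k.
  rewrite mxrank_ker -rkZL -/B; have := rank_leq_row D1.
  by move: hrank; rewrite -/D1 -/D2; lia.
have rBR : \rank (B *m R) = \rank B.
  apply/eqP; rewrite eqn_leq mxrankM_maxl /=.
  have /submxP[X ->] : (B <= L)%MS.
    by apply: submx_trans (capmxSl _ _) _; apply: submxMl.
  by rewrite -!mulmxA LR mulmx1 mxrankM_maxl.
(* A boundary supported on [M] comes from a face function constant on classes, so it is a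
   combination of class boundaries, the rows of [C *m D2]. *)
have BC : (B *m R <= C *m D2 *m R)%MS.
  apply: submxMr; apply/row_subP => k; set u := row k B.
  have uB : (u <= B)%MS by exact: row_sub.
  have /submxP[phi uE] : (u <= D2)%MS.
    by apply: submx_trans uB _; apply: capmxSr.
  have uN : u *m N = 0.
    have /submxP[X ->] : (u <= L)%MS.
      apply: submx_trans uB _; apply: submx_trans (capmxSl _ _) _.
      exact: submxMl.
    by rewrite -mulmxA LN mulmx0.
  pose p j := phi ord0 (enum_rank j).
  have pE : phi = rvof p by rewrite rvofP.
  have hp t : p t = p (comp t).
    apply: hcomp => e Me; move: uN.
    rewrite uE pE !mul_rvof => /rvof0P/(_ e).
    rewrite (bigD1 e) //= eqxx Me mulr1 [X in _ + X]big1 ?addr0 // => e' /negPf->.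
    by rewrite mulr0.
  have -> : u = rvof p *m C *m D2.
    rewrite uE pE; congr (_ *m _); rewrite mul_rvof; apply/rowP => t.
    rewrite !mxE (bigD1 (comp (enum_val t))) //= eqxx mulr1 [X in _ + X]big1 ?addr0 //.
    by move=> k' /negPf; rewrite eq_sym => ->; rewrite mulr0.
  by rewrite -mulmxA submxMl.
have := leq_trans (mxrankS BC) (rank_leq_nonzero_rows _).
rewrite rBR => rB2.
have rk : (#|H| <= #|Y| + \rank (kermx DH))%N.
  by rewrite mxrank_ker; have := rank_leq_col DH; lia.
apply: (leq_trans rk); rewrite -addnA leq_add2l.
apply: (leq_trans rB); rewrite addnC leq_add2l.
apply: (leq_trans rB2).
have -> : C *m D2 *m R =
    mxof (fun k h => \sum_(t | comp t == k) d2 t (r h)).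
  rewrite !mul_mxof; apply/matrixP => i j; rewrite !mxE.
  rewrite (bigD1 (r (enum_val j))) //= eqxx mulr1 [X in _ + X]big1 => [|e /negPf ->].
    rewrite addr0 [RHS]big_mkcond; apply: eq_bigr => t _.
    by case: ifP; rewrite ?mul1r ?mul0r.
  by rewrite mulr0.
rewrite -(card_imset _ enum_val_inj).
apply/subset_leq_card/fintype.subsetP => k.
case/imsetP => i; rewrite !inE => nz ->.
apply: contraNT nz => /existsPn h; apply/eqP/rowP => j; rewrite !mxE.
by apply/eqP; have := h (enum_val j); rewrite negbK.
Qed.

End FunctionMatrices.

Definition fibers_connected (V Y : finType) (e : rel V) (c : V -> option Y) :=
  forall x x', c x = c x' -> c x <> None ->
    connect [rel a b | [&& e a b, c a == c x & c b == c x]] x x'.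

Definition linked (V Y : finType) (e : rel V) (c : V -> option Y) (y y' : Y) :=
  [exists x, exists x', [&& e x x', c x == Some y & c x' == Some y']].

Definition linked_pairs (V Y : finType) (e : rel V) (c : V -> option Y)
    (H : {set {set Y}}) :=
  forall h, h \in H ->
    exists y y', [/\ y != y', linked e c y y' & h = [set y; y']].

(* [c] contracts its fibers and deletes the rest of [V], so that [H] is the edge
   set of a minor; the last clause is the bound for bipartite minors. *)
Definition sparse (g : nat) (V : finType) (e : rel V) :=
  forall (Y : finType) (c : V -> option Y) (H : {set {set Y}}),
    fibers_connected e c -> linked_pairs e c H ->
    (#|H| <= 3 * (#|Y| + g))%N /\
    forall A : {set Y}, (forall h, h \in H -> #|h :&: A| = 1%N) ->
      (#|H| <= 2 * (#|Y| + g))%N.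

Definition skeleton (W : finType) (F : {set {set W}}) : rel W :=
  [rel x y | (x != y) && [exists t in F, (x \in t) && (y \in t)]].

Definition dual_adj (W : finType) (F : {set {set W}}) : rel {set W} :=
  [rel t t' | [&& t \in F, t' \in F & #|t :&: t'| == 2%N]].

(* In such a complex [3 #|F| = 2 #|edges_of F|], so the last clause bounds the
   Euler genus by [g]. *)
Record surface (g : nat) (W : finType) (F : {set {set W}}) : Prop := Surface {
  surface_card3 : forall t, t \in F -> #|t| = 3%N;
  surface_two : forall e, e \in edges_of F ->
    #|[set t in F | e \subset t]| = 2%N;
  surface_dual : forall t t', t \in F -> t' \in F -> connect (dual_adj F) t t';
  surface_euler : (#|F| + 4 <= 2 * #|cover F| + 2 * g)%N }.

(** * Even subgraphs of a simple graph *)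

Section EvenSubgraphs.
Variables (Y : finType) (S : {set {set Y}}).
Hypothesis S2 : forall h, h \in S -> #|h| = 2%N.
Hypothesis evenS : forall y, ~~ odd #|[set h in S | y \in h]|.

Lemma even_subgraph_other (h : {set Y}) (y : Y) :
  h \in S -> y \in h -> exists2 h', h' \in S & (h' != h) && (y \in h').
Proof.
move=> hS yh; have := evenS y.
rewrite (cardsD1 h) !inE hS yh /= negbK => /odd_gt0.
case/card_gt0P => h'; rewrite !inE => /and3P[nh h'S yh'].
by exists h'; rewrite // nh yh'.
Qed.

Lemma edge_of_endpoints (h : {set Y}) (u v : Y) :
  h \in S -> u != v -> u \in h -> v \in h -> h = [set u; v].
Proof.
move=> hS nuv uh vh; apply/esym/eqP; rewrite eqEcard subUset !sub1set uh vh /=.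
by rewrite (S2 hS) cards2 nuv.
Qed.

(** Even degrees extend an edge at both ends; the two extensions differ because an edge is
    determined by its endpoints. *)
Lemma even_subgraph_path : S != set0 -> exists u v h h1 h2,
  [/\ [/\ h \in S, h1 \in S & h2 \in S], [/\ u != v, u \in h & v \in h],
      u \in h1, v \in h2 & uniq [:: h; h1; h2]].
Proof.
case/set0Pn => h hS; have /eqP/cards2P[u [v [nuv hE]]] := S2 hS.
have uh : u \in h by rewrite hE !inE eqxx.
have vh : v \in h by rewrite hE !inE eqxx orbT.
have [h1 h1S /andP[n1 uh1]] := even_subgraph_other hS uh.
have [h2 h2S /andP[n2 vh2]] := even_subgraph_other hS vh.
have h12 : h1 != h2.
  apply: contraNneq n1 => h12.
  by rewrite hE (edge_of_endpoints h1S nuv uh1) // h12.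
exists u, v, h, h1, h2; split=> //=.
by rewrite !inE negb_or ![h == _]eq_sym n1 n2 h12.
Qed.

Lemma even_subgraph_card3 : S != set0 -> (3 <= #|S|)%N.
Proof.
case/even_subgraph_path => u [v [h [h1 [h2 [[hS h1S h2S] _ _ _ un]]]]].
rewrite -[3%N]/(size [:: h; h1; h2]); rewrite -(card_uniqP un).
by apply/subset_leq_card/fintype.subsetP => x; rewrite !inE => /or3P[] /eqP->.
Qed.

(** The path [h1], [h], [h2] continues past the far end [w] of [h1] by an edge [h3]. If [h3] were
    [h2], the three edges would form a triangle, which has no 2-coloring. *)
Lemma bipartite_even_subgraph_card4 (A : {set Y}) :
  (forall h, h \in S -> #|h :&: A| = 1%N) -> S != set0 -> (4 <= #|S|)%N.
Proof.
move=> hA /even_subgraph_path.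
case=> u [v [h [h1 [h2 [[hS h1S h2S] [nuv uh vh] uh1 vh2 un]]]]].
have side h' x y : h' \in S -> x != y -> x \in h' -> y \in h' ->
    (x \in A) = (y \notin A).
  move=> h'S nxy xh yh; have := hA _ h'S.
  rewrite (edge_of_endpoints h'S nxy xh yh) setIUl.
  have [xA|xA] := boolP (x \in A); have [yA|yA] := boolP (y \in A) => //.
    have -> : [set x] :&: A :|: [set y] :&: A = [set x; y].
      by apply/setP => z; rewrite !inE;
        case: eqP => [->|_]; case: eqP => [->|_]; rewrite ?xA ?yA.
    by rewrite cards2 nxy.
  have -> : [set x] :&: A :|: [set y] :&: A = set0.
    apply/setP => z; rewrite !inE.
    by case: eqP => [->|_]; case: eqP => [->|_];
      rewrite ?(negPf xA) ?(negPf yA).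
  by rewrite cards0.
have [w wh1 nwu] : exists2 w, w \in h1 & w != u.
  have h1u : #|h1 :\ u| = 1%N by have := S2 h1S; rewrite (cardsD1 u) uh1; lia.
  have /card_gt0P[w] : (0 < #|h1 :\ u|)%N by rewrite h1u.
  by rewrite !inE => /andP[]; exists w.
have [h3 h3S /andP[n3 wh3]] := even_subgraph_other h1S wh1.
have nwv : w != v.
  apply/eqP => wv; move: un => /=; rewrite !inE negb_or => /andP[/andP[/eqP[]]].
  by rewrite (edge_of_endpoints hS nuv) // (edge_of_endpoints h1S nuv) // -wv.
have un3 : uniq [:: h3; h; h1; h2].
  rewrite cons_uniq un andbT !inE !negb_or n3 /=; apply/andP; split.
    apply/eqP => h3h; move: wh3; rewrite h3h (edge_of_endpoints hS nuv) //.
    by rewrite !inE (negPf nwu) (negPf nwv).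
  apply/eqP => h32; move: wh3; rewrite h32 => wh2.
  have := side _ _ _ hS nuv uh vh; have := side _ _ _ h1S nwu wh1 uh1.
  by have := side _ _ _ h2S nwv wh2 vh2; do 3!case: (_ \in A).
rewrite -[4%N]/(size [:: h3; h; h1; h2]) -(card_uniqP un3).
by apply/subset_leq_card/fintype.subsetP => x;
  rewrite !inE => /or4P[] /eqP->.
Qed.

End EvenSubgraphs.

Lemma addF2 (x : 'F_2) : x + x = 0.
Proof. by case: x => [[|[|//]] ?]; apply/val_inj. Qed.

Lemma addF2_eq0 (x y : 'F_2) : x + y = 0 -> x = y.
Proof. by move=> h; rewrite -[x]addr0 -(addF2 y) addrA h add0r. Qed.

Lemma natF2_eq0 n : (n%:R == 0 :> 'F_2) = ~~ odd n.
Proof.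
rewrite -{1}[n]odd_double_half -addnn natrD natrD addF2 addr0.
by case: (odd _).
Qed.

Lemma F2_neq0 (x : 'F_2) : x = (x != 0)%:R.
Proof. by case: x => [[|[|//]] ?]; apply/val_inj. Qed.

Lemma sum_pair (I : finType) (V : nmodType) (P : pred I) (f : I -> V) (i j : I) :
  i != j -> (forall k, P k = (k == i) || (k == j)) ->
  \sum_(k | P k) f k = f i + f j.
Proof.
move=> nij hP; rewrite (eq_bigl _ _ hP) (bigD1 i) ?eqxx //=.
rewrite (bigD1 j) ?eqxx ?orbT 1?eq_sym //= big1 ?addr0 // => k.
by case: eqP; case: eqP.
Qed.

(** * Homology mod 2 of a triangulated surface *)

Section SurfaceRank.
Variables (g : nat) (W : finType) (F : {set {set W}}).
Hypothesis sF : surface g F.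

Let T := {t | t \in F}.
Let E := {e | e \in edges_of F}.

(** The boundary matrices over F_2, where no orientation has to be chosen. *)
Definition face_edge (t : T) (e : E) : 'F_2 := (val e \subset val t)%:R.
Definition edge_vertex (e : E) (w : W) : 'F_2 := (w \in val e)%:R.

Lemma edge_card2 (e : {set W}) : e \in edges_of F -> #|e| = 2%N.
Proof. by rewrite inE => /andP[/eqP]. Qed.

Lemma edge_faces (e : E) : exists t t' : T,
  [/\ t != t', val e \subset val t, val e \subset val t' &
      forall s : T, (val e \subset val s) = (s == t) || (s == t')].
Proof.
have /eqP/cards2P[a [b [nab hab]]] := surface_two sF (valP e).
have ha : a \in [set t in F | val e \subset t] by rewrite hab !inE eqxx.
have hb : b \in [set t in F | val e \subset t] by rewrite hab !inE eqxx orbT.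
move: (ha) (hb); rewrite !inE => /andP[aF ea] /andP[bF eb].
exists (exist _ a aF), (exist _ b bF); split=> // s.
have /setP/(_ (val s)) := hab; rewrite !inE (valP s) /= => ->.
by rewrite -!val_eqE.
Qed.

Lemma sum_face_edge (phi : T -> 'F_2) (e : E) (t t' : T) :
  t != t' -> (forall s : T, (val e \subset val s) = (s == t) || (s == t')) ->
  \sum_s phi s * face_edge s e = phi t + phi t'.
Proof.
move=> nt ht; rewrite -(sum_pair phi nt ht) [RHS]big_mkcond.
by apply: eq_bigr => s _; rewrite /face_edge; case: ifP; rewrite ?mulr1 ?mulr0.
Qed.

Lemma subface_edge (t e : {set W}) :
  t \in F -> e \subset t -> #|e| = 2%N -> e \in edges_of F.
Proof.
by move=> tF et e2; rewrite inE e2 eqxx /=; apply/existsP; exists t; rewrite tF.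
Qed.

(** A vertex of a triangle lies on exactly two of its sides, and [1 + 1 = 0]. *)
Lemma boundary_of_boundary (t : T) (v : W) :
  \sum_e face_edge t e * edge_vertex e v = 0.
Proof.
have [vt|vt] := boolP (v \in val t); last first.
  rewrite big1 // => e _; rewrite /face_edge /edge_vertex.
  have [et|] := boolP (_ \subset _); last by rewrite mul0r.
  have [ve|] := boolP (v \in val e); last by rewrite mulr0.
  by rewrite (fintype.subsetP et _ ve) in vt.
have t3 := surface_card3 sF (valP t).
have /eqP/cards2P[a [b [nab hab]]] : #|val t :\ v| = 2%N.
  by have := t3; rewrite (cardsD1 v) vt; lia.
have : a \in val t :\ v by rewrite hab !inE eqxx.
have : b \in val t :\ v by rewrite hab !inE eqxx orbT.
rewrite !inE => /andP[nbv bt] /andP[nav at_].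
have sub x : x \in val t -> x != v -> [set v; x] \in edges_of F.
  move=> xt nxv; apply: (subface_edge (valP t)).
    by rewrite subUset !sub1set vt.
  by rewrite cards2 eq_sym nxv.
pose ea : E := exist (fun e => e \in edges_of F) _ (sub _ at_ nav).
pose eb : E := exist (fun e => e \in edges_of F) _ (sub _ bt nbv).
have nE : ea != eb.
  rewrite -val_eqE /=; apply: contraNneq nab => /setP/(_ a).
  by rewrite !inE eqxx orbT (negPf nav) /= => <-.
transitivity (\sum_(e : E | (val e \subset val t) && (v \in val e)) (1 : 'F_2)).
  rewrite [RHS]big_mkcond; apply: eq_bigr => e _; rewrite /face_edge /edge_vertex.
  by case: (_ \subset _); case: (v \in _); rewrite ?mulr1 ?mulr0.
apply: etrans (addF2 1); apply: (sum_pair (fun=> 1) nE) => e.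
apply/andP/orP => [[et ve]|].
  have /eqP/cards1P[x hx] : #|val e :\ v| = 1%N.
    by have := edge_card2 (valP e); rewrite (cardsD1 v) ve; lia.
  have eE : val e = [set v; x] by rewrite -(setD1K ve) hx.
  have : x \in val t :\ v.
    by apply: (fintype.subsetP (setSD _ et)); rewrite hx inE.
  by rewrite hab !inE -!val_eqE /= eE => /orP[] /eqP->; rewrite eqxx; [left|right].
by case=> /eqP->; rewrite /= subUset !sub1set vt ?at_ ?bt !inE eqxx.
Qed.

Lemma double_count_edges : (3 * #|F| = 2 * #|edges_of F|)%N.
Proof.
transitivity (\sum_(t in F) \sum_(e in edges_of F) (e \subset t : nat))%N.
  rewrite mulnC -sum_nat_const; apply: eq_bigr => t tF.
  transitivity 'C(#|t|, 2); first by rewrite (surface_card3 sF tF).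
  rewrite -cards_draws.
  rewrite -sum1_card big_mkcond [RHS]big_mkcond; apply: eq_bigr => e _.
  rewrite inE; case: (boolP (e \subset t)) => [et|_] /=; last by case: ifP.
  case: eqP => [e2|ne2]; first by rewrite (subface_edge tF et e2).
  by case: ifP => // /edge_card2.
rewrite exchange_big /= mulnC -sum_nat_const; apply: eq_bigr => e eE.
rewrite -(surface_two sF eE) -sum1_card big_mkcond [RHS]big_mkcond.
by apply: eq_bigr => t _; rewrite inE; case: (t \in F); case: (e \subset t).
Qed.

(** This bounds the first Betti number by [g]: the two ranks are at least [|F| - 1] and
    [|cover F| - 1] by connectedness, and the Euler inequality does the rest. *)
Lemma surface_rank :
  (#|{: E}| <= \rank (mxof edge_vertex) + \rank (mxof face_edge) + g)%N.
Proof.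
have r2 : (#|{: T}| <= \rank (mxof face_edge) + 1)%N.
  apply: rank_of_constant_kernel => u hu t t'.
  have /connectP[p] := surface_dual sF (valP t) (valP t').
  elim: p t => [|s p IH] t /=; first by move=> _ /val_inj->.
  case/andP=> /and3P[_ sF' ts] ps lst.
  rewrite -(IH (exist (fun t => t \in F) s sF')) //.
  have eE : val t :&: s \in edges_of F.
    by apply: (subface_edge (valP t)) (eqP ts); exact: subsetIl.
  have [a [b [nab ea eb hab]]] := edge_faces (exist (fun e => e \in edges_of F) _ eE).
  have := hu (exist (fun e => e \in edges_of F) _ eE); rewrite (sum_face_edge _ nab hab).
  have := hab t; have := hab (exist (fun t => t \in F) s sF'); rewrite /= subsetIl subsetIr.
  by move=> /esym/orP[]/eqP-> /esym/orP[]/eqP-> => [|/addF2_eq0|/addF2_eq0/esym|].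
(* A vertex in no triangle is on no edge and would enlarge the kernel; [S] restricts to the
   others. *)
pose V := {v | v \in cover F}.
pose S := mxof (fun (w : W) (v : V) => (w == val v)%:R : 'F_2).
have r1 : (#|{: V}| <= \rank (mxof edge_vertex) + 1)%N.
  apply: (@leq_trans (\rank (mxof edge_vertex *m S) + 1)); last first.
    by rewrite leq_add2r mxrankM_maxl.
  rewrite -mxrank_tr mul_mxof.
  have -> : (mxof (fun e l => \sum_j edge_vertex e j * (j == val l)%:R))^T =
      mxof (fun (v : V) e => edge_vertex e (val v)).
    apply/matrixP => i j; rewrite !mxE (bigD1 (val (enum_val i))) //=.
    by rewrite eqxx mulr1 big1 ?addr0 // => k /negPf->; rewrite mulr0.
  apply: rank_of_constant_kernel => u hu v v'.
  have edge x y (xV : x \in cover F) (yV : y \in cover F) t : t \in F ->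
      x \in t -> y \in t -> u (exist (fun v => v \in cover F) x xV) =
      u (exist (fun v => v \in cover F) y yV).
    move=> tF xt yt; have [exy|nxy] := eqVneq x y.
      by congr u; apply: val_inj.
    have eE : [set x; y] \in edges_of F.
      by apply: (subface_edge tF); rewrite ?subUset ?sub1set ?xt ?cards2 ?nxy.
    apply: addF2_eq0; rewrite -(hu (exist (fun e => e \in edges_of F) _ eE)).
    rewrite -(@sum_pair _ _ (fun k => val k \in [set x; y]) u) //.
      rewrite big_mkcond; apply: eq_bigr => k _; rewrite /edge_vertex /=.
      by case: ifP; rewrite ?mulr1 ?mulr0.
    by move=> k; rewrite !inE -!val_eqE.
  have /bigcupP[t tF vt] := valP v; have /bigcupP[t' tF' vt'] := valP v'.
  have /connectP[p] := surface_dual sF tF tF'.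
  elim: p t tF v vt => [|s p IH] t tF v vt /=.
    move=> _ tt'; rewrite tt' in vt'; case: v vt => v ? /= vt.
    by case: v' vt' => v' ? /= vt'; apply: edge tF _ _.
  case/andP=> /and3P[_ sF' /eqP ts] ps lst.
  have /card_gt0P[x] : (0 < #|t :&: s|)%N by rewrite ts.
  rewrite inE => /andP[xt xs].
  have xV : x \in cover F by apply/bigcupP; exists t.
  rewrite -(IH s sF' (exist (fun v => v \in cover F) x xV)) //.
  by case: v vt => v ? /= vt; apply: edge tF _ _.
have := surface_euler sF; have := double_count_edges; move: r1 r2.
move: (\rank (mxof edge_vertex)) (\rank (mxof face_edge)) => m n.
have cV : #|{: V}| = #|cover F| by rewrite card_sig.
have cT : #|{: T}| = #|F| by rewrite card_sig.
have cE : #|{: E}| = #|edges_of F| by rewrite card_sig.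
by rewrite cV cT cE; lia.
Qed.

End SurfaceRank.

(** * Faces of a minor of the 1-skeleton *)

Section SurfaceSparse.
Variables (g : nat) (W : finType) (F : {set {set W}}).
Hypothesis sF : surface g F.

Let T := {t | t \in F}.
Let E := {e | e \in edges_of F}.

Lemma skeletonE x y : skeleton F x y = (x != y) && ([set x; y] \in edges_of F).
Proof.
rewrite /skeleton /=; have [//|nxy] := eqVneq x y; rewrite inE cards2 nxy /=.
by apply: eq_existsb => t; rewrite subUset !sub1set.
Qed.

Lemma edge_vertexE (e : E) x x' v : x != x' -> val e = [set x; x'] ->
  edge_vertex e v = (v == x)%:R + (v == x')%:R.
Proof.
move=> nx ex; rewrite /edge_vertex ex !inE.
have [->|] := eqVneq v x; first by rewrite (negPf nx) addr0.
by rewrite add0r.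
Qed.

Lemma exists_edge (e : {set W}) : e \in edges_of F -> exists e' : E, val e' = e.
Proof. by move=> eE; exists (exist (fun e => e \in edges_of F) e eE). Qed.

Variables (Y : finType) (c : W -> option Y) (H : {set {set Y}}).
Hypothesis fibc : fibers_connected (skeleton F) c.
Hypothesis linkc : linked_pairs (skeleton F) c H.

Let HT := {h | h \in H}.

Definition inner_edge (e : E) :=
  [exists y, [forall x, (x \in val e) ==> (c x == Some y)]].

(** The chain is a path inside the fiber, whose boundary mod 2 consists of its two ends. *)
Lemma fiber_chain x x' : c x = c x' -> c x <> None -> exists q : E -> 'F_2,
  (forall e, ~~ inner_edge e -> q e = 0) /\
  forall v, \sum_e q e * edge_vertex e v = (v == x)%:R + (v == x')%:R.
Proof.
move=> cxx cx; have /connectP[p] := fibc cxx cx.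
suff ext z : c z = c x ->
    path [rel a b | [&& skeleton F a b, c a == c x & c b == c x]] z p ->
    x' = last z p -> exists q : E -> 'F_2,
    (forall e, ~~ inner_edge e -> q e = 0) /\
    forall v, \sum_e q e * edge_vertex e v = (v == z)%:R + (v == x')%:R.
  by move=> px lx; apply: ext.
elim: p z => [|b p IH] z cz /=.
  move=> _ ->; exists (fun=> 0); split=> // v.
  by rewrite addF2 big1 // => e _; rewrite mul0r.
case/andP=> /and3P[zb _ /eqP cb] pp lst.
have [q [q0 hq]] := IH b cb pp lst.
move: zb; rewrite skeletonE => /andP[nzb /exists_edge[e eE]].
have inn : inner_edge e.
  case cxE : (c x) cx => [y|//] _; apply/existsP; exists y.
  apply/forallP => a; apply/implyP; rewrite eE !inE => /orP[] /eqP->.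
    by rewrite cz cxE.
  by rewrite cb cxE.
exists (fun e' => (e' == e)%:R + q e'); split=> [e' ne'|v].
  rewrite q0 // addr0; case: eqP => // e'e.
  by rewrite e'e inn in ne'.
under eq_bigr do rewrite mulrDl.
rewrite big_split /= hq (bigD1 e) //= eqxx mul1r big1 => [|e' /negPf->]; last first.
  by rewrite mul0r.
rewrite addr0 (edge_vertexE v nzb eE).
by rewrite -addrA [X in _ + X]addrA addF2 add0r.
Qed.

Lemma link_data : exists R : HT -> E * (W * W) * (Y * Y), forall h,
  let: (e, (x, x'), (y, y')) := R h in
  [/\ x != x', val e = [set x; x'], c x = Some y /\ c x' = Some y',
      y != y' & val h = [set y; y']].
Proof.
suff /choice[R hR] : forall h : HT, exists p : E * (W * W) * (Y * Y),
    let: (e, (x, x'), (y, y')) := p in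
    [/\ x != x', val e = [set x; x'], c x = Some y /\ c x' = Some y',
        y != y' & val h = [set y; y']].
  by exists R.
move=> h; have [y [y' [ny /existsP[x /existsP[x']]]]] := linkc (valP h).
case/and3P; rewrite skeletonE => /andP[nx /exists_edge[e eE]] /eqP cx /eqP cx' hE.
by exists (e, (x, x'), (y, y')).
Qed.

(** [r h] is a skeleton edge representing [h], and [lift h] completes it by fiber chains to fixed
    roots of its two branch sets. All edges of the minor at [y] then end in the same root, so that
    lifts of cycles are cycles. *)
Lemma minor_lift : exists (r : HT -> E) (lift : HT -> E -> 'F_2)
    (root : Y -> W -> 'F_2),
  [/\ injective r,
      forall h y, \sum_(v | c v == Some y) edge_vertex (r h) v = (y \in val h)%:R,
      forall h h', lift h (r h') = (h == h')%:R,
      forall h v, \sum_e lift h e * edge_vertex e v =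
        \sum_y (y \in val h)%:R * root y v &
      forall h e, ~~ (inner_edge e || (e \in codom r)) -> lift h e = 0].
Proof.
have [R hR] := link_data; pose r h := (R h).1.1.
have sumr h y :
    \sum_(v | c v == Some y) edge_vertex (r h) v = (y \in val h)%:R.
  move: (hR h); rewrite /r; case: (R h) => [[e [x x']] [z z']] /=.
  case=> nx eE [cx cx'] nz ->; rewrite !inE.
  under eq_bigr do rewrite (edge_vertexE _ nx eE).
  have one u w : c u = Some w ->
      \sum_(v | c v == Some y) (v == u)%:R = (y == w)%:R :> 'F_2.
    move=> cu; rewrite big_mkcond (bigD1 u) //= cu eqxx big1 ?addr0 => [|v /negPf->].
      by rewrite (inj_eq Some_inj) eq_sym; case: eqP.
    by case: ifP.
  rewrite big_split /= (one _ _ cx) (one _ _ cx').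
  have [->|] := eqVneq y z; first by rewrite (negPf nz) addr0.
  by rewrite add0r.
have rinj : injective r.
  move=> h h' hh; apply: val_inj; apply/setP => y.
  have := sumr h y; rewrite hh sumr.
  by case: (y \in _); case: (y \in _).
have rinn h : ~~ inner_edge (r h).
  move: (hR h); rewrite /r; case: (R h) => [[e [x x']] [z z']] /=.
  case=> nx eE [cx cx'] nz _; apply/existsP => -[y /forallP hy].
  have := hy x; have := hy x' => /=; rewrite eE !inE !eqxx orbT /= cx cx'.
  by move=> /eqP[] zy /eqP[] zy'; rewrite zy zy' eqxx in nz.
(* Only an empty fiber has no root; no edge of [H] ends there, so the value 0 of [root] is
   harmless. *)
pose rt y := [pick v | c v == Some y].
pose root y (v : W) : 'F_2 := if rt y is Some w then (v == w)%:R else 0.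
have rtP x y : c x = Some y -> exists2 w, rt y = Some w & c w = Some y.
  rewrite /rt => cx; case: pickP => [w /eqP cw|/(_ x)]; first by exists w.
  by rewrite cx eqxx.
have /choice[lift hl] : forall h, exists l : E -> 'F_2,
   [/\ forall h', l (r h') = (h == h')%:R,
      forall v, \sum_e l e * edge_vertex e v =
        \sum_y (y \in val h)%:R * root y v &
      forall e, ~~ (inner_edge e || (e \in codom r)) -> l e = 0].
  move=> h; move: (hR h); case RE : (R h) => [[e [x x']] [z z']] /=.
  case=> nx eE [cx cx'] nz hE.
  have [w rw cw] := rtP _ _ cx; have [w' rw' cw'] := rtP _ _ cx'.
  have [|//|q [q0 hq]] := @fiber_chain x w; rewrite ?cx ?cw //.
  have [|//|q' [q0' hq']] := @fiber_chain x' w'; rewrite ?cx' ?cw' //.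
  have rh : r h = e by rewrite /r RE.
  exists (fun e' => (e' == e)%:R + (q e' + q' e')); split=> [h'|v|e' ne'].
  - by rewrite q0 ?q0' ?rinn // !addr0 -rh (inj_eq rinj) eq_sym.
  - under eq_bigr do rewrite !mulrDl.
    rewrite !big_split /= hq hq' (bigD1 e) //= eqxx mul1r.
    rewrite big1 => [|e' /negPf->]; last by rewrite mul0r.
    rewrite addr0 (edge_vertexE v nx eE) (bigD1 z) //= (bigD1 z') 1?eq_sym //=.
    rewrite big1 => [|y /andP[/negPf nyz /negPf nyz']]; last first.
      by rewrite hE !inE nyz nyz' mul0r.
    rewrite /root rw rw' hE !inE !eqxx orbT !mul1r addr0 [LHS]addrACA.
    by rewrite [X in X + _]addrA [X in _ + X]addrA !addF2 !add0r.
  move: ne'; rewrite negb_or => /andP[ie ce].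
  rewrite q0 // q0' // !addr0; case: eqP => // e'e; case/negP: ce.
  by rewrite e'e -rh codom_f.
exists r, lift, root; split=> // [h h'|h v|h e he].
- by case: (hl h).
- by case: (hl h).
- by case: (hl h) => _ _ ->.
Qed.

(** [k] counts the classes of triangles whose boundary contains some representative edge. Such a
    boundary restricts to a nonempty even subgraph of [H], and each edge of [H] is on at most two of
    them. *)
Lemma minor_faces (L : nat) :
  (forall S : {set {set Y}}, S \subset H ->
     (forall y, ~~ odd #|[set h in S | y \in h]|) -> S != set0 ->
     (L <= #|S|)%N) ->
  exists k : nat, (#|H| <= #|Y| + g + k)%N /\ (L * k <= 2 * #|H|)%N.
Proof.
move=> hL; have [r [lift [root [rinj sumr liftr liftD liftM]]]] := minor_lift.
pose M e := inner_edge e || (e \in codom r).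
pose dual : rel T := [rel t t' : T | [exists e : E,
  [&& ~~ M e, val e \subset val t & val e \subset val t']]].
have dualC : connect_sym dual.
  apply: sym_connect_sym => t t'; apply: eq_existsb => e.
  by congr (_ && _); rewrite andbC.
pose comp t := fingraph.root dual t.
have const phi : (forall e, ~~ M e -> \sum_t phi t * face_edge t e = 0) ->
    forall t, phi t = phi (comp t).
  move=> h0 t; have /connectP[p] := connect_root dual t; rewrite -/(comp t).
  move: (comp t) => t'; elim: p t => [|s p IH] t /=; first by move=> _ ->.
  case/andP => /existsP[e /and3P[Me et es]] ps lst; rewrite -(IH s ps lst).
  have [a [b [nab ea eb hab]]] := edge_faces sF e.
  have := h0 e Me; rewrite (sum_face_edge _ nab hab).
  move: et es; rewrite !hab.
  by move=> /orP[]/eqP-> /orP[]/eqP-> => [|/addF2_eq0|/addF2_eq0/esym|].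
pose C k h := \sum_(t | comp t == k) face_edge t (r h).
pose K := [set k | [exists h, C k h != 0]].
have Hc : #|{: HT}| = #|H| by rewrite card_sig.
exists #|K|; split.
  rewrite -Hc.
  exact: (nonzero_faces_bound (boundary_of_boundary sF) (surface_rank sF)
    liftr liftD liftM const).
pose N k := [set h | C k h != 0].
have NL k : k \in K -> (L <= #|N k|)%N.
  rewrite inE => /existsP[h0 nz0].
  pose S := [set val h | h in N k].
  have <- : #|S| = #|N k| by rewrite card_imset //; exact: val_inj.
  apply: hL; last first.
  - by apply/set0Pn; exists (val h0); apply: imset_f; rewrite inE.
  - move=> y; rewrite -natF2_eq0.
    have -> : [set h in S | y \in h] = [set val h | h in [set h in N k | y \in val h]].
      apply/setP => s; rewrite !inE; apply/andP/imsetP.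
        by case=> /imsetP[h hN ->] yh; exists h => //; rewrite inE hN yh.
      by case=> h; rewrite inE => /andP[hN yh] ->; split=> //; apply: imset_f.
    rewrite card_imset; last exact: val_inj.
    pose z e := \sum_(t | comp t == k) face_edge t e.
    have z0 e : ~~ M e -> z e = 0.
      move=> Me; have [a [b [nab ea eb hab]]] := edge_faces sF e.
      have cab : comp a = comp b.
        apply/(fingraph.rootP dualC)/connect1; apply/existsP; exists e.
        by rewrite Me ea eb.
      have := sum_face_edge (fun t => (comp t == k)%:R) nab hab.
      rewrite cab addF2 => <-; rewrite /z big_mkcond; apply: eq_bigr => t _.
      by case: ifP; rewrite ?mul1r ?mul0r.
    (* Summed over the fiber of [y], a contracted edge has both ends or none there and cancels,
       while [z] vanishes off [M]. What remains is the degree of [y] in [S], mod 2. *)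
    have : \sum_(v | c v == Some y) \sum_e z e * edge_vertex e v = 0.
      rewrite big1 // => v _; rewrite /z.
      under eq_bigr do rewrite mulr_suml.
      rewrite exchange_big big1 //= => t _.
      exact: (boundary_of_boundary sF).
    rewrite exchange_big /=; under eq_bigr do rewrite -mulr_sumr.
    rewrite (bigID (mem (codom r))) /= addrC big1 ?add0r; last first.
      move=> e ce; have [ie|ie] := boolP (inner_edge e); last first.
        by rewrite z0 ?mul0r // /M negb_or ie ce.
      have [x [x' [nx eE]]] : exists x x', x != x' /\ val e = [set x; x'].
        have /eqP/cards2P[x [x' [nx eE]]] := edge_card2 (valP e).
        by exists x, x'.
      have /existsP[w /forallP hw] := ie.
      rewrite (_ : \sum_(v | _) _ = 0) ?mulr0 //.
      under eq_bigr do rewrite (edge_vertexE _ nx eE).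
      have one u : u \in val e ->
          \sum_(v | c v == Some y) (v == u)%:R = (y == w)%:R :> 'F_2.
        move=> ue; have := hw u; rewrite ue /= => /eqP cu.
        rewrite big_mkcond (bigD1 u) //= cu eqxx big1 ?addr0 => [|v /negPf->].
          by rewrite (inj_eq Some_inj) eq_sym; case: eqP.
        by case: ifP.
      by rewrite big_split /= !one ?addF2 // eE !inE eqxx ?orbT.
    move=> <-; apply/eqP; rewrite -sum1_card natr_sum.
    transitivity (\sum_h C k h * (y \in val h)%:R).
      rewrite big_mkcond /=; apply: eq_bigr => h _; rewrite !inE.
      rewrite [C k h in RHS]F2_neq0.
      by case: (C k h != 0); case: (y \in val h); rewrite ?mulr0 ?mulr1.
    rewrite [RHS](eq_bigl (mem (r @: setT))); last first.
      by move=> e; apply/codomP/imsetP => [[h ->]|[h _ ->]]; exists h.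
    rewrite big_imset /=; last by move=> ? ? _ _; exact: rinj.
    by apply: eq_big => h; [rewrite inE|rewrite sumr].
  apply/fintype.subsetP => s /imsetP[h _ ->]; exact: (valP h).
(* Only the classes of the two triangles on [r h] can have it in their boundary. *)
have Nc h : (#|[set k | C k h != 0%R]| <= 2)%N.
  have [a [b [nab ea eb hab]]] := edge_faces sF (r h).
  apply: (@leq_trans #|[set comp a; comp b]|); last by rewrite cards2; case: eqP.
  apply/subset_leq_card/fintype.subsetP => k; rewrite !inE; apply: contraNT.
  rewrite negb_or => /andP[ka kb]; rewrite /C big1 // => t /eqP ct.
  rewrite /face_edge; case: (boolP (_ \subset _)) => //; rewrite hab.
  by case/orP=> /eqP tE; rewrite -ct tE eqxx in ka kb.
rewrite -Hc -cardsT mulnC -sum_nat_const.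
apply: (@leq_trans (\sum_(k in K) #|N k|)%N); first exact: leq_sum.
apply: (@leq_trans (\sum_k #|N k|)%N).
  by rewrite [X in (_ <= X)%N](bigID (mem K)) /= leq_addr.
have -> : (\sum_k #|N k| = \sum_h #|[set k | C k h != 0%R]|)%N.
  under eq_bigr do rewrite -sum1_card big_mkcond /=.
  rewrite exchange_big /=; apply: eq_bigr => h _.
  rewrite -sum1_card [RHS]big_mkcond /=; apply: eq_bigr => k _.
  by rewrite !inE.
rewrite mulnC -sum_nat_const big_mkcond [X in (_ <= X)%N]big_mkcond.
by apply: leq_sum => h _; rewrite inE.
Qed.

End SurfaceSparse.

Lemma linked_pairs_card2 (V Y : finType) (e : rel V) (c : V -> option Y) H h :
  linked_pairs e c H -> h \in H -> #|h| = 2%N.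
Proof. by move=> hH /hH[y [y' [ny _ ->]]]; rewrite cards2 ny. Qed.

(** Eliminate [k] between [|H| <= |Y| + g + k] and [L k <= 2 |H|], with [L = 3] in general and
    [L = 4] in the bipartite case. *)
Theorem surface_sparse (g : nat) (W : finType) (F : {set {set W}}) :
  surface g F -> sparse g (skeleton F).
Proof.
move=> sF Y c H fc lc; have H2 h := linked_pairs_card2 (h := h) lc.
have H2' (S : {set {set Y}}) : S \subset H -> forall h, h \in S -> #|h| = 2%N.
  by move=> /fintype.subsetP SH h /SH/H2.
split=> [|A hA].
  have [S SH ev nz|k] := @minor_faces _ _ _ sF _ _ _ fc lc 3.
    exact: even_subgraph_card3 (H2' _ SH) ev nz.
  lia.
have [S SH ev nz|k] := @minor_faces _ _ _ sF _ _ _ fc lc 4.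
  apply: (bipartite_even_subgraph_card4 (H2' _ SH) ev) nz => h hS.
  exact/hA/(fintype.subsetP SH).
lia.
Qed.

(** * Minors *)

(** A minor of a minor is a minor: a path in a fiber of [c] lifts edge by edge through [linked], and
    consecutive lifted edges are joined inside a fiber of [c0]. *)
Lemma sparse_minor (g : nat) (W V : finType) (eW : rel W) (e : rel V)
    (c0 : W -> option V) :
  fibers_connected eW c0 -> (forall u v, e u v -> linked eW c0 u v) ->
  sparse g eW -> sparse g e.
Proof.
move=> fc0 lc0 sp Y c H fc lc; apply: (sp Y (fun w => obind c (c0 w)) H); last first.
  move=> h /lc[y [y' [ny /existsP[x /existsP[x' /and3P[xx cx cx']]] ->]]].
  exists y, y'; split=> //; have /existsP[w /existsP[w']] := lc0 _ _ xx.
  case/and3P=> ww /eqP cw /eqP cw'; apply/existsP; exists w.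
  by apply/existsP; exists w'; rewrite ww cw cw' /= cx cx'.
move=> w w'; case cw: (c0 w) => [u|] //=; case cw': (c0 w') => [u'|] /= cu cn;
  last by rewrite cu in cn.
have /connectP[p] := fc _ _ cu cn.
suff ext z x : c z = c u -> c0 x = Some z ->
    path [rel a b | [&& e a b, c a == c u & c b == c u]] z p -> u' = last z p ->
    connect [rel a b | [&& eW a b, obind c (c0 a) == c u
                        & obind c (c0 b) == c u]] x w'.
  by move=> pz lz; apply: ext pz lz.
elim: p z x => [|b p IH] z x cz cx /=.
  move=> _ uz; have cxw : c0 x = c0 w' by rewrite cx cw' uz.
  have cxn : c0 x <> None by rewrite cx.
  have := fc0 _ _ cxw cxn; rewrite cx; apply: connect_sub => a b /and3P[ab /eqP ca /eqP cb].
  by apply: connect1; rewrite /= ab ca cb /= cz eqxx.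
case/andP=> /and3P[zb _ /eqP cb] pb lb.
have /existsP[a /existsP[a' /and3P[aa /eqP ca /eqP ca']]] := lc0 _ _ zb.
apply: (@connect_trans _ _ a); last first.
  apply: (@connect_trans _ _ a'); last exact: IH pb lb.
  by apply: connect1; rewrite /= aa ca ca' /= cz cb eqxx.
have cxa : c0 x = c0 a by rewrite cx ca.
have cxn : c0 x <> None by rewrite cx.
have := fc0 _ _ cxa cxn; rewrite cx; apply: connect_sub => d d' /and3P[dd /eqP cd /eqP cd'].
by apply: connect1; rewrite /= dd cd cd' /= cz eqxx.
Qed.

Definition connected_in (W : finType) (e : rel W) (S : {set W}) :=
  forall x y, x \in S -> y \in S ->
    connect [rel a b | [&& e a b, a \in S & b \in S]] x y.

Lemma connect_crossing (W : finType) (r : rel W) (A : {set W}) x y :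
  connect r x y -> x \in A -> y \notin A ->
  exists a b, [/\ r a b, a \in A & b \notin A].
Proof.
case/connectP=> p; elim: p x => [|z p IH] x /=; first by move=> _ -> ->.
case/andP=> xz pz lz xA yA; have [zA|zA] := boolP (z \in A); first exact: IH pz lz zA yA.
by exists x, z.
Qed.

Section MinorOfSystem.
Variables (W V : finType) (eW : rel W) (e : rel V).
Variables (Nv : V -> {set W}) (Ne : V -> V -> {set W}).
Hypothesis eW_sym : symmetric eW.
Hypothesis e_sym : symmetric e.
Hypothesis e_irr : irreflexive e.
Hypothesis Nv_conn : forall u, connected_in eW (Nv u).
Hypothesis Ne_conn : forall u v, e u v -> connected_in eW (Ne u v).
Hypothesis Nv_disj : forall u v w, w \in Nv u -> w \in Nv v -> u = v.
Hypothesis Ne_disj : forall u v u' v' w, e u v -> e u' v' ->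
  w \in Ne u v -> w \in Ne u' v' -> [set u; v] = [set u'; v'].
Hypothesis Nev_disj : forall u v x w, e u v ->
  w \in Ne u v -> w \in Nv x -> (x == u) || (x == v).
Hypothesis Nev_meet : forall u v, e u v ->
  (exists2 w, w \in Ne u v & w \in Nv u) /\ exists2 w, w \in Ne u v & w \in Nv v.

(* The part of [Ne u v] that gets absorbed into the branch set of [u]. *)
Let inner u v := [rel a b | [&& eW a b, a \in Ne u v :\: Nv v
                                      & b \in Ne u v :\: Nv v]].
Let A u v := [set w in Ne u v :\: Nv v |
  [exists x in Ne u v :&: Nv u, connect (inner u v) x w]].
(** An edge is absorbed only from its endpoint of smaller rank, as [Ne u v] and [Ne v u] may
    overlap. *)
Let lower u v := e u v && (enum_rank u < enum_rank v)%N.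
Let c w := if [pick u | w \in Nv u] is Some u then Some u else
  omap (fun p => p.1) [pick p : V * V | lower p.1 p.2 && (w \in A p.1 p.2)].

Let cP w u : c w = Some u <->
  w \in Nv u \/ (forall x, w \notin Nv x) /\ exists2 v, lower u v & w \in A u v.
Proof.
rewrite /c; case: pickP => [x wx|wN].
  split=> [[<-]|]; first by left.
  by case=> [wu|[/(_ x)]]; rewrite ?wx // (Nv_disj wx wu).
case: pickP => [[a b] /= /andP[ab wA]|nA]; split=> //=.
- by move=> [<-]; right; split; [move=> x; rewrite wN|exists b].
- case=> [|[_ [v uv wA']]]; first by rewrite wN.
  move: (ab) (uv) => /andP[eab ltab] /andP[euv ltuv].
  move: wA wA'; rewrite !inE => /andP[/andP[_ w1] _] /andP[/andP[_ w2] _].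
  have h := Ne_disj eab euv w1 w2.
  have : u \in [set a; b] by rewrite h !inE eqxx.
  rewrite !inE => /orP[/eqP-> //|/eqP ub].
  have : v \in [set a; b] by rewrite h !inE eqxx orbT.
  rewrite !inE => /orP[/eqP va|/eqP vb].
    by move: ltuv; rewrite ub va ltnNge ltnW.
  by move: euv; rewrite ub vb e_irr.
- case=> [|[_ [v uv wA']]]; first by rewrite wN.
  by have := nA (u, v); rewrite /= uv wA'.
Qed.

Let AB u v w : lower u v -> w \in A u v -> c w = Some u.
Proof.
move=> uv wA; apply/cP; have [x wx|h] := pickP (fun x => w \in Nv x).
  move: (wA) (uv); rewrite inE => /andP[]; rewrite inE => /andP[wNv wNe] _.
  case/andP=> euv _; have /orP[/eqP xu|/eqP xv] := Nev_disj euv wNe wx.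
    by left; rewrite -xu.
  by rewrite -xv wx in wNv.
by right; split; [move=> x; rewrite h|exists v].
Qed.

Let A_step u v a b : a \in A u v -> inner u v a b -> b \in A u v.
Proof.
rewrite inE => /andP[aS /existsP[x /andP[xS ca]]] ab.
have bS : b \in Ne u v :\: Nv v by case/and3P: ab.
rewrite inE bS; apply/existsP; exists x; rewrite xS /=.
by apply: (@connect_trans _ _ a) => //; apply: connect1.
Qed.

Let A_start u v x : e u v -> x \in Ne u v -> x \in Nv u -> x \in A u v.
Proof.
move=> uv xe xu; rewrite !inE xe andbT; apply/andP; split.
  by apply/negP => /(Nv_disj xu) h; rewrite h e_irr in uv.
by apply/existsP; exists x; rewrite !inE xe xu connect0.
Qed.

Let in_fiber u := [rel a b | [&& eW a b, c a == Some u & c b == Some u]].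

Let in_fiber_sym u : connect_sym (in_fiber u).
Proof.
by apply: sym_connect_sym => a b; rewrite /= eW_sym; congr (_ && _); rewrite andbC.
Qed.

Let reach_Nv u w : c w = Some u ->
  exists2 x, x \in Nv u & connect (in_fiber u) x w.
Proof.
case/cP=> [wu|[_ [v uv]]]; first by exists w; rewrite ?connect0.
rewrite inE => /andP[_ /existsP[x /andP[]]]; rewrite inE => /andP[xe xu].
move=> /connectP[p pp ->]; exists x => //.
have: x \in A u v by apply: A_start => //; case/andP: uv.
elim: p x {xe xu} pp => [|z p IH] x /= pp xA; first exact: connect0.
case/andP: pp => xz pz; have zA := A_step xA xz.
apply: (@connect_trans _ _ z) (IH z pz zA); apply: connect1.
by case/and3P: xz => /= -> _ _; rewrite (AB uv xA) (AB uv zA) eqxx.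
Qed.

(** The branch set of [u] is [Nv u] together with the absorbed parts [A u v]. A path in [Ne u v]
    from [Nv u] to [Nv v] has to leave [A u v], and by maximality of [A u v] it does so into [Nv v];
    this edge links the two branch sets. *)
Lemma minor_of_system :
  exists c : W -> option V,
    fibers_connected eW c /\ forall u v, e u v -> linked eW c u v.
Proof.
exists c; split=> [w w' cww|u v uv].
  case cw : (c w) cww => [u|] // /esym cw' _.
  have [x xu xw] := reach_Nv cw; have [x' xu' xw'] := reach_Nv cw'.
  rewrite in_fiber_sym in xw. apply: connect_trans xw (connect_trans _ xw').
  have := Nv_conn xu xu'; apply: connect_sub => a b /and3P[ab au bu].
  apply: connect1; rewrite /= ab.
  have -> : c a = Some u by apply/cP; left.
  have -> : c b = Some u by apply/cP; left.
  by rewrite eqxx.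
wlog lt : u v uv / (enum_rank u < enum_rank v)%N.
  move=> th; have [|lt|/ord_inj/enum_rank_inj uv'] := ltngtP (enum_rank u) (enum_rank v).
  - exact: th.
  - have vu : e v u by rewrite e_sym.
    have /existsP[a /existsP[b /and3P[ab ca cb]]] := th _ _ vu lt.
    by apply/existsP; exists b; apply/existsP; exists a; rewrite eW_sym ab ca cb.
  by rewrite uv' e_irr in uv.
have luv : lower u v by rewrite /lower uv.
have [[x xe xu] [y ye yv]] := Nev_meet uv.
have yA : y \notin A u v by rewrite !inE yv.
have [a [b [/and3P[ab ae be] aA bA]]] :=
  connect_crossing (Ne_conn uv xe ye) (A_start uv xe xu) yA.
have bv : b \in Nv v.
  apply: contraNT bA => bv; apply: (A_step aA).
  by move: (aA); rewrite inE => /andP[aS _]; rewrite /= ab aS inE bv be.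
apply/existsP; exists a; apply/existsP; exists b; rewrite ab (AB luv aA) eqxx /=.
by apply/eqP/cP; left.
Qed.

End MinorOfSystem.

(** * The midpoint subdivision *)

Lemma set2_sub (T : finType) (a b : T) (t : {set T}) :
  ([set a; b] \subset t) = (a \in t) && (b \in t).
Proof. by rewrite subUset !sub1set. Qed.

Section Midpoint.
Variable W : finType.
Implicit Types (a b c : W) (s t : {set W}) (F : {set {set W}}).

(* The midpoint subdivision cuts each triangle into four; its vertices are the
   vertices [a] and the midpoints of the edges [ab], encoded by the sets [{a}]
   and [{a, b}]. *)
Definition corner a t : {set {set W}} :=
  [set s : {set W} | [&& s \subset t, a \in s & (#|s| <= 2)%N]].
Definition middle t : {set {set W}} :=
  [set s : {set W} | (s \subset t) && (#|s| == 2%N)].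
Definition midpoint F : {set {set {set W}}} :=
  [set middle t | t in F] :|:
  [set corner p.1 p.2 | p in [set p : W * {set W} | (p.2 \in F) && (p.1 \in p.2)]].

Lemma midpointP F (tau : {set {set W}}) :
  tau \in midpoint F <->
  (exists2 t, t \in F & tau = middle t) \/
  exists a t, [/\ t \in F, a \in t & tau = corner a t].
Proof.
rewrite inE; split=> [/orP[/imsetP[t]|/imsetP[[a t]]]|].
- by left; exists t.
- by rewrite inE => /andP[tF at_] ->; right; exists a, t.
case=> [[t tF ->]|[a [t [tF at_ ->]]]]; first by rewrite imset_f.
by apply/orP; right; apply/imsetP; exists (a, t); rewrite ?inE ?tF.
Qed.

Lemma card3P t a : #|t| = 3%N -> a \in t -> exists b c,
  [/\ a != b, a != c, b != c & t = [set a; b; c]].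
Proof.
move=> t3 at_; have /eqP/cards2P[b [c [nbc tE]]] : #|t :\ a| = 2%N.
  by move: t3; rewrite (cardsD1 a) at_; lia.
have : b \in t :\ a by rewrite tE !inE eqxx.
have : c \in t :\ a by rewrite tE !inE eqxx orbT.
rewrite !inE => /andP[nc _] /andP[nb _]; exists b, c.
by split; rewrite ?[a == _]eq_sym // -setUA -tE setD1K.
Qed.

Lemma set2_other a s : a \in s -> #|s| = 2%N -> exists2 b, a != b & s = [set a; b].
Proof.
move=> as_ s2; have /eqP/cards1P[b sE] : #|s :\ a| = 1%N.
  by move: s2; rewrite (cardsD1 a) as_; lia.
have : b \in s :\ a by rewrite sE inE.
by rewrite !inE => /andP[nb _]; exists b; rewrite 1?eq_sym // -sE setD1K.
Qed.

Lemma set2_inj a b c : a != b -> [set a; b] = [set a; c] -> b = c.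
Proof.
move=> nab /setP/(_ b); rewrite !inE eqxx orbT [b == a]eq_sym (negPf nab) /=.
by move/esym/eqP.
Qed.

Lemma set1_neq_set2 a b c : b != c -> [set a] != [set b; c].
Proof.
move=> nbc; apply/eqP => h; have := cards2 b c.
by rewrite -h cards1 nbc.
Qed.

Lemma mem_corner_singleton a b t : ([set b] \in corner a t) = (a == b) && (b \in t).
Proof. by rewrite inE sub1set inE cards1 andbT andbC. Qed.

Lemma mem_corner_pair a b c t : b != c ->
  ([set b; c] \in corner a t) = [&& b \in t, c \in t & (a == b) || (a == c)].
Proof. by move=> nbc; rewrite inE set2_sub !inE cards2 nbc andbT andbA. Qed.

Lemma mem_middle_singleton b t : [set b] \notin middle t.
Proof. by rewrite inE cards1 andbF. Qed.

Lemma mem_middle_pair b c t : b != c ->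
  ([set b; c] \in middle t) = (b \in t) && (c \in t).
Proof. by move=> nbc; rewrite inE set2_sub cards2 nbc andbT. Qed.

Lemma cornerE a b c : a != b -> a != c -> b != c ->
  corner a [set a; b; c] = [set [set a]; [set a; b]; [set a; c]].
Proof.
move=> nab nac nbc; apply/setP => s; rewrite !inE; apply/and3P/idP.
  case=> st as_ s2; have : (0 < #|s|)%N by apply/card_gt0P; exists a.
  move: s2; rewrite leq_eqVlt ltnS => /orP[/eqP s2 _|s1 s0].
    have [d nad sE] := set2_other as_ s2.
    have : d \in [set a; b; c] by apply: (fintype.subsetP st); rewrite sE !inE eqxx orbT.
    rewrite !inE [d == a]eq_sym (negPf nad) /= sE.
    by case/orP=> /eqP->; rewrite eqxx ?orbT.
  have /cards1P[d sE] : #|s| == 1%N by rewrite eqn_leq s1.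
  by move: as_; rewrite sE inE => /eqP->; rewrite eqxx.
case/orP=> [/orP[]|] /eqP->; rewrite ?sub1set ?set2_sub !inE !eqxx ?orbT;
  by split; rewrite ?cards1 ?cards2 //; case: (_ != _).
Qed.

Lemma card_set3 (T : finType) (x y z : T) :
  x != y -> x != z -> y != z -> #|[set x; y; z]| = 3%N.
Proof.
move=> nxy nxz nyz; rewrite setUC cardsU1 !inE cards2 nxy.
by rewrite [z == x]eq_sym [z == y]eq_sym (negPf nxz) (negPf nyz).
Qed.

Lemma card_corner a t : #|t| = 3%N -> a \in t -> #|corner a t| = 3%N.
Proof.
move=> t3 at_; have [b [c [nab nac nbc ->]]] := card3P t3 at_.
rewrite cornerE // card_set3 ?set1_neq_set2 //.
by apply: contra nbc => /eqP/(set2_inj nab)->.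
Qed.

Lemma card_middle t : #|t| = 3%N -> #|middle t| = 3%N.
Proof. by move=> t3; rewrite cards_draws t3. Qed.

Lemma pair_card3_eq t a b c : #|t| = 3%N -> a != b -> a != c -> b != c ->
  a \in t -> b \in t -> c \in t -> t = [set a; b; c].
Proof.
move=> t3 nab nac nbc at_ bt ct; apply/esym/eqP; rewrite eqEcard.
by rewrite card_set3 // t3 leqnn andbT !subUset !sub1set at_ bt ct.
Qed.

Variables (g : nat) (F : {set {set W}}).
Hypothesis sF : surface g F.

Let F3 t : t \in F -> #|t| = 3%N. Proof. exact: (surface_card3 sF). Qed.

Lemma midpoint_card3 tau : tau \in midpoint F -> #|tau| = 3%N.
Proof.
by case/midpointP=> [[t /F3 t3 ->]|[a [t [/F3 t3 at_ ->]]]];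
  [exact: card_middle|exact: card_corner].
Qed.

(** The half of [ab] next to [a] lies in the corners at [a] of the two triangles on [ab]. *)
Lemma midpoint_half_edge a b : a != b -> [set a; b] \in edges_of F ->
  #|[set tau in midpoint F | [set [set a]; [set a; b]] \subset tau]| = 2%N.
Proof.
move=> nab eE; rewrite -(surface_two sF eE).
have -> : [set tau in midpoint F | [set [set a]; [set a; b]] \subset tau] =
    [set corner a t | t in [set t in F | [set a; b] \subset t]].
  apply/setP => tau; rewrite inE set2_sub; apply/and3P/imsetP.
    case=> /midpointP[[t _ ->]|[a' [t [tF at_ ->]]]].
      by rewrite (negPf (mem_middle_singleton _ _)).
    rewrite mem_corner_singleton mem_corner_pair // => /andP[/eqP-> _].
    by case/and3P=> at' bt _; exists t; rewrite // inE tF set2_sub at' bt.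
  case=> t; rewrite inE set2_sub => /and3P[tF at_ bt] ->; split.
  - by apply/midpointP; right; exists a, t.
  - by rewrite mem_corner_singleton eqxx.
  - by rewrite mem_corner_pair // at_ bt eqxx.
rewrite card_in_imset // => t t'; rewrite !inE !set2_sub.
case/and3P=> tF at_ bt /and3P[tF' at' bt'] /setP h.
apply/eqP; rewrite eqEcard (F3 tF) (F3 tF') leqnn andbT.
apply/fintype.subsetP => x xt; have [<-//|nax] := eqVneq a x.
by have := h [set a; x]; rewrite !mem_corner_pair // at_ xt eqxx => /esym/and3P[].
Qed.

(** An edge between two midpoints separates the middle of its triangle from one corner. *)
Lemma midpoint_inner_edge a b c : a != b -> a != c -> b != c ->
  [set a; b; c] \in F ->
  #|[set tau in midpoint F | [set [set a; b]; [set a; c]] \subset tau]| = 2%N.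
Proof.
move=> nab nac nbc tF; set t := [set a; b; c] in tF *.
have [at_ bt ct] : [/\ a \in t, b \in t & c \in t] by rewrite !inE !eqxx !orbT.
have -> : [set tau in midpoint F | [set [set a; b]; [set a; c]] \subset tau] =
    [set middle t; corner a t].
  apply/setP => tau; rewrite inE set2_sub in_set2; apply/and3P/orP.
    case=> /midpointP[[t' tF' ->]|[a' [t' [tF' at' ->]]]].
      rewrite !mem_middle_pair // => /andP[a1 b1] /andP[_ c1]; left.
      by rewrite (pair_card3_eq (F3 tF') nab nac nbc a1 b1 c1).
    rewrite !mem_corner_pair // => /and3P[a1 b1 h1] /and3P[_ c1 h2]; right.
    rewrite (pair_card3_eq (F3 tF') nab nac nbc a1 b1 c1) -/t.
    case/orP: h1 => /eqP h1; first by rewrite h1.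
    case/orP: h2 => /eqP h2; first by rewrite h2.
    by rewrite -h1 h2 eqxx in nbc.
  case=> /eqP->; split.
  - by apply/midpointP; left; exists t.
  - by rewrite mem_middle_pair // at_ bt.
  - by rewrite mem_middle_pair // at_ ct.
  - by apply/midpointP; right; exists a, t.
  - by rewrite mem_corner_pair // at_ bt eqxx.
  - by rewrite mem_corner_pair // at_ ct eqxx.
rewrite cards2; case: eqP => // /setP/(_ [set a]).
by rewrite (negPf (mem_middle_singleton _ _)) mem_corner_singleton eqxx at_.
Qed.

Lemma midpoint_two e : e \in edges_of (midpoint F) ->
  #|[set tau in midpoint F | e \subset tau]| = 2%N.
Proof.
rewrite inE => /andP[/eqP/[dup] e2 /eqP/cards2P[x [y [nxy eE]]]].
case/existsP => tau /andP[/midpointP[[t tF ->]|[a [t [tF at_ ->]]]]].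
  rewrite eE set2_sub !inE => /andP[/andP[xt /eqP x2] /andP[yt /eqP y2]].
  have : (0 < #|x :&: y|)%N.
    have := subset_leq_card (_ : x :|: y \subset t).
    rewrite subUset xt yt (F3 tF) cardsU x2 y2 => /(_ isT); lia.
  case/card_gt0P=> a; rewrite inE => /andP[ax ay].
  have [b nab xE] := set2_other ax x2; have [c nac yE] := set2_other ay y2.
  have nbc : b != c by apply: contraNneq nxy => bc; rewrite xE yE bc.
  rewrite xE yE; apply: midpoint_inner_edge => //.
  move: xt yt; rewrite xE yE !set2_sub => /andP[at_ bt] /andP[_ ct].
  by rewrite -(pair_card3_eq (F3 tF) nab nac nbc at_ bt ct).
have [b [c [nab nac nbc tE]]] := card3P (F3 tF) at_.
have eab : [set a; b] \in edges_of F.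
  by rewrite inE cards2 nab; apply/existsP; exists t; rewrite tF tE set2_sub !inE !eqxx ?orbT.
have eac : [set a; c] \in edges_of F.
  by rewrite inE cards2 nac; apply/existsP; exists t; rewrite tF tE set2_sub !inE !eqxx ?orbT.
have tF' : [set a; c; b] \in F.
  by rewrite (_ : [set a; c; b] = t) // tE setUAC.
rewrite tE in tF; rewrite {1}eE tE cornerE // set2_sub !inE.
have ncb : c != b by rewrite eq_sym.
case/andP=> /orP[/orP[]|] /eqP xE /orP[/orP[]|] /eqP yE; move: nxy;
  rewrite eE xE yE ?eqxx // => _.
- exact: midpoint_half_edge.
- exact: midpoint_half_edge.
- by rewrite setUC; apply: midpoint_half_edge.
- exact: midpoint_inner_edge.
- by rewrite setUC; apply: midpoint_half_edge.
- exact: midpoint_inner_edge.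
Qed.

(** Inside a triangle every corner meets the middle in an edge. Across a side shared by [t] and [s],
    the corners at a common vertex [a] share half of that side. *)
Lemma midpoint_dual tau tau' : tau \in midpoint F -> tau' \in midpoint F ->
  connect (dual_adj (midpoint F)) tau tau'.
Proof.
have dsym : connect_sym (dual_adj (midpoint F)).
  apply: sym_connect_sym => x y; rewrite /dual_adj /= [y :&: x]setIC.
  by case: (x \in _); case: (y \in _).
have cm a t : t \in F -> a \in t ->
    connect (dual_adj (midpoint F)) (corner a t) (middle t).
  move=> tF at_; apply: connect1; apply/and3P; split.
  - by apply/midpointP; right; exists a, t.
  - by apply/midpointP; left; exists t.
  have [b [c [nab nac nbc tE]]] := card3P (F3 tF) at_.
  rewrite (_ : _ :&: _ = [set [set a; b]; [set a; c]]).
    rewrite cards2 (_ : [set a; b] != [set a; c]) //.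
    by apply: contraNneq nbc => /(set2_inj nab)->.
  rewrite tE cornerE //; apply/setP => s; rewrite !inE.
  case: (s =P [set a]) => [->|_] /=.
    by rewrite cards1 andbF; apply/esym/negbTE;
       rewrite negb_or !set1_neq_set2.
  by apply: andb_idr => /orP[] /eqP->; rewrite set2_sub cards2 ?nab ?nac !inE !eqxx ?orbT.
have mm t t' : t \in F -> t' \in F ->
    connect (dual_adj (midpoint F)) (middle t) (middle t').
  move=> tF tF'; have /connectP[p] := surface_dual sF tF tF'.
  elim: p t tF => [|s p IH] t tF /=; first by move=> _ ->.
  case/andP=> /and3P[_ sF' ts] ps ls.
  apply: (@connect_trans _ _ (middle s)); last exact: IH.
  have /cards2P[a [b [nab tsE]]] := ts.
  have : a \in t :&: s by rewrite tsE !inE eqxx.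
  have : b \in t :&: s by rewrite tsE !inE eqxx orbT.
  rewrite !inE => /andP[bt bs] /andP[at_ as_].
  apply: (@connect_trans _ _ (corner a s)); last exact: cm.
  apply: (@connect_trans _ _ (corner a t)); first by rewrite dsym; exact: cm.
  apply: connect1; apply/and3P; split.
  - by apply/midpointP; right; exists a, t.
  - by apply/midpointP; right; exists a, s.
  rewrite (_ : _ :&: _ = [set [set a]; [set a; b]]).
    by rewrite cards2 set1_neq_set2.
  have [c [d [nac nad ncd tE]]] := card3P (F3 tF) at_.
  apply/setP => x; rewrite in_setI !inE; apply/andP/orP.
    case=> /and3P[xt ax x2] /and3P[xs _ _].
    have : x \subset [set a; b] by rewrite -tsE subsetI xt xs.
    move: x2; rewrite leq_eqVlt => /orP[/eqP x2|x1] xab; [right|left].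
      by rewrite eqEcard xab x2 cards2 nab.
    by rewrite eq_sym eqEcard sub1set ax cards1.
  by case=> /eqP->; rewrite ?sub1set ?set2_sub ?cards1 ?cards2 ?nab !inE
    eqxx ?at_ ?as_ ?bt ?bs.
have tm x : x \in midpoint F -> exists2 t, t \in F &
    connect (dual_adj (midpoint F)) x (middle t).
  case/midpointP=> [[t tF ->]|[a [t [tF at_ ->]]]]; exists t => //.
  exact: cm.
case/tm=> t tF ct /tm[t' tF' ct']; rewrite dsym in ct'.
exact: connect_trans ct (connect_trans (mm _ _ tF tF') ct').
Qed.

(** There are at most [4 |F|] new triangles and at least [|V| + |E|] new vertices. As
    [3 |F| = 2 |E|], these bounds raise both sides of the old inequality by [3 |F|]. *)
Lemma midpoint_euler :
  (#|midpoint F| + 4 <= 2 * #|cover (midpoint F)| + 2 * g)%N.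
Proof.
have cF : (#|midpoint F| <= 4 * #|F|)%N.
  apply: (leq_trans (leq_card_setU _ _)).
  have -> : (4 * #|F| = #|F| + 3 * #|F|)%N by lia.
  apply: leq_add; first exact: leq_imset_card.
  apply: (leq_trans (leq_imset_card _ _)).
  have -> : #|[set p : W * {set W} | (p.2 \in F) && (p.1 \in p.2)]| =
      (\sum_(t in F) \sum_(a in t) 1)%N.
    rewrite -sum1_card [RHS](exchange_big_dep xpredT) //= pair_big_dep /=.
    by apply: eq_bigl => -[a t]; rewrite inE.
  rewrite mulnC -sum_nat_const; apply: leq_sum => t tF.
  by rewrite sum1_card F3.
have cV : (#|cover F| + #|edges_of F| <= #|cover (midpoint F)|)%N.
  rewrite -(card_imset (mem (cover F)) (@set1_inj W)).
  have dis : [disjoint [set [set x] | x in cover F] & edges_of F].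
    apply/pred0P => s; apply/negbTE/negP => /andP[/imsetP[x _ ->]].
    by rewrite !inE cards1.
  move: dis; rewrite -leq_card_setU => /eqP <-.
  apply/subset_leq_card/fintype.subsetP => s; rewrite inE => /orP[].
    case/imsetP=> a /bigcupP[t tF at_] ->; apply/bigcupP; exists (corner a t).
      by apply/midpointP; right; exists a, t.
    by rewrite mem_corner_singleton eqxx.
  rewrite inE => /andP[s2 /existsP[t /andP[tF st]]].
  apply/bigcupP; exists (middle t); last by rewrite inE st.
  by apply/midpointP; left; exists t.
by have := double_count_edges sF; have := surface_euler sF; lia.
Qed.

Lemma midpoint_surface : surface g (midpoint F).
Proof.
split; [exact: midpoint_card3|exact: midpoint_two|exact: midpoint_dual|].
exact: midpoint_euler.
Qed.

End Midpoint.

(** * Triangulated closed surfaces *)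

Lemma next_neq_prev (T : eqType) (c : seq T) (x : T) :
  uniq c -> (2 < size c)%N -> x \in c -> next c x != prev c x.
Proof.
move=> uc sc xc; have [i p cE] := rot_to xc.
have up : uniq (x :: p) by rewrite -cE rot_uniq.
have sp : (2 < size (x :: p))%N by rewrite -cE size_rot.
rewrite -(next_rot i uc) -(prev_rot i uc) cE {i c uc sc xc cE}.
case: p up sp => [|y [|z p]] // up _.
have xN : x \notin [:: y, z & p] by case/andP: up.
rewrite prev_nth mem_head (memNindex xN) /= eqxx.
rewrite -[nth _ _ _]/(nth x (z :: p) (size (z :: p)).-1) nth_last /=.
by move: up => /= /and4P[_ yN _ _]; apply: contraNneq yN => ->; exact: mem_last.
Qed.

Section ClosedSurface.
Variables (W : finType) (F : {set {set W}}).
Hypothesis cF : closed_surface F.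

Let F3 t : t \in F -> #|t| = 3%N. Proof. by case: cF => _ h _ _; exact: h. Qed.

Let link (w : W) : exists c : seq W, [/\ (2 < size c)%N, uniq c &
    forall x y, ([set w; x; y] \in F) =
      (x \in c) && ((y == next c x) || (y == prev c x))].
Proof. by case: cF => _ _ h _; exact: h. Qed.

Lemma share_edge_connect t t' a b : t \in F -> t' \in F -> a != b ->
  a \in t -> b \in t -> a \in t' -> b \in t' -> connect (dual_adj F) t t'.
Proof.
move=> tF tF' nab at_ bt at' bt'; have [->|nt] := eqVneq t t'.
  exact: connect0.
apply: connect1; rewrite /dual_adj /= tF tF' eqn_leq /=; apply/andP; split; last first.
  have -> : 2%N = #|[set a; b]| by rewrite cards2 nab.
  by apply: subset_leq_card; rewrite set2_sub !inE at_ bt at' bt'.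
rewrite leqNgt; apply: contra nt => h; rewrite eqEcard (F3 tF) (F3 tF') leqnn andbT.
have /eqP <- : t :&: t' == t by rewrite eqEcard subsetIl (F3 tF).
exact: subsetIr.
Qed.

(** Consecutive triangles around [w] share an edge at [w], and the link cycle visits them all. *)
Lemma star_connect w t t' : t \in F -> t' \in F -> w \in t -> w \in t' ->
  connect (dual_adj F) t t'.
Proof.
have [c [sc uc hc]] := link w.
pose tau x := [set w; x; next c x].
have tauF x : x \in c -> tau x \in F by move=> xc; rewrite hc xc eqxx.
have starE s : s \in F -> w \in s -> exists2 x, x \in c & s = tau x.
  move=> sF ws; have [a [b [nwa nwb nab sE]]] := card3P (F3 sF) ws.
  move: (sF); rewrite sE hc => /andP[ac /orP[/eqP bn|/eqP bp]].
    by exists a; rewrite // bn.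
  exists b; first by rewrite bp mem_prev.
  by rewrite /tau bp next_prev // setUAC.
move=> tF tF' wt wt'.
have [x xc ->] := starE _ tF wt; have [y yc ->] := starE _ tF' wt'.
have : fconnect (next c) x y by rewrite (fconnect_cycle (cycle_next uc) xc).
case/connectP=> p; elim: p x xc => [|z p IH] x xc /=.
  by move=> _ ->; exact: connect0.
case/andP=> /eqP zE pp lp; have zc : z \in c by rewrite -zE mem_next.
apply: connect_trans (IH z zc pp lp).
have nwz : w != z.
  have := F3 (tauF x xc); rewrite /tau zE => h; apply/eqP => wz.
  have : (#|[set w; x; z]| <= 2)%N.
    have -> : [set w; x; z] = [set w; x].
      by apply/setP => v; rewrite !inE wz; case: (v == z); rewrite ?orbT ?orbF.
    by rewrite cards2; case: (_ != _).
  by rewrite h.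
by apply: (share_edge_connect (tauF _ xc) (tauF _ zc) nwz);
  rewrite /tau ?zE !inE !eqxx ?orbT.
Qed.

Lemma closed_surface_dual t t' : t \in F -> t' \in F ->
  connect (dual_adj F) t t'.
Proof.
move=> tF tF'; have /card_gt0P[u ut] : (0 < #|t|)%N by rewrite (F3 tF).
have /card_gt0P[v vt'] : (0 < #|t'|)%N by rewrite (F3 tF').
have : connect (fun u v => [exists t in F, (u \in t) && (v \in t)]) u v.
  by case: cF.
case/connectP=> p; elim: p u t tF ut => [|z p IH] u t tF ut /=.
  by move=> _ vu; apply: (star_connect tF tF' ut); rewrite -vu.
case/andP=> /existsP[s /and3P[sF us zs]] pp lp.
exact: connect_trans (star_connect tF sF ut us) (IH z s sF zs pp lp).
Qed.

(** The third vertices of the triangles on [wx] are the two neighbors of [x] on the link cycle of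
    [w], distinct because the cycle has length at least 3. *)
Lemma closed_surface_two e : e \in edges_of F ->
  #|[set t in F | e \subset t]| = 2%N.
Proof.
rewrite inE => /andP[/cards2P[w [x [nwx ->]]] /existsP[t /andP[tF]]].
rewrite set2_sub => /andP[wt xt]; have [c [sc uc hc]] := link w.
have third s : s \in F -> w \in s -> x \in s ->
    x \in c /\ exists2 y, s = [set w; x; y] & (y == next c x) || (y == prev c x).
  move=> sF ws xs; have [a [b [nwa nwb nab sE]]] := card3P (F3 sF) ws.
  have [y sy] : exists y, s = [set w; x; y].
    move: xs; rewrite sE !inE eq_sym (negPf nwx) /= => /orP[] /eqP->.
      by exists b.
    by exists a; rewrite setUAC.
  by move: sF; rewrite {1}sy hc => /andP[xc hy]; split=> //; exists y.
have [xc _] := third t tF wt xt.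
have nF y : (y == next c x) || (y == prev c x) -> [set w; x; y] \in F.
  by rewrite hc xc.
have ny y : [set w; x; y] \in F -> (y != w) && (y != x).
  move=> /F3 h; rewrite -negb_or; apply/negP => yE.
  have : (#|[set w; x; y]| <= 2)%N.
    have -> : [set w; x; y] = [set w; x].
      by apply/setP => v; rewrite !inE; case: (v =P y) => [->|_]; rewrite ?orbF // yE.
    by rewrite cards2; case: (_ != _).
  by rewrite h.
have nn := nF (next c x); rewrite eqxx in nn; have /andP[n1 n2] := ny _ (nn isT).
have np := nF (prev c x); rewrite eqxx orbT in np.
rewrite (_ : [set _ in F | _] = [set [set w; x; next c x]; [set w; x; prev c x]]).
  rewrite cards2 (_ : _ != _) //; apply/eqP => /setP/(_ (next c x)).
  by rewrite !inE eqxx orbT (negPf n1) (negPf n2) (negPf (next_neq_prev uc sc xc)).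
apply/setP => s; rewrite inE set2_sub !inE; apply/and3P/orP.
  by case=> sF ws /(third s sF ws)[_ [y -> /orP[] /eqP->]]; rewrite eqxx; [left|right].
by case=> /eqP->; rewrite ?nn ?np // !inE !eqxx ?orbT.
Qed.

Lemma closed_surface_cover : cover F = setT.
Proof.
apply/setP => w; rewrite inE; apply/bigcupP; have [c [sc uc hc]] := link w.
case: c sc uc hc => // x c _ _ hc; exists [set w; x; next (x :: c) x].
  by rewrite hc mem_head eqxx.
by rewrite !inE eqxx.
Qed.

Lemma closed_surface_surface (g : nat) : euler_genus F <= g%:Z -> surface g F.
Proof.
(* The provisional genus [|F| + 4] makes the Euler clause trivial, so that [double_count_edges]
   becomes available for proving the true one. *)
move=> hg; have sur : surface (#|F| + 4) F.
  split; [exact: F3|exact: closed_surface_two|exact: closed_surface_dual|lia].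
split; [exact: F3|exact: closed_surface_two|exact: closed_surface_dual|].
have := double_count_edges sur; move: hg.
by rewrite /euler_genus /euler_characteristic closed_surface_cover cardsT; lia.
Qed.

End ClosedSurface.

(** * Barycentric coordinates of the midpoint subdivision *)

Definition bary (R : realType) (W : finType) (F : {set {set W}}) (lam : W -> R) :=
  [/\ forall w, 0 <= lam w, \sum_w lam w = 1 &
      exists2 s, s \in F & forall w, lam w != 0 -> w \in s].

(** Mesh size as seen by one function. For the original coordinates [h] it measures how small the
    stars of a subdivision have become. *)
Definition variation_le (R : realType) (W : finType) (F : {set {set W}})
    (h : W -> R) (v : R) :=
  forall t w w', t \in F -> w \in t -> w' \in t -> `|h w - h w'| <= v.

Section Barycentric.
Variables (R : realType) (W : finType).
Implicit Types (F : {set {set W}}) (lam h : W -> R).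

(* The barycentric coordinates, in the midpoint subdivision, of the point with
   coordinates [lam]. *)
Definition midcoord lam (s : {set W}) : R :=
  if (#|s| <= 2)%N then
    Num.max 0 (Num.min (2 * \big[Num.min/1]_(w in s) lam w)
                       (2 * \sum_(w in s) lam w - 1))
  else 0.

(** The affine interpolation of [h], evaluated at the new vertex [s]. *)
Definition midmean h (s : {set W}) : R := (\sum_(w in s) h w) / #|s|%:R.

Lemma midmean_pair h a x : midmean h [set a; x] = (h a + h x) / 2.
Proof.
rewrite /midmean cards2; have [<-|nax] := eqVneq a x.
  by rewrite setUid big_set1 divr1; lra.
by rewrite big_setU1 ?inE // big_set1.
Qed.

(** Two vertices of a small triangle have an endpoint [a] in common, so their means differ by half
    of [h x - h y]: this is why the mesh halves. *)
Lemma midpoint_pairs F tau s s' : (forall t, t \in F -> #|t| = 3%N) ->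
  tau \in midpoint F -> s \in tau -> s' \in tau ->
  exists t a x y, [/\ t \in F, [/\ a \in t, x \in t & y \in t],
    s = [set a; x] & s' = [set a; y]].
Proof.
move=> F3 /midpointP[[t tF ->]|[a [t [tF at_ ->]]]].
  rewrite !inE => /andP[st /eqP s2] /andP[st' /eqP s2'].
  have : (0 < #|s :&: s'|)%N.
    have := subset_leq_card (_ : s :|: s' \subset t).
    rewrite subUset st st' (F3 _ tF) cardsU s2 s2' => /(_ isT); lia.
  case/card_gt0P=> a; rewrite inE => /andP[as_ as'].
  have [x _ sE] := set2_other as_ s2; have [y _ sE'] := set2_other as' s2'.
  exists t, a, x, y; split=> //; move: st st'; rewrite sE sE' !set2_sub.
  by move=> /andP[-> ->] /andP[_ ->].
have cor r : r \in corner a t -> exists2 x, x \in t & r = [set a; x].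
  have [b [c [nab nac nbc tE]]] := card3P (F3 _ tF) at_.
  rewrite tE cornerE // !inE => /orP[/orP[]|] /eqP->.
  - by exists a; rewrite ?setUid // !inE eqxx.
  - by exists b; rewrite // !inE eqxx ?orbT.
  - by exists c; rewrite // !inE eqxx ?orbT.
by move=> /cor[x xt ->] /cor[y yt ->]; exists t, a, x, y.
Qed.

Lemma midmean_variation F h v : (forall t, t \in F -> #|t| = 3%N) ->
  variation_le F h v ->
  variation_le (midpoint F) (midmean h) (v / 2).
Proof.
move=> F3 hv tau s s' tauF st st'.
have [t [a [x [y [tF [at_ xt yt] -> ->]]]]] := midpoint_pairs F3 tauF st st'.
rewrite !midmean_pair (_ : _ - _ = (h x - h y) / 2); last by lra.
by rewrite normrM [`|2^-1|]ger0_norm // ler_pM2r //; exact: hv tF xt yt.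
Qed.

Section Triangle.
Variables (a b c : W) (lam : W -> R).
Hypotheses (nab : a != b) (nac : a != c) (nbc : b != c).
Hypothesis lam_ge0 : forall w, 0 <= lam w.
Hypothesis lam_sum : \sum_w lam w = 1.
Hypothesis lam_supp : forall w, lam w != 0 -> w \in [set a; b; c].

Lemma triangle_sum (V : nmodType) (f : W -> V) :
  (forall w, w \notin [set a; b; c] -> f w = 0) -> \sum_w f w = f a + f b + f c.
Proof.
move=> f0; rewrite (bigID (mem [set a; b; c])) /= [X in _ + X]big1 ?addr0 //.
rewrite setUC big_setU1 /=; last by rewrite !inE eq_sym (negPf nac) eq_sym (negPf nbc).
by rewrite big_setU1 ?inE //= big_set1 addrC.
Qed.

Lemma triangle_lam_sum : lam a + lam b + lam c = 1.
Proof.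
rewrite -lam_sum triangle_sum // => w; apply: contraNeq; exact: lam_supp.
Qed.

Lemma midcoord_single x : midcoord lam [set x] = Num.max 0 (2 * lam x - 1).
Proof.
rewrite /midcoord cards1 /= !big_set1E addr0; have := lam_ge0 x.
have : lam x <= 1.
  rewrite -lam_sum (bigD1 x) //= lerDl; exact: sumr_ge0.
by move=> ? ?; rewrite (min_l (y := 1)) // min_r //; lra.
Qed.

Lemma midcoord_pair x y : x != y -> midcoord lam [set x; y] =
  Num.max 0 (Num.min (2 * Num.min (lam x) (lam y)) (2 * (lam x + lam y) - 1)).
Proof.
move=> nxy; rewrite /midcoord cards2 nxy /= big_setU1 ?inE //= big_set1.
have y1 : lam y <= 1.
  rewrite -lam_sum (bigD1 y) //= lerDl; exact: sumr_ge0.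
congr (Num.max 0 (Num.min (2 * _) _)).
rewrite (bigminD1 x) ?inE ?eqxx //= (eq_bigl (pred1 y)).
  by rewrite big_pred1_eq_id (min_l y1).
move=> w; rewrite !inE; have [->|] := eqVneq w x; last by rewrite andbT.
by rewrite (negPf nxy).
Qed.

Lemma midcoord_outside (s : {set W}) : ~~ (s \subset [set a; b; c]) -> midcoord lam s = 0.
Proof.
case/subsetPn => w ws wN; rewrite /midcoord; case: ifP => // _.
apply/max_idPl; rewrite ge_min; apply/orP; left.
have lw : lam w = 0 by apply/eqP; apply: contraNT wN; exact: lam_supp.
by rewrite (bigminD1 w) //= lw pmulr_rle0 // ge_min lexx.
Qed.

Lemma midcoord_set0 : midcoord lam set0 = 0.
Proof.
by rewrite /midcoord cards0 /= !big_set0 mulr0 sub0r; apply/max_idPl;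
  rewrite ge_min oppr_le0 ler01 orbT.
Qed.

Lemma midcoord_sum (H : {set W} -> R) :
  \sum_s midcoord lam s * H s =
  midcoord lam [set a] * H [set a] + midcoord lam [set b] * H [set b] +
  midcoord lam [set c] * H [set c] + midcoord lam [set a; b] * H [set a; b] +
  midcoord lam [set a; c] * H [set a; c] + midcoord lam [set b; c] * H [set b; c].
Proof.
pose L := [:: [set a]; [set b]; [set c]; [set a; b]; [set a; c]; [set b; c]].
have nab' : [set a; b] != [set a; c] by apply: contraNneq nbc => /(set2_inj nab)->.
have uL : uniq L.
  rewrite /= !inE !negb_or !set1_neq_set2 // !andbT.
  rewrite !(inj_eq set1_inj) nab nac nbc nab' /=; apply/andP; split.
    by apply: contraNneq nac => /setP/(_ a); rewrite !inE eqxx (negPf nab) /= => <-.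
  apply: contraNneq nab => /setP/(_ a); rewrite !inE eqxx (negPf nac) !orbF /=.
  by move=> <-.
rewrite (bigID (mem L)) /= [X in _ + X]big1 ?addr0 => [|s sN]; last first.
  have [st|st] := boolP (s \subset [set a; b; c]); last first.
    by rewrite midcoord_outside ?mul0r.
  rewrite (_ : midcoord lam s = 0) ?mul0r //.
  have [s2|s2] := leqP #|s| 2; last by rewrite /midcoord leqNgt s2.
  have [->|/set0Pn[d ds]] := eqVneq s set0; first exact: midcoord_set0.
  case/negP: sN; have : (0 < #|s|)%N by apply/card_gt0P; exists d.
  have dt := fintype.subsetP st d ds.
  move: s2; rewrite leq_eqVlt ltnS => /orP[/eqP s2 _|s1 s0].
    have [d' ndd sE] := set2_other ds s2.
    have : d' \in [set a; b; c] by apply: (fintype.subsetP st); rewrite sE !inE eqxx orbT.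
    move: dt; rewrite sE /L !inE => /orP[/orP[]|] /eqP dE /orP[/orP[]|] /eqP d'E;
      rewrite ?dE ?d'E ?eqxx ?orbT // in ndd *.
    - by rewrite (setUC [set b]) eqxx !orbT.
    - by rewrite (setUC [set c]) eqxx !orbT.
    - by rewrite (setUC [set c]) eqxx !orbT.
  have /cards1P[d' sE] : #|s| == 1%N by rewrite eqn_leq s1.
  move: ds; rewrite sE inE => /eqP <-; move: dt.
  by rewrite /L !inE => /orP[/orP[]|] /eqP->; rewrite eqxx ?orbT.
rewrite -big_uniq //= /L !big_cons big_nil addr0.
by rewrite !addrA.
Qed.

Let single_small x : 2 * lam x <= 1 -> midcoord lam [set x] = 0.
Proof. by move=> h; rewrite midcoord_single max_l //; lra. Qed.

Let single_large x : 1 <= 2 * lam x -> midcoord lam [set x] = 2 * lam x - 1.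
Proof. by move=> h; rewrite midcoord_single max_r //; lra. Qed.

Let pair_large x y : x != y -> lam x + lam y <= 1 -> 1 <= 2 * lam x ->
  midcoord lam [set x; y] = 2 * lam y.
Proof.
move=> nxy h1 h2; rewrite midcoord_pair // (min_r (x := lam x)); last by lra.
by rewrite min_l ?max_r //; have := lam_ge0 y; lra.
Qed.

Let pair_middle x y : x != y -> 2 * lam x <= 1 -> 2 * lam y <= 1 ->
  1 <= 2 * (lam x + lam y) ->
  midcoord lam [set x; y] = 2 * (lam x + lam y) - 1.
Proof.
move=> nxy h1 h2 h3; rewrite midcoord_pair // min_r ?max_r //; first by lra.
by rewrite -ler_pdivrMl // le_min; apply/andP; split; lra.
Qed.

Let pair_small x y : x != y -> 2 * (lam x + lam y) <= 1 ->
  midcoord lam [set x; y] = 0.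
Proof.
move=> nxy h; rewrite midcoord_pair // max_l // ge_min; apply/orP; right; lra.
Qed.

(** The four small triangles: a point lies in the corner of a coordinate that is at least 1/2, and
    in the middle if there is none. The min-max formula of [midcoord] becomes linear on each of
    them. *)
Let lam_cases :
  [\/ [/\ 1 <= 2 * lam a, 2 * lam b <= 1 & 2 * lam c <= 1],
      [/\ 1 <= 2 * lam b, 2 * lam a <= 1 & 2 * lam c <= 1],
      [/\ 1 <= 2 * lam c, 2 * lam a <= 1 & 2 * lam b <= 1] |
      [/\ 2 * lam a <= 1, 2 * lam b <= 1 & 2 * lam c <= 1]].
Proof.
have := triangle_lam_sum; have := lam_ge0 a; have := lam_ge0 b; have := lam_ge0 c.
move=> c0 b0 a0 s1; have [ha|ha] := leP 1 (2 * lam a).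
  by constructor 1; split; lra.
have [hb|hb] := leP 1 (2 * lam b); first by constructor 2; split; lra.
have [hc|hc] := leP 1 (2 * lam c); first by constructor 3; split; lra.
by constructor 4; split; lra.
Qed.

(** Subdividing does not move points: an affine function has the same value in the old and the new
    coordinates. *)
Lemma midcoord_mean h :
  \sum_s midcoord lam s * midmean h s = \sum_w lam w * h w.
Proof.
rewrite midcoord_sum !midmean_pair /midmean !big_set1 !cards1 !divr1.
rewrite (@triangle_sum _ (fun w => lam w * h w)); last first.
  move=> w wN; apply/eqP; rewrite mulf_eq0; apply/orP; left.
  by apply: contraNT wN; exact: lam_supp.
have s1 := triangle_lam_sum.
have [a0 b0 c0] := And3 (lam_ge0 a) (lam_ge0 b) (lam_ge0 c).
case: lam_cases => -[h1 h2 h3].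
- rewrite (single_large h1) (single_small h2) (single_small h3).
  rewrite (@pair_large a b) //; last by lra.
  rewrite (@pair_large a c) //; last by lra.
  rewrite (@pair_small b c) //; last by lra.
  rewrite (_ : lam a = 1 - lam b - lam c); last by lra.
  lra.
- rewrite (single_small h2) (single_large h1) (single_small h3).
  rewrite (setUC [set a] [set b]) (@pair_large b a) 1?eq_sym //; last by lra.
  rewrite (@pair_large b c) //; last by lra.
  rewrite (@pair_small a c) //; last by lra.
  rewrite (_ : lam b = 1 - lam a - lam c); last by lra.
  lra.
- rewrite (single_small h2) (single_large h1) (single_small h3).
  rewrite (setUC [set a] [set c]) (@pair_large c a) 1?eq_sym //; last by lra.
  rewrite (setUC [set b] [set c]) (@pair_large c b) 1?eq_sym //; last by lra.
  rewrite (@pair_small a b) //; last by lra.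
  rewrite (_ : lam c = 1 - lam a - lam b); last by lra.
  lra.
rewrite (single_small h1) (single_small h2) (single_small h3).
rewrite (@pair_middle a b) //; last by lra.
rewrite (@pair_middle a c) //; last by lra.
rewrite (@pair_middle b c) //; last by lra.
rewrite (_ : lam c = 1 - lam a - lam b); last by lra.
  lra.
Qed.

End Triangle.

Lemma midcoord_ge0 lam s : 0 <= midcoord lam s.
Proof. by rewrite /midcoord; case: ifP => // _; rewrite le_max lexx. Qed.

Lemma baryP F lam : (forall t, t \in F -> #|t| = 3%N) -> bary F lam ->
  exists a b c, [/\ [set a; b; c] \in F, [/\ a != b, a != c & b != c] &
    forall w, lam w != 0 -> w \in [set a; b; c]].
Proof.
move=> F3 [_ _ [t tF ht]]; have /card_gt0P[a at_] : (0 < #|t|)%N by rewrite F3.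
have [b [c [nab nac nbc tE]]] := card3P (F3 _ tF) at_.
by exists a, b, c; rewrite -tE; split.
Qed.

Lemma bary_mean F lam h : (forall t, t \in F -> #|t| = 3%N) -> bary F lam ->
  \sum_s midcoord lam s * midmean h s = \sum_w lam w * h w.
Proof.
move=> F3 bl; have [a [b [c [_ [nab nac nbc] ht]]]] := baryP F3 bl.
by case: bl => l0 l1 _; exact: (midcoord_mean nab nac nbc).
Qed.

Lemma midcoord_bary F lam : (forall t, t \in F -> #|t| = 3%N) -> bary F lam ->
  bary (midpoint F) (midcoord lam).
Proof.
move=> F3 bl; have [l0 l1 [t tF ht]] := bl; split=> [s||].
- exact: midcoord_ge0.
(* The total weight is the mean of the constant 1. The empty set, where [midmean] is 0 instead of 1,
   carries no weight. *)
- rewrite -l1 -[RHS](eq_bigr _ (fun w _ => mulr1 (lam w))).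
  rewrite -(bary_mean (fun=> 1) F3 bl); apply: eq_bigr => s _.
  have [->|sn0] := eqVneq s set0; first by rewrite midcoord_set0 mul0r.
  rewrite /midmean sumr_const divff ?mulr1 // pnatr_eq0 -lt0n.
  by rewrite card_gt0.
have le2 s : midcoord lam s != 0 -> (#|s| <= 2)%N.
  by rewrite /midcoord; case: ifP; rewrite ?eqxx.
have [a [b [c [tF' [nab nac nbc] ht']]]] := baryP F3 bl.
have sub s : midcoord lam s != 0 -> s \subset [set a; b; c].
  by apply: contraNT => ns; apply/eqP; exact: midcoord_outside ht' _ ns.
(* A coordinate of at least 1/2 places the point in a corner, otherwise it is in the middle
   triangle. *)
have [[x hx]|nx] := pselect (exists x, 1 <= 2 * lam x).
  have xt : x \in [set a; b; c].
    by apply: ht'; apply: contraTneq hx => ->; rewrite mulr0 ler10.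
  exists (corner x [set a; b; c]).
    by apply/midpointP; right; exists x, [set a; b; c].
  move=> s ns; rewrite inE (sub s ns) (le2 s ns) andbT /=.
  apply: contraNT ns => xs; rewrite /midcoord; case: ifP => // _.
  apply/eqP/max_l; rewrite ge_min; apply/orP; right.
  have : lam x + \sum_(w in s) lam w <= 1.
    rewrite -l1 [leRHS](bigD1 x) //= lerD2l [leRHS](bigID (mem s)) /=.
    rewrite [X in _ <= X + _](eq_bigl (mem s)) ?lerDl ?sumr_ge0 // => w /=.
    by case: eqVneq => // ->; rewrite (negPf xs).
  by move: (\sum_(w in s) _) => y; lra.
exists (middle [set a; b; c]).
  by apply/midpointP; left; exists [set a; b; c].
move=> s ns; rewrite inE (sub s ns) /= eqn_leq le2 //= ltnNge.
apply: contra ns => s1; have [->|] := eqVneq s set0; first by rewrite midcoord_set0.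
rewrite -card_gt0 => s0; have /cards1P[x ->] : #|s| == 1%N by rewrite eqn_leq s1.
rewrite midcoord_single //; apply/eqP/max_l.
by have /negP := contra_not (ex_intro (fun x => 1 <= 2 * lam x) x) nx; rewrite -ltNge; lra.
Qed.

End Barycentric.

Section Refinement.
Variable R : realType.

(** Every subdivision changes the vertex type, so the [n]-fold one is described by its effects: [L]
    transports coordinates and [h'] interpolates [h]. Continuity is stated for composites with [u],
    which avoids a topology on [W -> R]. *)
Definition refinement (g n : nat) (W : finType) (F : {set {set W}}) :=
  exists (W' : finType) (F' : {set {set W'}}) (L : (W -> R) -> W' -> R),
  [/\ surface g F', forall lam, bary F lam -> bary F' (L lam),
      forall (T : topologicalType) (u : T -> W -> R),
        (forall w, continuous (fun x => u x w : R)) ->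
        forall w', continuous (fun x => L (u x) w' : R) &
      forall h v, variation_le F h v -> exists h' : W' -> R,
        variation_le F' h' (v / 2 ^+ n) /\
        forall lam, bary F lam -> \sum_s L lam s * h' s = \sum_w lam w * h w].

Lemma midcoord_continuous (W : finType) (T : topologicalType) (u : T -> W -> R) :
  (forall w, continuous (fun x => u x w : R)) ->
  forall s, continuous (fun x => midcoord (u x) s : R).
Proof.
move=> cu s; rewrite /midcoord.
case: (#|s| <= 2)%N => x; last exact: cvg_cst.
have cmin : continuous (fun y => \big[Num.min/1]_(w in s) u y w : R).
  apply: (@continuous_big R W Num.min 1 (mem s) (@min_continuous _ R) T _
    (fun w y => u y w)) => w _; exact: cu.
have csum : continuous (fun y => \sum_(w in s) u y w : R).
  apply: (@continuous_big R W +%R 0 (mem s) (@add_continuous R) T _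
    (fun w y => u y w)) => w _; exact: cu.
apply: (@continuous_max R T (fun=> 0)); first exact: cvg_cst.
apply: (@continuous_min R T).
  by apply: (@continuousM R T (fun=> 2)); [exact: cvg_cst|exact: cmin].
apply: (@continuousB R R T _ (fun=> 1)); last exact: cvg_cst.
by apply: (@continuousM R T (fun=> 2)); [exact: cvg_cst|exact: csum].
Qed.

Lemma refinement_exists g n (W : finType) (F : {set {set W}}) :
  surface g F -> refinement g n F.
Proof.
elim: n W F => [|n IH] W F sF.
  exists W, F, id; split=> // h v hv; exists h; split=> //.
  by rewrite expr0 divr1.
have F3 := surface_card3 sF.
have [W' [F' [L [sF' bL cL mL]]]] := IH _ _ (midpoint_surface sF).
exists W', F', (fun lam => L (midcoord lam)); split=> //.
- by move=> lam bl; apply/bL/(midcoord_bary F3 bl).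
- by move=> T u cu; apply: cL => s; exact: midcoord_continuous.
move=> h v hv; have [h' [hv' hm]] := mL _ _ (midmean_variation F3 hv).
exists h'; split; first by rewrite exprS invfM mulrA.
move=> lam bl; rewrite hm; first exact: (bary_mean h F3 bl).
exact: midcoord_bary.
Qed.

(** The sum is a convex combination of values of [h] on one triangle containing [w0]. *)
Lemma bary_near_vertex (W : finType) (F : {set {set W}}) h v (lam : W -> R) w0 :
  variation_le F h v -> bary F lam -> lam w0 != 0 ->
  `|\sum_w lam w * h w - h w0| <= v.
Proof.
move=> hv [l0 l1 [t tF ht]] lw.
rewrite -[h w0]mul1r -l1 mulr_suml -sumrB.
apply: (le_trans (ler_norm_sum _ _ _)).
rewrite -[v]mul1r -l1 mulr_suml; apply: ler_sum => w _.
rewrite -mulrBr normrM ger0_norm //.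
have [->|nz] := eqVneq (lam w) 0; first by rewrite !mul0r.
apply: ler_wpM2l => //; exact: hv tF (ht _ nz) (ht _ lw).
Qed.

End Refinement.

(** * Drawings on a surface *)

Section Drawing.
Variable R : realType.
Local Open Scope classical_set_scope.

Lemma star_connected (V : normedModType R) (p : V) (K : set V) : K p ->
  (forall x t, K x -> 0 <= t <= 1 -> K (x + t *: (p - x))) -> connected K.
Proof.
move=> Kp star.
have -> : K = \bigcup_(x in K) ((fun t : R => x + t *: (p - x)) @` `[0, 1]).
  apply/seteqP; split => [x Kx|_ [x Kx [t /= + <-]]].
    exists x => //; exists 0; rewrite /= ?in_itv /= ?lexx ?ler01 //.
    by rewrite scale0r addr0.
  by rewrite in_itv /=; exact: star.
apply: bigcup_connected => [|x Kx].
  exists p => x Kx /=; exists 1; rewrite /= ?in_itv /= ?lexx ?ler01 //.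
  by rewrite scale1r addrC subrK.
apply: connected_continuous_connected; first exact: segment_connected.
apply: continuous_subspaceT => t; apply: cvgD; first exact: cvg_cst.
by apply: cvgZr_tmp; exact: cvg_id.
Qed.

(** The relatively open sets [0 < phi x w] cover [K]. Those with [w] reachable from [w0] and the
    remaining ones have disjoint unions, since vertices positive at one point share a triangle; a
    connected [K] cannot be split this way. *)
Lemma nerve_connected (V : topologicalType) (K : set V) (W : finType)
    (F : {set {set W}}) (phi : V -> W -> R) :
  connected K -> (forall w, {within K, continuous (fun x => phi x w : R)}) ->
  (forall x, K x -> bary F (phi x)) ->
  connected_in (skeleton F) [set w | `[< exists x, K x /\ 0 < phi x w >]]%SET.
Proof.
move=> Kc cphi bphi; set N := finset _.
have NP w : w \in N <-> exists x, K x /\ 0 < phi x w.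
  by rewrite inE; split=> /asboolP.
move=> w0 w1 w0N w1N; set r : rel W := (X in connect X).
have /choice[U hU] w : exists U : set V,
    open U /\ U `&` K = [set x | 0 < phi x w] `&` K.
  have /open_subspaceP[U oU UE] := (continuousP _).1 (cphi w) _ (@open_gt R 0).
  by exists U.
have UP w x : K x -> U w x <-> 0 < phi x w.
  move=> Kx; have [_ /seteqP[h1 h2]] := hU w; split=> h.
    by have [] := h1 x (conj h Kx).
  by have [] := h2 x (conj h Kx).
apply: contrapT => /negP w1A.
pose C := \bigcup_(w in [set w | (w \in N) && connect r w0 w]) U w.
pose D := \bigcup_(w in [set w | (w \in N) && ~~ connect r w0 w]) U w.
have oC : open C by apply: bigcup_open => w _; case: (hU w).
have oD : open D by apply: bigcup_open => w _; case: (hU w).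
have CD x : K x -> C x -> D x -> False.
  move=> Kx [w /andP[wN cw] /(UP w x Kx) xw] [w' /andP[w'N /negP cw'] /(UP w' x Kx) xw'].
  apply: cw'; apply: connect_trans cw _; have [<-|nww] := eqVneq w w'.
    exact: connect0.
  apply: connect1; apply/and3P; split=> //; rewrite /skeleton /= nww /=.
  have [_ _ [t tF ht]] := bphi x Kx; apply/existsP; exists t.
  by rewrite tF !ht // gt_eqF.
have cover x : K x -> C x \/ D x.
  move=> Kx; have [p0 p1 _] := bphi x Kx.
  have [w pw] : exists w, 0 < phi x w.
    apply: contrapT => /forallNP h; have : \sum_w phi x w = 0.
      rewrite big1 // => w _; apply/eqP; rewrite eq_le p0 andbT leNgt.
      exact/negP.
    by rewrite p1 => /eqP; rewrite oner_eq0.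
  have wN : w \in N by apply/NP; exists x.
  by have [cw|cw] := boolP (connect r w0 w); [left|right];
    exists w; rewrite /= ?wN ?cw //; apply/UP.
have /NP[x0 [Kx0 xw0]] := w0N; have /NP[x1 [Kx1 xw1]] := w1N.
have Cx0 : C x0 by exists w0; rewrite /= ?w0N ?connect0 //; apply/UP.
have Dx1 : D x1 by exists w1; rewrite /= ?w1N //; apply/UP.
suff KC : K `&` C = K by apply: (CD x1 Kx1 _ Dx1); move: Kx1; rewrite -{1}KC => -[].
apply: Kc; first by exists x0.
  by exists C.
exists (~` D); first exact: open_closedC.
apply/seteqP; split=> x [Kx h]; split=> //; first by move/(CD x Kx h).
by have [] := cover x Kx.
Qed.

(** The images are disjoint compact sets, so the distance between them has a positive minimum. The
    norm is a maximum over coordinates, which yields a single [i]. The factor 2 leaves room for two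
    points, each [1 / 2 ^ k] away from a common vertex. *)
Lemma compact_separated (m n : nat) (f : 'rV[R]_m -> 'rV[R]_n) (X K K' : set 'rV[R]_m) :
  {within X, continuous f} -> {in X &, injective f} ->
  K `<=` X -> K' `<=` X -> compact K -> compact K' -> K `&` K' = classical_sets.set0 ->
  exists N : nat, forall k, (N <= k)%N -> forall x y, K x -> K' y ->
    exists i, 2 / 2 ^+ k < `|f x ord0 i - f y ord0 i|.
Proof.
move=> cf injf KX KX' cK cK' KK'.
have [[a Ka]|K0] := pselect (exists x, K x); last first.
  by exists 0%N => k _ x y Kx; case: K0; exists x.
have [[b Kb]|K0] := pselect (exists x, K' x); last first.
  by exists 0%N => k _ x y _ Ky; case: K0; exists y.
pose E := (f @` K) `*` (f @` K').
have cE : compact E.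
  apply: compact_setX; apply: continuous_compact => //.
    exact: continuous_subspaceW KX cf.
  exact: continuous_subspaceW KX' cf.
pose dist (z : 'rV[R]_n * 'rV[R]_n) : R := `|z.1 - z.2|.
have cdist : continuous dist.
  by move=> z; apply: cvg_norm; apply: cvgB; [exact: cvg_fst|exact: cvg_snd].
have E0 : E !=set0 by exists (f a, f b); split; [exists a|exists b].
have [c cE' hc] := compact_EVT_min E0 cE (continuous_subspaceT cdist).
have dpos : 0 < dist c.
  move: cE' => /set_mem[[x Kx fx] [y Ky fy]]; rewrite normr_gt0 subr_eq0.
  apply/eqP; rewrite -fx -fy.
  move=> /(injf _ _ (mem_set (KX _ Kx)) (mem_set (KX' _ Ky))) xy.
  by have : (K `&` K') x; [split=> //; rewrite xy|rewrite KK'].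
have dE : dist c = mx_norm (c.1 - c.2) by [].
exists (Num.Def.archi_bound (2 / dist c)) => k hk x y Kx Ky.
have small : 2 / 2 ^+ k < dist c.
  rewrite ltr_pdivrMr ?exprn_gt0 // mulrC -ltr_pdivrMr //.
  exact: upper_nthrootP.
have : dist c <= dist (f x, f y).
  by apply/hc/mem_set; split; [exists x|exists y].
move=> /(lt_le_trans small); rewrite {1}/dist /= => lt.
have nz : mx_norm (f x - f y) != 0.
  by apply: lt0r_neq0; apply: le_lt_trans lt; rewrite divr_ge0 ?exprn_ge0.
have [[i j] /= hij] := mx_norm_neq0 nz; exists j.
rewrite (_ : `|f x - f y| = mx_norm (f x - f y)) // hij in lt.
by move: lt; rewrite !mxE (ord1 i).
Qed.

End Drawing.

Section DrawnGraph.
Variable R : realType.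
Local Open Scope classical_set_scope.

Definition coord (W : finType) (x : 'rV[R]_#|W|) (w : W) : R := x ord0 (enum_rank w).

(** Lower bounds on coordinates cut out the pieces of the drawing, both the stars of vertices and
    the middle thirds of edges, as compact star-shaped sets. *)
Definition above (W : finType) (F : {set {set W}}) (theta : W -> R) :
    set 'rV[R]_#|W| :=
  [set x | realization R F x /\ forall w, theta w <= coord x w].

Section Above.
Variables (W : finType) (F : {set {set W}}) (theta : W -> R).

Lemma coord_cont (w : W) : continuous (fun x : 'rV[R]_#|W| => coord x w : R).
Proof. exact: coord_continuous. Qed.

Lemma coord_row (h : W -> R) w : coord (\row_i h (enum_val i)) w = h w.
Proof. by rewrite /coord mxE enum_rankK. Qed.

Lemma bary_le1 (lam : W -> R) (w : W) : bary F lam -> lam w <= 1.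
Proof.
by move=> [l0 l1 _]; rewrite -l1 (bigD1 w) //= lerDl sumr_ge0.
Qed.

Lemma bary_le1_pair (lam : W -> R) (u v : W) : bary F lam -> u != v -> lam u + lam v <= 1.
Proof.
move=> [l0 l1 _] nuv; rewrite -l1 (bigD1 u) //= (bigD1 v) 1?eq_sym //= addrA.
by rewrite lerDl sumr_ge0.
Qed.

Lemma above_compact : compact (above F theta).
Proof.
pose cube := [set v : 'rV[R]_#|W| | forall i, `[0, 1]%classic (v ord0 i)].
have ccube : compact cube.
  by apply: (@rV_compact R _ (fun=> `[0, 1])) => i; exact: segment_compact.
apply: (subclosed_compact _ ccube); last first.
  move=> x [bx _] i /=; rewrite in_itv /=; have [x0 _ _] := bx.
  have := x0 (enum_val i); have := bary_le1 (enum_val i) bx.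
  by rewrite /coord enum_valK => -> ->.
have half (D : set R) w : closed D -> closed [set x : 'rV[R]_#|W| | D (coord x w)].
  move=> cD; apply: (@preimage_closed _ _ (fun x => coord x w) D) => //.
  by move=> x _; exact: coord_cont.
have -> : above F theta =
    (\bigcap_(w in classical_sets.setT) [set x | theta w <= coord x w]) `&`
    ((\bigcap_(w in classical_sets.setT) [set x | 0 <= coord x w]) `&`
    ([set x : 'rV[R]_#|W| | \sum_w coord x w = 1] `&`
     \bigcup_(s in [set s | s \in F])
       \bigcap_(w in [set w | w \notin s]) [set x | coord x w = 0])).
  apply/seteqP; split=> x.
    case=> -[x0 x1 [s sF hs]] xt; split=> [w _|]; first exact: xt.
    split=> [w _|]; first exact: x0.
    split=> //; exists s => // w /= ws.
    by apply/eqP; apply: contraNT ws; exact: hs.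
  case=> xt [x0 [x1 [s sF hs]]]; split=> [|w]; last exact: xt.
  split=> [w||]; [exact: x0|exact: x1|exists s => // w].
  by apply: contraR => ws; apply/eqP; exact: hs.
apply: closedI.
  by apply: closed_bigI => w _; apply: (half _ w (@closed_ge R (theta w))).
apply: closedI; first by apply: closed_bigI => w _; apply: (half _ w (@closed_ge R 0)).
apply: closedI.
  apply: (@preimage_closed _ _ (fun x : 'rV[R]_#|W| => \sum_w coord x w) [set 1]).
    move=> x _.
    apply: (@continuous_big R W +%R 0 xpredT (@add_continuous R) _ _
      (fun w x => coord x w)) => w _; exact: coord_cont.
  exact: closed_eq.
apply: closed_bigcup => [|s _]; first exact: finite_finset.
by apply: closed_bigI => w _; apply: (half _ w (@closed_eq R 0)).
Qed.

(** The support of [p] is contained in that of every [x], so the segment from [x] to [p] stays in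
    the simplex carrying [x]. *)
Lemma above_connected p : above F theta p ->
  (forall x w, above F theta x -> coord p w != 0 -> coord x w != 0) ->
  connected (above F theta).
Proof.
move=> Kp supp; apply: (star_connected Kp) => x t Kx /andP[t0 t1].
have cE w : coord (x + t *: (p - x)) w = (1 - t) * coord x w + t * coord p w.
  by rewrite /coord !mxE; lra.
have [[x0 x1 [s sF hs]] xt] := Kx; have [[p0 p1 _] pt] := Kp.
have t1' : 0 <= 1 - t by lra.
split; last first.
  move=> w; rewrite cE; have := ler_wpM2l t0 (pt w); have := ler_wpM2l t1' (xt w).
  by move: (coord x w) (coord p w) => a b; lra.
split=> [w||]; first by
    rewrite -/(coord _ w) cE; apply: addr_ge0; apply: mulr_ge0;
    rewrite // ?t1' //; [exact: x0|exact: p0].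
- under eq_bigr do rewrite -/(coord _ _) cE.
  by rewrite big_split /= -!mulr_sumr x1 p1; lra.
exists s => // w; rewrite -/(coord _ w) cE => nz; apply: hs.
apply: contra_neq nz => xw; rewrite [coord x w]xw mulr0 add0r.
have [->|pw] := eqVneq (coord p w) 0; first by rewrite mulr0.
by have := supp x w Kx pw; rewrite /coord xw eqxx.
Qed.

End Above.

Lemma drawing_minor (g : nat) (G : sgraph) (W : finType) (F : {set {set W}}) :
  surface g F -> embeds_in R G F ->
  exists (W' : finType) (F' : {set {set W'}}) (c : W' -> option G),
    [/\ surface g F', fibers_connected (skeleton F') c &
        forall u v, adj u v -> linked (skeleton F') c u v].
Proof.
move=> sF [f /= [cf injf imf]]; set X := realization R (graph_complex G) in cf injf imf.
have adj_neq (u v : G) : adj u v -> u != v.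
  by apply: contraTneq => ->; rewrite adj_irr.
(* Two vertex pieces are disjoint because [2/3 + 2/3 > 1]; the middle third of an edge still meets
   the pieces of both its ends, at the points with coordinates 2/3 and 1/3. *)
pose theta (i : G + G * G) (w : G) : R :=
  match i with
  | inl v => if w == v then 2 / 3 else 0
  | inr (u, v) => if (w == u) || (w == v) then 3^-1 else 0
  end.
pose K i := above (graph_complex G) (theta i).
have KX i : K i `<=` X by move=> x [].
have hsep (p : (G + G * G) * (G + G * G)) : exists N : nat,
    K p.1 `&` K p.2 = classical_sets.set0 ->
    forall k, (N <= k)%N -> forall x y, K p.1 x -> K p.2 y ->
    exists i, 2 / 2 ^+ k < `|f x ord0 i - f y ord0 i|.
  have [h|h] := pselect (K p.1 `&` K p.2 = classical_sets.set0); last by exists 0%N.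
  have [N hN] := compact_separated cf injf (@KX _) (@KX _)
    (@above_compact _ _ _) (@above_compact _ _ _) h.
  by exists N => _; exact: hN.
(* One subdivision is fine enough for all of the finitely many pairs of pieces. *)
have [N hN] := choice hsep; pose n := (\max_p N p)%N.
have [W' [F' [L [sF' bL cL mL]]]] := @refinement_exists R g n _ _ sF.
pose phi x w := L (coord (f x)) w.
have bf x : X x -> bary F (coord (f x)).
  by move=> Xx; apply: (imf (f x)); exists x.
have bphi x : X x -> bary F' (phi x) by move=> /bf; exact: bL.
pose S i := [set w | `[< exists x, K i x /\ 0 < phi x w >]]%SET.
have SP i w : w \in S i <-> exists x, K i x /\ 0 < phi x w.
  by rewrite inE; split=> /asboolP.
(* Pieces whose traces share a refined vertex do meet. Otherwise some coordinate [k] separates their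
   images by more than [2 / 2 ^ n], although both are within [1 / 2 ^ n] of its value [h' w] at that
   vertex. *)
have Smeet i j w : w \in S i -> w \in S j -> exists z, K i z /\ K j z.
  case/SP=> x [Kx xw] /SP[y [Ky yw]]; apply: contrapT => /forallNP hK.
  have /(hN (i, j))/(_ n (leq_bigmax (i, j)) x y Kx Ky)[k] :
      K i `&` K j = classical_sets.set0.
    by apply/seteqP; split=> z // hz; case: (hK z).
  pose h (w : W) : R := (enum_rank w == k)%:R.
  have hv : variation_le F h 1.
    move=> t a b _ _ _; rewrite /h.
    by do 2!case: eqP => _; rewrite ?subrr ?subr0 ?sub0r ?normrN ?normr1 ?normr0.
  have [h' [hv' hm]] := mL _ _ hv.
  have hc z : X z -> \sum_s phi z s * h' s = f z ord0 k.
    move=> /bf bz; rewrite hm // (bigD1 (enum_val k)) //= big1 ?addr0.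
      by rewrite /h /coord enum_valK eqxx mulr1.
    move=> a na; rewrite /h (_ : (enum_rank a == k) = false) ?mulr0 //.
    by apply: contraNF na => /eqP <-; rewrite enum_rankK.
  have hx := bary_near_vertex hv' (bphi x (KX _ _ Kx)) (lt0r_neq0 xw).
  have hy := bary_near_vertex hv' (bphi y (KX _ _ Ky)) (lt0r_neq0 yw).
  move: hx hy; rewrite !hc; [|exact: KX Ky|exact: KX Kx].
  move=> hx; rewrite distrC => hy; rewrite ltNge => /negP; apply.
  apply: (le_trans (ler_distD (h' w) _ _)); apply: (le_trans (lerD hx hy)).
  by rewrite -mulrDl.
have Sin i j z : K i z -> K j z -> exists2 w, w \in S i & w \in S j.
  move=> Ki Kj; have [p0 p1 _] := bphi z (KX _ _ Ki).
  have [w pw] : exists w, 0 < phi z w.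
    apply: contrapT => /forallNP h; have : \sum_w phi z w = 0.
      rewrite big1 // => w _; apply/eqP; rewrite eq_le p0 andbT leNgt.
      exact/negP.
    by rewrite p1 => /eqP; rewrite oner_eq0.
  by exists w; apply/SP; exists z.
have Sconn i : connected (K i) -> connected_in (skeleton F') (S i).
  move=> Kc; apply: (nerve_connected Kc) => [w|x Kx]; last exact: bphi (KX _ _ Kx).
  (* The drawing is continuous only on its domain, so the topological space [T] is the subspace
     [K i]. *)
  apply: (cL (subspace (K i)) (fun x w => coord (f x) w)) => a x.
  apply: (@continuous_comp (subspace (K i)) _ _ f (fun y => coord y a)).
    exact: (continuous_subspaceW (@KX i) cf).
  exact: coord_cont.
pose pt (u v : G) (a : R) : 'rV[R]_#|G| :=
  \row_k (a * (enum_val k == u)%:R + (1 - a) * (enum_val k == v)%:R).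
have ptE u v a w : coord (pt u v a) w = a * (w == u)%:R + (1 - a) * (w == v)%:R.
  exact: (coord_row (fun w => a * (w == u)%:R + (1 - a) * (w == v)%:R)).
have ptX u v a : (u == v) || adj u v -> 0 <= a <= 1 -> X (pt u v a).
  move=> uv /andP[a0 a1]; have a1' : 0 <= 1 - a by lra.
  split=> [w||].
  - by rewrite -/(coord _ w) ptE addr_ge0 ?mulr_ge0.
  - under eq_bigr do rewrite -/(coord _ _) ptE.
    have one (x : G) : \sum_w (w == x)%:R = 1 :> R.
      by rewrite (bigD1 x) //= eqxx big1 ?addr0 // => w /negPf->.
    by rewrite big_split /= -!mulr_sumr !one; lra.
  exists [set u; v]%SET.
    rewrite inE; case/orP: uv => [/eqP->|uv]; apply/orP; [left|right].
      by apply/existsP; exists v; rewrite setUid.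
    by apply/existsP; exists u; apply/existsP; exists v; rewrite uv eqxx.
  move=> w; rewrite -/(coord _ w) ptE !inE.
  by case: (w == u); case: (w == v); rewrite // !mulr0 addr0 eqxx.
have supp2 z (u v : G) : X z -> adj u v -> coord z u != 0 -> coord z v != 0 ->
    forall w, coord z w != 0 -> w \in [set u; v]%SET.
  move=> [_ _ [s]]; rewrite inE => sG hs uv zu zv w zw.
  have us := hs u zu; have vs := hs v zv; have ws := hs w zw.
  have nuv := adj_neq _ _ uv; case/orP: sG => /existsP[a].
    move=> /eqP sE; move: us vs; rewrite sE !inE => /eqP ua /eqP va.
    by rewrite ua va eqxx in nuv.
  case/existsP=> b /andP[_ /eqP sE].
  have <- : s = [set u; v]%SET; last by [].
  apply/esym/eqP; rewrite eqEcard set2_sub us vs /= sE !cards2 nuv.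
  by case: (_ != _).
have pos i z w : K i z -> 0 < theta i w -> coord z w != 0.
  by move=> [_ /(_ w) h] h0; apply: lt0r_neq0; apply: lt_le_trans h0 h.
have posv v : 0 < theta (inl v) v by rewrite /= eqxx; lra.
have posl u v : 0 < theta (inr (u, v)) u by rewrite /= eqxx /= invr_gt0.
have posr u v : 0 < theta (inr (u, v)) v by rewrite /= eqxx orbT invr_gt0.
have Kv v : K (inl v) (pt v v 1).
  split; first by apply: ptX; rewrite ?eqxx // ler01 lexx.
  move=> w; rewrite ptE /= subrr mul0r addr0 mul1r.
  by case: (w == v) => //=; lra.
have Kuv u v a : adj u v -> 3^-1 <= a <= 1 - 3^-1 -> K (inr (u, v)) (pt u v a).
  move=> uv /andP[a1 a2]; split.
    by apply: ptX; rewrite ?uv ?orbT //; apply/andP; split; lra.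
  move=> w; rewrite ptE /=; have [->|_] := eqVneq w u.
    by rewrite (negPf (adj_neq _ _ uv)) /=; lra.
  by case: (w == v) => //=; lra.
have [c [fc lc]] : exists c : W' -> option G,
    fibers_connected (skeleton F') c /\
    forall u v, adj u v -> linked (skeleton F') c u v.
  apply: (@minor_of_system _ _ (skeleton F') adj (fun u => S (inl u))
    (fun u v => S (inr (u, v)))).
  - by move=> x y; rewrite /skeleton /= eq_sym; congr (_ && _);
      apply: eq_existsb => t; congr (_ && _); rewrite andbC.
  - exact: adj_sym.
  - exact: adj_irr.
  - move=> u; apply/Sconn/(above_connected (Kv u)) => x w Kx.
    rewrite ptE; have [-> _|_] := eqVneq w u; last by rewrite !mulr0 addr0 eqxx.
    exact: pos Kx (posv u).
  - move=> u v uv; have Kp : K (inr (u, v)) (pt u v 2^-1).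
      by apply: Kuv => //; apply/andP; split; lra.
    apply/Sconn/(above_connected Kp) => x w Kx.
    rewrite ptE; have [-> _|_] := eqVneq w u; first exact: pos Kx (posl u v).
    have [-> _|_] := eqVneq w v; first exact: pos Kx (posr u v).
    by rewrite !mulr0 addr0 eqxx.
  - move=> u v w wu wv; have [z [[zX zu] [_ zv]]] := Smeet _ _ _ wu wv.
    apply/eqP; apply: contraT => nuv.
    have : coord z u + coord z v <= 1 := bary_le1_pair zX nuv.
    have := zu u; have := zv v.
    by rewrite /= !eqxx; lra.
  - move=> u v u' v' w uv uv' w1 w2; have [z [K1 K2]] := Smeet _ _ _ w1 w2.
    have zX := KX _ _ K1.
    have s1 := supp2 z u v zX uv (pos _ _ _ K1 (posl _ _)) (pos _ _ _ K1 (posr _ _)).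
    have a1 := s1 _ (pos _ _ _ K2 (posl _ _)); have a2 := s1 _ (pos _ _ _ K2 (posr _ _)).
    apply/esym/eqP; rewrite eqEcard set2_sub a1 a2 !cards2.
    by rewrite (adj_neq _ _ uv) (adj_neq _ _ uv').
  - move=> u v x w uv w1 w2; have [z [K1 K2]] := Smeet _ _ _ w1 w2.
    have zX := KX _ _ K1.
    have s1 := supp2 z u v zX uv (pos _ _ _ K1 (posl _ _)) (pos _ _ _ K1 (posr _ _)).
    by have := s1 _ (pos _ _ _ K2 (posv _)); rewrite !inE.
  move=> u v uv; split.
    apply: (Sin (inr (u, v)) (inl u) (pt u v (2 / 3))).
      by apply: Kuv => //; apply/andP; split; lra.
    split; first by apply: ptX; rewrite ?uv ?orbT //; apply/andP; split; lra.
    move=> w; rewrite ptE /=; have [->|_] := eqVneq w u; last by case: (w == v) => //=; lra.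
    by rewrite (negPf (adj_neq _ _ uv)) /=; lra.
  apply: (Sin (inr (u, v)) (inl v) (pt u v (1 / 3))).
    by apply: Kuv => //; apply/andP; split; lra.
  split; first by apply: ptX; rewrite ?uv ?orbT //; apply/andP; split; lra.
  move=> w; rewrite ptE /=; have [->|_] := eqVneq w v; last by case: (w == u) => //=; lra.
  by rewrite eq_sym (negPf (adj_neq _ _ uv)) /=; lra.
by exists W', F', c.
Qed.

Theorem genus_sparse (g : nat) (G : sgraph) :
  euler_genus_at_most R g G -> sparse g (@adj G).
Proof.
move=> [W [F [cF gF eF]]].
have [W' [F' [c [sF' fc lc]]]] :=
  drawing_minor (closed_surface_surface cF gF) eF.
exact: sparse_minor fc lc (surface_sparse sF').
Qed.

End DrawnGraph.

(** * Counting in graphs with sparse minors *)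

Lemma card_pairs (I J : finType) (A : {set I}) (Q : I -> J -> bool) :
  #|[set p : I * J | (p.1 \in A) && Q p.1 p.2]| =
  (\sum_(i in A) #|[set j | Q i j]|)%N.
Proof.
under eq_bigr do rewrite -sum1_card.
rewrite pair_big_dep /= -sum1_card; apply: eq_bigl => -[i j] /=.
by rewrite !inE.
Qed.

Lemma card_bigcup_le (I T : finType) (P : pred I) (A : I -> {set T}) :
  (#|\bigcup_(i | P i) A i| <= \sum_(i | P i) #|A i|)%N.
Proof.
elim/big_rec2: _ => [|i n B _ h]; first by rewrite cards0.
by apply: leq_trans (leq_card_setU _ _) _; rewrite leq_add2l.
Qed.

Section SparseCounting.
Variables (g : nat) (V : finType) (e : rel V).
Hypothesis e_sym : symmetric e.
Hypothesis e_irr : irreflexive e.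
Hypothesis sp : sparse g e.

Lemma sparse_ordered (Y : finType) (c : V -> option Y) : fibers_connected e c ->
  (#|[set p : Y * Y | (p.1 != p.2) && linked e c p.1 p.2]| <= 6 * (#|Y| + g))%N.
Proof.
move=> fc; pose H := [set [set p.1; p.2] | p in
  [set p : Y * Y | (p.1 != p.2) && linked e c p.1 p.2]].
have lH : linked_pairs e c H.
  by move=> h /imsetP[[y y']]; rewrite inE => /andP[/= ny ly] ->; exists y, y'.
have [hH _] := sp fc lH.
rewrite (_ : 6 * _ = 2 * (3 * (#|Y| + g)))%N; last by lia.
apply: (@leq_trans (2 * #|H|)); last by rewrite leq_pmul2l.
rewrite -sum1_card (partition_big (fun p => [set p.1; p.2]) (mem H)) /=; last first.
  by move=> p hp; apply: imset_f.
rewrite mulnC -sum_nat_const; apply: leq_sum => h /imsetP[[a b] _ /= ->].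
rewrite sum1_card; apply: (@leq_trans #|[set (a, b); (b, a)]|); last first.
  by rewrite cards2; case: (_ != _).
apply/subset_leq_card/fintype.subsetP => -[y y'] /andP[].
rewrite !inE /= => /andP[ny _] /eqP h'.
have : y \in [set a; b] by rewrite -h' !inE eqxx.
have : y' \in [set a; b] by rewrite -h' !inE eqxx orbT.
rewrite !inE => /orP[]/eqP y'E /orP[]/eqP yE; move: ny; rewrite yE y'E ?eqxx //.
by rewrite orbT.
Qed.

(** Corestricting [c] to the subtype of [A] replaces [|V|] by [|A|] in the bound. *)
Lemma sparse_ordered_on (A : {set V}) (c : V -> option V) :
  fibers_connected e c -> (forall v y, c v = Some y -> y \in A) ->
  (#|[set p : V * V | (p.1 != p.2) && linked e c p.1 p.2]| <= 6 * (#|A| + g))%N.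
Proof.
move=> fc cA; pose Y := {y | y \in A}.
pose c' v : option Y := obind insub (c v).
have c'P v (y : Y) : (c' v == Some y) = (c v == Some (val y)).
  rewrite /c'; case E : (c v) => [z|] //=; have zA := cA _ _ E.
  by rewrite insubT /= !(inj_eq Some_inj) -val_eqE.
have c'E v v' : (c' v == c' v') = (c v == c v').
  have cN u : c u = None -> c' u = None by rewrite /c' => ->.
  have cS u z : c u = Some z -> exists y : Y, c' u = Some y.
    by move=> h; exists (exist (fun y => y \in A) z (cA _ _ h)); apply/eqP; rewrite c'P h.
  case E : (c v) => [z|]; last first.
    rewrite (cN _ E); case E' : (c v') => [z'|]; last by rewrite (cN _ E').
    by have [y' ->] := cS _ _ E'.
  have [y /[dup] yE /eqP] := cS _ _ E; rewrite c'P E => /eqP[zy].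
  by rewrite yE eq_sym c'P zy eq_sym.
have fc' : fibers_connected e c'.
  move=> x x' /eqP; rewrite c'E => /eqP cx nx.
  have := fc _ _ cx; rewrite /c' in nx.
  have nx' : c x <> None by move=> h; rewrite h in nx.
  move=> /(_ nx'); congr (is_true (connect _ _ _)).
  by apply/funext => a; apply/funext => b; rewrite /= !c'E.
have := sparse_ordered fc'; rewrite card_sig => /(leq_trans _); apply.
rewrite -[X in (_ <= X)%N](card_imset _
  (_ : injective (fun p : Y * Y => (val p.1, val p.2)))).
  apply/subset_leq_card/fintype.subsetP => -[y y']; rewrite inE /= => /andP[ny].
  case/existsP=> x /existsP[x' /and3P[xx cx cx']].
  have yA := cA _ _ (eqP cx); have yA' := cA _ _ (eqP cx').
  apply/imsetP; exists (exist (fun y => y \in A) y yA, exist (fun y => y \in A) y' yA') => //.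
  rewrite inE /= -val_eqE /= ny; apply/existsP; exists x; apply/existsP; exists x'.
  by rewrite xx !c'P cx cx'.
by move=> [a b] [a' b'] /= [/val_inj-> /val_inj->].
Qed.

Definition arcs (A B : {set V}) :=
  [set p : V * V | (p.1 \in A) && ((p.2 \in B) && e p.1 p.2)].

Lemma arcs_square (A : {set V}) : (#|arcs A A| <= 6 * (#|A| + g))%N.
Proof.
pose c v := if v \in A then Some v else None.
have cE v y : c v = Some y <-> v = y /\ v \in A.
  by rewrite /c; case: ifP => vA; split=> // -[] // ->.
have fc : fibers_connected e c.
  move=> x x'; case E : (c x) => [y|] // /esym/cE[-> _].
  by move/cE: E => [-> _] _; exact: connect0.
apply: leq_trans (sparse_ordered_on fc (_ : forall v y, c v = Some y -> y \in A)).
  apply/subset_leq_card/fintype.subsetP => -[x y]; rewrite !inE /= => /and3P[xA yA xy].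
  apply/andP; split; first by apply: contraTneq xy => ->; rewrite e_irr.
  by apply/existsP; exists x; apply/existsP; exists y; rewrite xy /c xA yA !eqxx.
by move=> v y /cE[<-].
Qed.

Lemma arcsC (A B : {set V}) : #|arcs A B| = #|arcs B A|.
Proof.
rewrite -(card_imset _ (_ : injective (fun p : V * V => (p.2, p.1)))).
  apply: eq_card => -[x y]; apply/imsetP/idP => [[[a b]]|].
    by rewrite !inE /= => /and3P[aA bB ab] [-> ->]; rewrite bB aA e_sym.
  rewrite !inE /= => /and3P[xB yA xy]; exists (y, x); rewrite ?inE //=.
  by rewrite xB yA e_sym.
by move=> [a b] [a' b'] /= [-> ->].
Qed.

(** Arcs from [A] to [B] and back all lie in the union, and those counted twice lie in the
    intersection; apply [arcs_square] to both and halve. *)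
Lemma arcs_bound (A B : {set V}) : (#|arcs A B| <= 3 * (#|A| + #|B|) + 6 * g)%N.
Proof.
have h : (#|arcs A B| + #|arcs B A| <=
    #|arcs (A :|: B) (A :|: B)| + #|arcs (A :&: B) (A :&: B)|)%N.
  rewrite -cardsUI; apply: leq_add; apply/subset_leq_card/fintype.subsetP => -[x y];
    rewrite !inE /=.
    by case: (x \in A); case: (x \in B); case: (y \in A); case: (y \in B); case: (e x y).
  by case: (x \in A); case: (x \in B); case: (y \in A); case: (y \in B); case: (e x y).
have := arcs_square (A :|: B); have := arcs_square (A :&: B).
by have := cardsUI A B; rewrite [#|arcs B A|]arcsC in h; lia.
Qed.

(** With [m] common neighbors there is a complete bipartite graph with parts 3 and [m], whence
    [3 m <= 2 (m + 3 + g)]. *)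
Lemma common_neighbors (t : 'I_3 -> V) : injective t ->
  (#|[set x | [forall i, e (t i) x]]| <= 6 + 2 * g)%N.
Proof.
move=> tinj; set C := finset _; pose Y := ({x | x \in C} + 'I_3)%type.
have tC i : t i \notin C.
  by rewrite inE; apply/negP => /forallP/(_ i); rewrite e_irr.
pose c v : option Y := if [pick i | t i == v] is Some i then Some (inr i)
  else omap inl (insub v).
have ct i : c (t i) = Some (inr i).
  rewrite /c; case: pickP => [j /eqP/tinj-> //|/(_ i)].
  by rewrite eqxx.
have cC (x : {x | x \in C}) : c (val x) = Some (inl x).
  rewrite /c; case: pickP => [j /eqP jx|_]; last by rewrite valK.
  by have := valP x; rewrite -jx (negPf (tC j)).
have cinj v v' : c v = c v' -> c v <> None -> v = v'.
  rewrite /c; case: pickP => [i /eqP <-|_]; case: pickP => [j /eqP <-|_] //=.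
  - by move=> [->].
  - by case: insubP.
  - by case: insubP.
  by case: insubP => // x _ <-; case: insubP => // y _ <- /= [->].
have fc : fibers_connected e c by move=> x x' h /(cinj _ _ h) ->; exact: connect0.
pose f (p : 'I_3 * {x | x \in C}) : {set Y} := [set inr p.1; inl p.2].
have finj : injective f.
  move=> [i x] [j y] /setP h.
  have := h (inr i); have := h (inl x); rewrite !inE /= !eqxx /=.
  by move=> /esym/eqP[->]; rewrite orbF => /esym/eqP[->].
pose H := [set f p | p in setT].
have lH : linked_pairs e c H.
  move=> h /imsetP[[i x] _ ->]; exists (inr i), (inl x); split=> //.
  apply/existsP; exists (t i); apply/existsP; exists (val x).
  rewrite ct cC !eqxx !andbT; have := valP x; rewrite inE => /forallP; exact.
have [_ /(_ [set inr i | i in setT])] := sp fc lH.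
rewrite card_imset // cardsT card_prod card_ord card_sum card_ord card_sig.
rewrite (_ : #|[pred x in C]| = #|C|) //.
suff h : forall h : {set Y}, h \in H -> #|h :&: [set inr i | i in setT]| = 1%N.
  by move=> /(_ h); lia.
move=> h /imsetP[[i x] _ ->]; apply/eqP/cards1P; exists (inr i); apply/setP => y.
rewrite !inE; case: y => [z|j] /=; first by apply/negbTE/negP => /andP[_ /imsetP[]].
by rewrite orbF imset_f ?inE // andbT.
Qed.

Section Stars.
Variables (U X D : {set V}) (dm : V -> V).
Hypothesis U_closed : forall u v, u \in U -> e u v -> v \in U.
Hypotheses (XU : X \subset U) (XD : forall v, v \in X -> v \notin D).
Hypothesis dmD : forall u, u \in U -> dm u \in D.
Hypothesis dm_adj : forall u, u \in U -> dm u = u \/ e u (dm u).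
Hypothesis dm_id : forall u, u \in D -> dm u = u.
Hypothesis DU : D \subset U.

(** Contracting along [star_of] gives a minor on [X] and [D]: the vertices of [X] stay single, all
    others join the star of their dominator. *)
Definition star_of v := if v \in X then v else dm v.

Definition star_neighbors v := [set star_of u | u in [set u | e v u]].

(** The pairs between [X] and [D] occur in both directions among the [6 (|X| + |D| + g)] ordered
    pairs of the minor, those inside [X] number at most [6 (|X| + g)]. Adding the two bounds counts
    everything twice. *)
Lemma star_degree_sum :
  (\sum_(v in X) #|star_neighbors v| <= 6 * #|X| + 3 * #|D| + 6 * g)%N.
Proof.
pose c v := if v \in U then Some (star_of v) else None.
have starXD u : u \in U -> star_of u \in X :|: D.
  by move=> uU; rewrite /star_of inE; case: ifP => [->|_]; rewrite ?dmD ?orbT.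
have fc : fibers_connected e c.
  have hub u y : c u = Some y -> connect
      [rel a b | [&& e a b, c a == Some y & c b == Some y]] u y /\ connect
      [rel a b | [&& e a b, c a == Some y & c b == Some y]] y u.
    move=> /[dup] cu; rewrite {1}/c; case: ifP => // uU [].
    rewrite /star_of; case: ifP => [uX <-|uX dy]; first by rewrite connect0.
    have yD : y \in D by rewrite -dy dmD.
    have cy : c y = Some y.
      rewrite /c (fintype.subsetP DU y yD) /star_of.
      by case: ifP => // _; rewrite dm_id.
    have [du|] := dm_adj uU; first by rewrite -dy du connect0.
    rewrite dy => uy; split; apply: connect1; rewrite /= cu cy !eqxx ?uy //.
    by rewrite e_sym uy.
  move=> x x'; case E : (c x) => [y|] // /esym E' _.
  have [xy _] := hub _ _ E; have [_ yx'] := hub _ _ E'.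
  exact: connect_trans xy yx'.
have cXD v y : c v = Some y -> y \in X :|: D.
  by rewrite /c; case: ifP => // vU [<-]; exact: starXD.
have hP := sparse_ordered_on fc cXD; set P := finset _ in hP.
have star_neq v u : v \in X -> e v u -> star_of u != v.
  move=> vX vu; rewrite /star_of; case: ifP => uX.
    by apply: contraTneq vu => ->; rewrite e_irr.
  have uU : u \in U by apply: U_closed vu; apply: (fintype.subsetP XU).
  by apply: contraTneq (dmD uU) => ->; exact: XD.
have lP v z : v \in X -> z \in star_neighbors v -> (v, z) \in P /\ (z, v) \in P.
  move=> vX /imsetP[u]; rewrite inE => vu zE.
  have vU : v \in U by apply: (fintype.subsetP XU).
  have uU := U_closed vU vu.
  have cv : c v = Some v by rewrite /c vU /star_of vX.
  have cu : c u = Some z by rewrite /c uU zE.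
  have nz : z != v by rewrite zE star_neq.
  rewrite !inE /= nz eq_sym nz /=; split.
    by apply/existsP; exists v; apply/existsP; exists u; rewrite vu cv cu !eqxx.
  by apply/existsP; exists u; apply/existsP; exists v; rewrite e_sym vu cv cu !eqxx.
pose PX := [set p : V * V | (p.1 \in X) && (p.2 \in star_neighbors p.1 :&: X)].
pose PD := [set p : V * V | (p.1 \in X) && (p.2 \in star_neighbors p.1 :&: D)].
have -> : (\sum_(v in X) #|star_neighbors v| = #|PX| + #|PD|)%N.
  rewrite (card_pairs X (fun v z => z \in star_neighbors v :&: X)).
  rewrite (card_pairs X (fun v z => z \in star_neighbors v :&: D)).
  rewrite -big_split /=; apply: eq_bigr => v vX.
  rewrite -cardsUI.
  have -> : [set j in star_neighbors v :&: X] = star_neighbors v :&: X.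
    by apply/setP => j; rewrite !inE.
  have -> : [set j in star_neighbors v :&: D] = star_neighbors v :&: D.
    by apply/setP => j; rewrite !inE.
  rewrite -setIUr -setIIr; have /setIidPl -> : star_neighbors v \subset X :|: D.
    apply/fintype.subsetP => z /imsetP[u]; rewrite inE => vu ->; apply: starXD.
    by apply: U_closed vu; apply: (fintype.subsetP XU).
  rewrite (_ : X :&: D = set0) ?setI0 ?cards0 ?addn0 //.
  by apply/setP => z; rewrite !inE; apply/negbTE/negP => /andP[/XD/negP].
have hX : (#|PX| <= 6 * (#|X| + g))%N.
  apply: leq_trans (arcs_square X); apply/subset_leq_card/fintype.subsetP => -[v z].
  rewrite !inE /= => /and3P[vX /imsetP[u]]; rewrite inE => vu zE zX.
  rewrite vX zX /=; have uU : u \in U.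
    by apply: U_closed vu; apply: (fintype.subsetP XU).
  move: zE; rewrite /star_of; case: ifP => [_ ->//|_ zE].
  by move: (XD zX); rewrite zE dmD.
pose PD' := [set (p.2, p.1) | p in PD].
have cPD' : #|PD'| = #|PD|.
  by rewrite card_imset // => -[a b] [a' b'] /= [-> ->].
have sub : PX :|: PD :|: PD' \subset P.
  rewrite !subUset -andbA; apply/and3P; split; apply/fintype.subsetP => -[v z].
  - by rewrite inE /= => /andP[vX]; rewrite inE => /andP[zT _]; case: (lP v z).
  - by rewrite inE /= => /andP[vX]; rewrite inE => /andP[zT _]; case: (lP v z).
  case/imsetP=> -[a b]; rewrite inE /= => /andP[aX]; rewrite inE => /andP[bT _].
  by move=> [-> ->]; case: (lP a b).
have d1 : [disjoint PX & PD].
  apply/pred0P => -[v z]; apply/negbTE/negP; rewrite /= !inE /=.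
  by case/andP=> /and3P[_ _ /XD/negP zX] /and3P[_ _].
have d2 : [disjoint PX :|: PD & PD'].
  apply/pred0P => -[v z]; apply/negbTE/negP; rewrite /= !inE /=.
  case/andP=> vX /imsetP[[a b]]; rewrite !inE /= => /and3P[_ _ bD] [vb _].
  have vX' : v \in X by case/orP: vX => /andP[].
  by have := XD vX'; rewrite vb bD.
have := subset_leq_card sub.
rewrite (eqP (etrans (leq_card_setU _ _).2 d2)) (eqP (etrans (leq_card_setU _ _).2 d1)).
have : (#|X :|: D| <= #|X| + #|D|)%N by exact: leq_card_setU.
lia.
Qed.

End Stars.
End SparseCounting.

(** * The three phases of the algorithm *)

Section Phases.
Variables (V : finType) (e : rel V) (M J : nat).

Definition coverable (v : V) : bool :=
  [exists S : {set V}, [&& (#|S| <= 8)%N, v \notin S &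
    [forall u, e v u ==> ((u \in S) || [exists w in S, e u w])]]].

Definition phase1 : {set V} := [set v | ~~ coverable v].

Definition residual (D : {set V}) : {set V} :=
  [set u | (u \notin D) && [forall w in D, ~~ e u w]].

Definition phase2 : {set V} := [set v | (v \notin phase1) &&
  (M <= #|[set u in residual phase1 | e v u]|)%N].

Definition target : {set V} := residual (phase1 :|: phase2).

Definition load (w : V -> nat) (v : V) : nat := (w v + \sum_(u | e v u) w u)%N.

(* The weights form a fractional packing with capacity [14 * 2 ^ J]; a vertex
   saturates at half of it, so that doubling the weights away from the saturated
   vertices never exceeds the capacity. *)
Definition saturated (w : V -> nat) : {set V} := [set v | (7 * 2 ^ J <= load w v)%N].

Definition grow (w : V -> nat) (u : V) : nat :=
  if u \in residual (saturated w) then (2 * w u)%N else w u.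

Definition weight (i : nat) : V -> nat := iter i grow (fun u => u \in target : nat).

(** A target not dominated by saturated vertices has doubled in every round, so its weight [2 ^ J]
    pays for selecting it. *)
Definition phase3 : {set V} :=
  saturated (weight J) :|: target :&: residual (saturated (weight J)).

Definition local_dominating : {set V} := phase1 :|: phase2 :|: phase3.

Lemma residualP (D : {set V}) u :
  reflect (u \notin D /\ forall w, w \in D -> ~~ e u w) (u \in residual D).
Proof.
rewrite inE; apply: (iffP andP) => -[uD h]; split=> //.
  by move=> w wD; move/forallP/(_ w)/implyP: h; exact.
by apply/forallP => w; apply/implyP; exact: h.
Qed.

Lemma not_residual (D : {set V}) u : u \notin residual D ->
  u \in D \/ exists2 w, w \in D & e u w.
Proof.
move=> uD; have [|uD'] := boolP (u \in D); first by left.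
right; move: uD; rewrite inE uD' /= => /forallPn[w].
by rewrite negb_imply negbK => /andP[]; exists w.
Qed.

Lemma residualS (D D' : {set V}) : D \subset D' -> residual D' \subset residual D.
Proof.
move=> /fintype.subsetP DD; apply/fintype.subsetP => u /residualP[uD h].
apply/residualP; split; first by apply: contra uD; exact: DD.
by move=> w /DD; exact: h.
Qed.

Lemma local_dominating_dominates u :
  u \in local_dominating \/ exists2 w, w \in local_dominating & e u w.
Proof.
have sub (A : {set V}) : A \subset local_dominating -> u \notin residual A ->
    u \in local_dominating \/ exists2 w, w \in local_dominating & e u w.
  move=> /fintype.subsetP AD /not_residual[/AD|[w /AD wD uw]]; [by left|right].
  by exists w.
have [uT|uT] := boolP (u \in target); last exact: sub (subsetUl _ _) uT.
have [uS|uS] := boolP (u \in residual (saturated (weight J))).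
  by left; apply/setUP; right; apply/setUP; right; apply/setIP.
apply: sub uS; apply: subset_trans (subsetUr _ _); exact: subsetUl.
Qed.

End Phases.

(** * Vertices taken by the first two phases *)

Section PhaseBounds.
Variables (g : nat) (V : finType) (e : rel V).
Hypothesis e_sym : symmetric e.
Hypothesis e_irr : irreflexive e.
Hypothesis sp : sparse g e.
Variables (U D : {set V}).
Hypothesis U_closed : forall u v, u \in U -> e u v -> v \in U.
Hypothesis DU : D \subset U.
Hypothesis D_dom : forall u, u \in U -> u \in D \/ exists2 w, w \in D & e u w.

(* Three vertices have at most [6 + 2 * g] common neighbors, so this many common
   neighbors of [v] and [d] cannot be dominated by 8 vertices other than [v] and
   [d]. *)
Definition common_bound := (8 * (6 + 2 * g + 1) + 1)%N.
(** More neighbors than 8 stars can absorb when each takes at most [common_bound] of them. *)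
Definition degree_bound := (8 * common_bound + 1)%N.

Let M := degree_bound.

Lemma dominator_exists : exists dm : V -> V,
  [/\ forall u, u \in U -> dm u \in D,
      forall u, u \in U -> dm u = u \/ e u (dm u) &
      forall u, u \in D -> dm u = u].
Proof.
have /choice[dm h] u : exists d, (u \in U -> d \in D) /\
    (u \in U -> d = u \/ e u d) /\ (u \in D -> d = u).
  have [uD|uD] := boolP (u \in D); first by exists u; split=> //; split=> //; left.
  have [uU|uU] := boolP (u \in U); last by exists u.
  have [uD'|[w wD uw]] := D_dom uU; first by rewrite uD' in uD.
  by exists w; split=> //; split=> [_|] //; right.
by exists dm; split=> u; case: (h u) => ? [].
Qed.

(** From [9 |X| <= 6 |X| + 3 |D| + 6 g]; this is where the 8 of [coverable] enters. *)
Lemma few_large_stars (X : {set V}) (dm : V -> V) :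
  X \subset U -> (forall v, v \in X -> v \notin D) ->
  (forall u, u \in U -> dm u \in D) -> (forall u, u \in U -> dm u = u \/ e u (dm u)) ->
  (forall u, u \in D -> dm u = u) ->
  (forall v, v \in X -> (8 < #|star_neighbors e X dm v|)%N) ->
  (#|X| <= #|D| + 2 * g)%N.
Proof.
move=> XU XD dmD dmA dmI big.
have := star_degree_sum e_sym e_irr sp U_closed XU XD dmD dmA dmI DU.
have : (9 * #|X| <= \sum_(v in X) #|star_neighbors e X dm v|)%N.
  by rewrite mulnC -sum_nat_const; exact: leq_sum.
lia.
Qed.

(** The star neighbors of [v] dominate its neighborhood, since each neighbor equals or is adjacent
    to the center of its star. If there were at most 8 of them, [v] would be coverable. *)
Lemma phase1_bound : (#|phase1 e :&: U :\: D| <= #|D| + 2 * g)%N.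
Proof.
have [dm [dmD dmA dmI]] := dominator_exists.
apply: (few_large_stars (dm := dm)) => //.
- by rewrite subDset subsetU // subsetIr orbT.
- by move=> v; rewrite !inE => /andP[].
move=> v vX; have := vX; rewrite !inE => /and3P[vD /negP v1 vU].
rewrite ltnNge; apply/negP => small; apply: v1; apply/existsP.
exists (star_neighbors e (phase1 e :&: U :\: D) dm v); rewrite small /=.
apply/andP; split.
  apply/imsetP => -[u]; rewrite inE => vu; rewrite /star_of; case: ifP => uX vE.
    by rewrite vE e_irr in vu.
  by have := dmD u (U_closed vU vu); rewrite -vE (negPf vD).
apply/forallP => u; apply/implyP => vu; have uU := U_closed vU vu.
set T := star_neighbors _ _ _ _; have : star_of (phase1 e :&: U :\: D) dm u \in T.
  by apply: imset_f; rewrite inE.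
rewrite /star_of; case: ifP => [_ -> //|_ dT]; have [<-|ud] := dmA u uU.
  by rewrite dT.
by apply/orP; right; apply/existsP; exists (dm u); rewrite dT.
Qed.

Let R1 := residual e (phase1 e).
Let heavy v d := (common_bound <= #|[set u in R1 | e v u && e d u]|)%N.

(** A star centered in [X] absorbs a single residual neighbor of [v]. One centered at [d] in [D]
    absorbs [d] and common neighbors of [v] and [d], at most [common_bound] in all as [v] is not
    heavy. So [M] neighbors need more than 8 stars. *)
Lemma phase2_light_bound :
  (#|[set v in phase2 e M :&: U :\: D | [forall d in D, ~~ heavy v d]]|
    <= #|D| + 2 * g)%N.
Proof.
have [dm [dmD dmA dmI]] := dominator_exists; set X := finset _.
have XP v : v \in X -> [/\ v \notin D, v \in phase2 e M, v \in U &
    forall d, d \in D -> ~~ heavy v d].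
  rewrite inE => /andP[]; rewrite in_setD in_setI => /and3P[vD v2 vU] /forallP h.
  by split=> // d dD; move/implyP: (h d); exact.
apply: (few_large_stars (dm := dm)) => //.
- by apply/fintype.subsetP => v /XP[].
- by move=> v /XP[].
move=> v /[dup] vX /XP[vD v2 vU vh]; set T := star_neighbors _ _ _ _.
have : (M <= #|[set u in R1 | e v u]|)%N by move: v2; rewrite inE => /andP[].
have sub : [set u in R1 | e v u] \subset
    \bigcup_(z in T) [set u in R1 | e v u && (star_of X dm u == z)].
  apply/fintype.subsetP => u; rewrite inE => /andP[uR vu]; apply/bigcupP.
  exists (star_of X dm u); first by apply: imset_f; rewrite inE.
  by rewrite inE uR vu eqxx.
have fiber z : z \in T ->
    (#|[set u in R1 | e v u && (star_of X dm u == z)]| <= common_bound)%N.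
  case/imsetP=> u0; rewrite inE => vu0 zE; have u0U := U_closed vU vu0.
  have [zX|zX] := boolP (z \in X).
    apply: (@leq_trans #|[set z]|); last by rewrite cards1.
    apply/subset_leq_card/fintype.subsetP => u; rewrite inE => /and3P[_ vu /eqP].
    rewrite in_set1.
    rewrite /star_of; case: ifP => [_ ->//|_ uz]; have [zD _ _ _] := XP _ zX.
    by have := dmD u (U_closed vU vu); rewrite uz (negPf zD).
  have zD : z \in D.
    move: zE zX; rewrite /star_of; case: ifP => [uX -> |_ -> _]; last exact: dmD.
    by rewrite uX.
  have hz := vh z zD; rewrite /heavy -ltnNge in hz.
  apply: leq_trans _ hz.
  rewrite -add1n -(cards1 z); apply: leq_trans _ (leq_card_setU _ _).
  apply/subset_leq_card/fintype.subsetP => u; rewrite inE => /and3P[uR vu /eqP].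
  rewrite in_setU in_set1 in_set uR vu /star_of.
  case: ifP => [_ ->|_ uz]; first by rewrite eqxx.
  have [uz'|uz'] := dmA u (U_closed vU vu); first by rewrite -uz uz' eqxx.
  by rewrite -uz e_sym uz' orbT.
move=> /leq_trans/(_ (subset_leq_card sub))/leq_trans/(_ (card_bigcup_le _ _)).
move=> /leq_trans/(_ (leq_sum _ fiber)).
rewrite sum_nat_const /M /degree_bound => h; rewrite ltnNge; apply/negP => T8.
have : (#|T| * common_bound <= 8 * common_bound)%N by rewrite leq_mul2r T8 orbT.
lia.
Qed.

(** A heavy pair [v], [d] has neighbors of [d] that phase 1 leaves undominated, so [d] is coverable
    by some [S] of size at most 8. Then [v] belongs to [S]: otherwise the common neighbors of [v]
    and [d] would be covered by 8 sets, each made of some [s] and the common neighbors of [v], [d]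
    and [s]. *)
Lemma phase2_heavy_bound :
  (#|[set v in phase2 e M :&: U :\: D | [exists d in D, heavy v d]]| <= 8 * #|D|)%N.
Proof.
set X := finset _.
have sub : X \subset \bigcup_(d in D) [set v in X | heavy v d].
  apply/fintype.subsetP => v vX; have := vX; rewrite inE => /andP[_ /existsP[d /andP[dD h]]].
  by apply/bigcupP; exists d; rewrite // inE vX.
apply: leq_trans (subset_leq_card sub) _; apply: leq_trans (card_bigcup_le _ _) _.
rewrite mulnC -sum_nat_const; apply: leq_sum => d dD.
set Xd := finset _; have [->|/set0Pn[v0]] := eqVneq Xd set0; first by rewrite cards0.
rewrite inE => /andP[_ h0].
have [u0] : exists u, u \in [set u in R1 | e v0 u && e d u].
  by apply/card_gt0P; apply: leq_trans h0; rewrite /common_bound addn1.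
rewrite inE => /and3P[/residualP[_ u0R] _ du0].
have : coverable e d.
  by apply: contraTT du0 => dn; rewrite e_sym; apply: u0R; rewrite inE dn.
case/existsP=> S /and3P[S8 dS /forallP hS].
apply: (leq_trans _ S8); apply/subset_leq_card/fintype.subsetP => v.
rewrite inE => /andP[vX hv]; apply: contraT => vS.
have vd : v != d.
  by apply: contraTneq dD => <-; move: vX; rewrite !inE => /andP[/andP[]].
have : ([set u in R1 | e v u && e d u] \subset
    \bigcup_(s in S) (s |: [set u | [&& e v u, e d u & e s u]])).
  apply/fintype.subsetP => u; rewrite inE => /and3P[_ vu du]; apply/bigcupP.
  have := hS u; rewrite du /= => /orP[uS|/existsP[s /andP[sS us]]].
    by exists u; rewrite // inE in_set1 eqxx.
  by exists s; rewrite // !inE vu du e_sym us orbT.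
move/subset_leq_card/(leq_trans hv)/leq_trans/(_ (card_bigcup_le _ _)).
have each s : s \in S ->
    (#|s |: [set u | [&& e v u, e d u & e s u]]| <= 6 + 2 * g + 1)%N.
  move=> sS; rewrite addn1 -add1n; apply: leq_trans (leq_card_setU _ _) _.
  rewrite cards1 leq_add2l.
  pose t (i : 'I_3) := nth v [:: v; d; s] i.
  have tinj : injective t.
    move=> i j /eqP; rewrite nth_uniq ?ltn_ord //; first by move/eqP/val_inj.
    rewrite /= !inE negb_or vd /= andbT; apply/andP; split.
      by apply: contraNneq vS => ->.
    by apply: contraNneq dS => ->.
  apply: leq_trans _ (common_neighbors e_irr sp tinj).
  apply/subset_leq_card/fintype.subsetP => u; rewrite !inE => /and3P[vu du su].
  by apply/forallP => -[[|[|[|//]]] ?]; rewrite /t /=.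
move=> /leq_trans/(_ (leq_sum _ each)).
rewrite sum_nat_const /common_bound => h.
have : (#|S| * (6 + 2 * g + 1) <= 8 * (6 + 2 * g + 1))%N by rewrite leq_mul2r S8 orbT.
lia.
Qed.

(** The 11 adds 1 for [D] itself, 1 for phase 1, 1 for light and 8 for heavy vertices. *)
Lemma phase12_bound : (#|(phase1 e :|: phase2 e M) :&: U| <= 11 * #|D| + 4 * g)%N.
Proof.
have sub : (phase1 e :|: phase2 e M) :&: U \subset D :|: (phase1 e :&: U :\: D) :|:
   [set v in phase2 e M :&: U :\: D | [forall d in D, ~~ heavy v d]] :|:
   [set v in phase2 e M :&: U :\: D | [exists d in D, heavy v d]].
  apply/fintype.subsetP => v; rewrite in_setI in_setU => /andP[v12 vU].
  have [vD|vD] := boolP (v \in D); first by rewrite !in_setU vD.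
  case/orP: v12 => v12.
    apply/setUP; left; apply/setUP; left; apply/setUP; right.
    by rewrite in_setD vD in_setI v12.
  have [h|/existsPn h] := boolP [exists d in D, heavy v d].
    by apply/setUP; right; rewrite in_set in_setD in_setI vD v12 vU h.
  apply/setUP; left; apply/setUP; right.
  rewrite in_set in_setD in_setI vD v12 vU /=.
  by apply/forallP => d; apply/implyP => dD; have := h d; rewrite dD.
have := subset_leq_card sub; have := phase1_bound; have := phase2_light_bound.
have := phase2_heavy_bound.
move: (phase1 e :&: U :\: D) (finset _) (finset _) => A B C.
have := (leq_card_setU (D :|: A :|: B) C).1; have := (leq_card_setU (D :|: A) B).1.
have := (leq_card_setU D A).1; lia.
Qed.

End PhaseBounds.

(** * The primal-dual packing *)

Section Packing.
Variables (V : finType) (e : rel V) (M J : nat).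
Hypothesis e_sym : symmetric e.
Hypothesis MJ : (M <= 14 * 2 ^ J)%N.

Let w i := weight e M J i.
Let T := target e M.

Lemma weightS i u : w i.+1 u =
  if u \in residual e (saturated e J (w i)) then (2 * w i u)%N else w i u.
Proof. by []. Qed.

Lemma weight_leS i u : (w i u <= w i.+1 u)%N.
Proof. by rewrite weightS; case: ifP => // _; lia. Qed.

Lemma weight_le i u : (w i u <= 2 ^ i)%N.
Proof.
elim: i => [|i IH]; first by rewrite /w /weight /=; case: (_ \in _).
by rewrite weightS expnS; case: ifP => _; lia.
Qed.

Lemma load_leS i v : (load e (w i) v <= load e (w i.+1) v)%N.
Proof. by apply: leq_add; [|apply: leq_sum => u _]; exact: weight_leS. Qed.

Lemma saturatedS i : saturated e J (w i) \subset saturated e J (w i.+1).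
Proof.
apply/fintype.subsetP => v; rewrite !inE => /leq_trans; apply; exact: load_leS.
Qed.

(** Saturated sets only grow, so such a target was unfrozen, and doubled, in every earlier round. *)
Lemma weight_residual i u : u \in T -> u \in residual e (saturated e J (w i)) ->
  w i u = (2 ^ i)%N.
Proof.
move=> uT; elim: i => [|i IH] uR; first by rewrite /w /weight /= uT.
have uR' := fintype.subsetP (residualS e (saturatedS i)) u uR.
by rewrite weightS uR' IH // expnS.
Qed.

(** Initially a vertex of phases 1 and 2 has load 0, because targets avoid its closed neighborhood,
    and any other vertex has fewer than [M] target neighbors. Later, saturation freezes a closed
    neighborhood, and an unsaturated load is below half the capacity. *)
Lemma load_bound i v : (load e (w i) v <= 14 * 2 ^ J)%N.
Proof.
elim: i => [|i IH].
  apply: leq_trans MJ; rewrite /load /w /weight /=.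
  have [v12|v12] := boolP (v \in phase1 e :|: phase2 e M).
    rewrite big1 => [|u vu].
      by case: (boolP (v \in _)) => // /residualP[]; rewrite v12.
    case: (boolP (u \in _)) => // /residualP[_ /(_ v v12)].
    by rewrite e_sym vu.
  move: v12; rewrite in_setU negb_or => /andP[v1]; rewrite in_set v1 /= -ltnNge => lt.
  apply: (leq_trans _ lt); rewrite -add1n; apply: leq_add; first by case: (_ \in _).
  rewrite -sum1_card [X in (_ <= X)%N]big_mkcond [X in (X <= _)%N]big_mkcond.
  apply: leq_sum => u _; rewrite in_set andbC; case: (e v u) => //=.
  case: (boolP (u \in target e M)) => //= uT.
  by rewrite (fintype.subsetP (residualS e (subsetUl _ _)) u uT).
have [vS|vS] := boolP (v \in saturated e J (w i)).
  apply: leq_trans IH; apply: leq_add; [|apply: leq_sum => u vu]; rewrite weightS.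
    by case: ifP => // /residualP[]; rewrite vS.
  by case: ifP => // /residualP[_ /(_ v vS)]; rewrite e_sym vu.
move: vS; rewrite in_set -ltnNge => lt.
have dbl u : (w i.+1 u <= 2 * w i u)%N by rewrite weightS; case: ifP => _; lia.
have : (load e (w i.+1) v <= 2 * load e (w i) v)%N.
  rewrite /load mulnDr leq_add ?dbl // big_distrr.
  by apply: leq_sum => u _; exact: dbl.
lia.
Qed.

Section Bound.
Variable g : nat.
Hypothesis e_irr : irreflexive e.
Hypothesis sp : sparse g e.
Variables (U D : {set V}).
Hypothesis U_closed : forall u v, u \in U -> e u v -> v \in U.
Hypothesis D_dom : forall u, u \in U -> u \in D \/ exists2 w, w \in D & e u w.

Let K := (2 ^ J)%N.
Let S := saturated e J (w J).

(** Weak duality of packing and domination: the weight of each vertex of [U] is charged to a member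
    of [D] that dominates it. *)
Lemma total_weight : (\sum_(u in U) w J u <= 14 * K * #|D|)%N.
Proof.
apply: (@leq_trans (\sum_(d in D) load e (w J) d)); last first.
  by rewrite mulnC -sum_nat_const; apply: leq_sum => d _; exact: load_bound.
pose c u d := (u == d) || e d u.
have -> : (\sum_(d in D) load e (w J) d = \sum_(u : V) \sum_(d in D | c u d) w J u)%N.
  rewrite [RHS](exchange_big_dep (mem D)) /=; last by move=> u d _ /andP[].
  apply: eq_bigr => d dD; rewrite /load [RHS](bigD1 d) /=; last by rewrite dD /c eqxx.
  congr addn; apply: eq_bigl => u; rewrite dD /c /=.
  by have [->|] := eqVneq u d; rewrite ?e_irr ?andbT.
rewrite big_mkcond /=; apply: leq_sum => u _; case: ifP => // uU.
have [d dD cd] : exists2 d, d \in D & c u d.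
  have [uD|[d dD ud]] := D_dom uU; first by exists u; rewrite // /c eqxx.
  by exists d; rewrite // /c e_sym ud orbT.
by rewrite (bigD1 d) /= ?dD // leq_addr.
Qed.

Lemma weight_layers u : w J u = (\sum_(k < K) (k < w J u))%N.
Proof.
have : (w J u <= K)%N by exact: weight_le.
move: (w J u) => n nK.
rewrite -(big_mkord xpredT (fun k => (k < n : nat))) (big_cat_nat (leq0n n) nK) /=.
rewrite [X in (_ = _ + X)%N]big_nat_cond [X in (_ = _ + X)%N]big1 ?addn0; last first.
  by move=> k /andP[/andP[nk _] _]; rewrite ltnNge nk.
rewrite big_nat_cond (eq_bigr (fun=> 1%N)); last by move=> k /andP[/andP[_ ->]].
by rewrite -big_nat_cond sum_nat_const_nat subn0 muln1.
Qed.

(** Slicing the weights into [K] layers turns weighted arcs into sets, to which [arcs_bound]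
    applies. Load at least [7 K] on [A] against [K |A|] of own weight and [3 K |A| + 3 w(W) + 6 g K]
    from arcs leaves [3 K |A| <= 3 w(W) + 6 g K]. *)
Lemma saturated_bound :
  (K * #|S :&: U| <= \sum_(u in U | u \notin residual e S) w J u + 2 * g * K)%N.
Proof.
pose A := S :&: U; pose W := [set u in U | u \notin residual e S].
pose W_ (k : nat) := [set u in W | (k < w J u)%N].
have h1 : (7 * K * #|A| <= \sum_(v in A) load e (w J) v)%N.
  rewrite mulnC -sum_nat_const; apply: leq_sum => v; rewrite in_setI => /andP[vS _].
  by move: vS; rewrite in_set.
have h2 : (\sum_(v in A) load e (w J) v <=
    K * #|A| + \sum_(v in A) \sum_(u | e v u) w J u)%N.
  rewrite /load big_split /= leq_add2r mulnC -sum_nat_const.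
  by apply: leq_sum => v _; exact: weight_le.
have h3 : (\sum_(v in A) \sum_(u | e v u) w J u = \sum_(k < K) #|arcs e A (W_ k)|)%N.
  transitivity (\sum_(v in A) \sum_(k < K) #|[set u | (u \in W_ k) && e v u]|)%N.
    apply: eq_bigr => v; rewrite in_setI => /andP[vS vU].
    under eq_bigr do rewrite weight_layers.
    rewrite exchange_big /=; apply: eq_bigr => k _.
    rewrite -sum1_card big_mkcond [RHS]big_mkcond /=; apply: eq_bigr => u _.
    rewrite in_set; case vu : (e v u); last by rewrite andbF.
    have uW : u \in W.
      rewrite in_set (U_closed vU vu) /=.
      by apply/negP => /residualP[_ /(_ v vS)]; rewrite e_sym vu.
    by rewrite in_set uW andbT /=; case: (_ < _)%N.
  rewrite exchange_big /=; apply: eq_bigr => k _.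
  by rewrite /arcs (card_pairs A (fun v u => (u \in W_ k) && e v u)).
have h4 : (\sum_(k < K) #|arcs e A (W_ k)| <=
    \sum_(k < K) (3 * (#|A| + #|W_ k|) + 6 * g))%N.
  by apply: leq_sum => k _; exact: (arcs_bound e_sym e_irr sp).
have h5 : (\sum_(k < K) #|W_ k| = \sum_(u in U | u \notin residual e S) w J u)%N.
  under [RHS]eq_bigr do rewrite weight_layers.
  rewrite exchange_big /=; apply: eq_bigr => k _.
  rewrite -sum1_card big_mkcond [RHS]big_mkcond /=; apply: eq_bigr => u _.
  by rewrite in_set [u \in W]in_set; case: (u \in U) => //=;
    case: (u \notin residual e S) => //=; case: (_ < _)%N.
move: h4; rewrite big_split /= -big_distrr /= big_split /= h5 !sum_nat_const !card_ord -h3.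
by rewrite -/A; lia.
Qed.

(** Each weight is spent once: on the saturated vertices if they dominate its vertex, on the vertex
    itself otherwise. *)
Lemma phase3_bound : (#|phase3 e M J :&: U| <= 14 * #|D| + 2 * g)%N.
Proof.
have K0 : (0 < K)%N by rewrite expn_gt0.
rewrite -(leq_pmul2l K0).
pose L := T :&: residual e S :&: U.
have hL : (K * #|L| <= \sum_(u in U | u \in residual e S) w J u)%N.
  rewrite mulnC -sum_nat_const [X in (_ <= X)%N](bigID (mem T)) /=.
  apply: leq_trans (leq_addr _ _).
  rewrite (eq_bigl (fun u => [&& u \in U, u \in residual e S & u \in T])); last first.
    by move=> u; rewrite !in_setI andbC; congr (_ && _); rewrite andbC.
  rewrite [X in (_ <= X)%N](eq_bigl
    (fun u => [&& u \in U, u \in residual e S & u \in T])); last first.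
    by move=> u; rewrite andbA.
  by apply: leq_sum => u /and3P[_ uR uT]; rewrite weight_residual.
have : (#|phase3 e M J :&: U| <= #|S :&: U| + #|L|)%N.
  by rewrite /phase3 setIUl leq_card_setU.
have := saturated_bound; have := total_weight.
rewrite (bigID (mem (residual e S))) /=.
move: (\sum_(_ in _ | _) _)%N (\sum_(_ in _ | _) _)%N hL => A B hL h1 h2 h3.
have : (K * #|phase3 e M J :&: U| <= K * (#|S :&: U| + #|L|))%N.
  by rewrite leq_pmul2l.
rewrite mulnDr; lia.
Qed.

End Bound.
End Packing.

(** * Local computations *)

Inductive view := Seed of nat | Heard of view & seq view.

Definition full_information (out : view -> bool) : local_algorithm :=
  {| alg_state := view; alg_message := view; alg_init := Seed;
     alg_send := fun s _ => s; alg_update := Heard; alg_output := out |}.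

Fixpoint view_of (G : sgraph) (port : G -> seq G) (ident : G -> nat) (r : nat)
    (v : G) : view :=
  if r is r'.+1 then
    Heard (view_of port ident r' v) [seq view_of port ident r' u | u <- port v]
  else Seed (ident v).

Lemma full_information_output out r (G : sgraph) (port : G -> seq G)
    (ident : G -> nat) :
  local_output (full_information out) r port ident =
  [set v | out (view_of port ident r v)].
Proof.
apply/setP => v; rewrite !inE /=; congr (out _).
elim: r v => [//|r IH] v /=; rewrite /local_round /= IH; congr (Heard _ _).
by apply: eq_map => u; exact: IH.
Qed.

Record network := Network {
  net_graph :> sgraph;
  port : net_graph -> seq net_graph;
  ident : net_graph -> nat;
  portP : port_numbering port;
  ident_inj : injective ident }.
Arguments port {n}.
Arguments ident {n}.

(** The decoding [out] is uniform over all networks. [X] may be any type, so that intermediate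
    results such as weights and sets can be composed. *)
Definition local_in (r : nat) (X : Type) (phi : forall N : network, N -> X) :=
  exists out : view -> X, forall (N : network) (v : N),
    phi N v = out (view_of port ident r v).

Definition local (X : Type) (phi : forall N : network, N -> X) :=
  exists r, local_in r phi.

Lemma local_in_leq r r' (X : Type) (phi : forall N : network, N -> X) :
  (r <= r')%N -> local_in r phi -> local_in r' phi.
Proof.
elim: r' => [|r' IH]; first by rewrite leqn0 => /eqP->.
rewrite leq_eqVlt => /orP[/eqP-> //|]; rewrite ltnS => /IH h /h[out hout].
(* A view contains the view of the preceding round, so extra rounds can be ignored. *)
by exists (fun w => if w is Heard w' _ then out w' else out w).
Qed.

Lemma local_ext (X : Type) (phi psi : forall N : network, N -> X) :
  (forall N v, phi N v = psi N v) -> local psi -> local phi.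
Proof. by move=> h [r [out hout]]; exists r, out => N v; rewrite h. Qed.

Lemma local_map (X Y : Type) (f : X -> Y) (phi : forall N : network, N -> X) :
  local phi -> local (fun N v => f (phi N v)).
Proof. by move=> [r [out hout]]; exists r, (f \o out) => N v; rewrite hout. Qed.

Lemma local_map2 (X Y Z : Type) (f : X -> Y -> Z) (phi : forall N : network, N -> X)
    (psi : forall N : network, N -> Y) :
  local phi -> local psi -> local (fun N v => f (phi N v) (psi N v)).
Proof.
move=> [r lphi] [r' lpsi]; exists (maxn r r').
have [out hout] := local_in_leq (leq_maxl r r') lphi.
have [out' hout'] := local_in_leq (leq_maxr r r') lpsi.
by exists (fun w => f (out w) (out' w)) => N v; rewrite hout hout'.
Qed.

Lemma local_ident : local (fun N v => ident v).
Proof. by exists 0%N, (fun w => if w is Seed i then i else 0%N). Qed.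

Lemma local_neighbors (X : Type) (phi : forall N : network, N -> X) :
  local phi -> local (fun N v => [seq phi N u | u <- port v]).
Proof.
move=> [r [out hout]]; exists r.+1.
exists (fun w => if w is Heard _ s then map out s else [::]) => N v /=.
by rewrite -map_comp; apply: eq_map => u /=; exact: hout.
Qed.

Definition local_set (D : forall N : network, {set N}) :=
  local (fun N v => v \in D N).

Lemma mem_port (N : network) (v u : N) : (u \in port v) = adj v u.
Proof. by have [_ ->] := portP v. Qed.

Lemma uniq_port (N : network) (v : N) : uniq (port v).
Proof. by have [] := portP v. Qed.

Lemma sum_port (N : network) (v : N) (w : N -> nat) :
  (\sum_(u | adj v u) w u)%N = sumn [seq w u | u <- port v].
Proof.
rewrite sumnE big_map big_uniq /=; last exact: uniq_port.
by apply: eq_bigl => u; rewrite mem_port.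
Qed.

Lemma local_setU D D' : local_set D -> local_set D' ->
  local_set (fun N => D N :|: D' N).
Proof. by move=> h h'; apply: local_ext (local_map2 orb h h') => N v; rewrite inE. Qed.

Lemma local_setI D D' : local_set D -> local_set D' ->
  local_set (fun N => D N :&: D' N).
Proof. by move=> h h'; apply: local_ext (local_map2 andb h h') => N v; rewrite inE. Qed.

Lemma local_residual D : local_set D -> local_set (fun N => residual adj (D N)).
Proof.
move=> lD; apply: local_ext
  (local_map2 (fun b s => ~~ b && ~~ has id s) lD (local_neighbors lD)) => N v.
apply/residualP/andP => [[vD h]|[vD /hasPn h]]; split=> //.
  apply/hasPn => b /mapP[u]; rewrite mem_port => vu ->.
  by apply: contraL vu => uD; exact: h.
move=> w wD; apply/negP => vw.
have /h : (w \in D N) \in [seq u \in D N | u <- port v].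
  by apply: (map_f (fun u => u \in D N)); rewrite mem_port.
by rewrite wD.
Qed.

Lemma local_load w : local (fun N v => w N v : nat) ->
  local (fun N v => load adj (w N) v).
Proof.
move=> lw; apply: local_ext
  (local_map2 (fun n s => n + sumn s)%N lw (local_neighbors lw)) => N v.
by rewrite /load sum_port.
Qed.

(** Identifiers within distance 2 determine the answer. [S] becomes a list of at most 8 identifiers;
    keeping only the vertices of the network whose identifier is in the list yields a set that is no
    larger. *)
Lemma local_phase1 : local_set (fun N => phase1 (@adj N)).
Proof.
pose ids := local_neighbors local_ident.
pose ids2 := local_neighbors (local_map2 pair local_ident ids).
pose test (i : nat) (l : seq (nat * seq nat)) : bool :=
  ~~ `[< exists s : seq nat, [/\ (size s <= 8)%N, i \notin s &
       all (fun p => (p.1 \in s) || has (mem s) p.2) l] >].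
apply: local_ext (local_map2 test local_ident ids2) => N v; rewrite inE.
congr (~~ _); apply/existsP/asboolP.
  case=> S /and3P[S8 vS /forallP hS]; exists (map ident (enum S)); split.
  - by rewrite size_map -cardE.
  - by rewrite (mem_map (@ident_inj N)) mem_enum.
  apply/allP => p /mapP[u]; rewrite mem_port => vu -> /=.
  have := hS u; rewrite vu /= => /orP[uS|/existsP[w /andP[wS uw]]].
    by rewrite (mem_map (@ident_inj N)) mem_enum uS.
  apply/orP; right; apply/hasP; exists (ident w).
    by apply: map_f; rewrite mem_port.
  by rewrite /= (mem_map (@ident_inj N)) mem_enum.
case=> s [s8 vs /allP hs]; exists [set u | ident u \in s].
rewrite inE vs /=; apply/andP; split.
  apply: leq_trans s8; rewrite cardE -(size_map ident).
  apply: uniq_leq_size; first by rewrite (map_inj_uniq (@ident_inj N)) enum_uniq.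
  by move=> i /mapP[u]; rewrite mem_enum inE => us ->.
apply/forallP => u; apply/implyP => vu.
have := hs (ident u, [seq ident w | w <- port u]).
rewrite (map_f (fun u => (ident u, [seq ident w | w <- port u]))) ?mem_port //.
move=> /(_ isT) /= /orP[us|/hasP[i /mapP[w uw ->] ws]]; first by rewrite inE us.
rewrite mem_port in uw; apply/orP; right; apply/existsP; exists w.
by rewrite inE uw andbT.
Qed.

Lemma local_phase2 M : local_set (fun N => phase2 (@adj N) M).
Proof.
have lR := local_residual local_phase1.
apply: local_ext (local_map2 (fun b s => ~~ b && (M <= sumn (map nat_of_bool s))%N)
  local_phase1 (local_neighbors lR)) => N v.
rewrite inE; congr (_ && (_ <= _)%N); rewrite -map_comp -sum_port.
rewrite -sum1_card big_mkcond [RHS]big_mkcond /=; apply: eq_bigr => u _.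
by rewrite in_set; case: (adj v u); case: (_ \in _).
Qed.

Lemma local_target M : local_set (fun N => target (@adj N) M).
Proof.
exact: (local_residual (local_setU local_phase1 (local_phase2 M))).
Qed.

Lemma local_saturated J w : local (fun N v => w N v : nat) ->
  local_set (fun N => saturated (@adj N) J (w N)).
Proof.
move=> lw; apply: local_ext (local_map (fun n => 7 * 2 ^ J <= n)%N (local_load lw)).
by move=> N v; rewrite inE.
Qed.

Lemma local_weight M J i : local (fun N v => weight (@adj N) M J i v).
Proof.
elim: i => [|i IH]; first exact: (local_map nat_of_bool (local_target M)).
apply: local_ext (local_map2 (fun (b : bool) n => if b then 2 * n else n)%N
  (local_residual (local_saturated J IH)) IH) => N v.
by [].
Qed.

Lemma local_local_dominating M J : local_set (fun N => local_dominating (@adj N) M J).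
Proof.
have lS := local_saturated J (local_weight M J J).
apply: local_setU; first exact: local_setU local_phase1 (local_phase2 M).
exact: local_setU lS (local_setI (local_target M) (local_residual lS)).
Qed.

(** * Small and large components *)

Section Distance.
Variable N : network.
Implicit Types v w x : N.

Definition near (k : nat) v w :=
  exists p, [/\ path adj v p, last v p = w & (size p <= k)%N].

Lemma near_refl k v : near k v v.
Proof. by exists [::]. Qed.

Lemma near_adj v w : adj v w -> near 1 v w.
Proof. by move=> vw; exists [:: w]; split; rewrite //= vw. Qed.

Lemma near_trans j k v w x : near j v w -> near k w x -> near (j + k) v x.
Proof.
move=> [p [pp lp sp]] [q [pq lq sq]]; exists (p ++ q); split.
- by rewrite cat_path pp lp.
- by rewrite last_cat lp.
- by rewrite size_cat leq_add.
Qed.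

Lemma near_leq j k v w : (j <= k)%N -> near j v w -> near k v w.
Proof. by move=> jk [p [pp lp sp]]; exists p; split=> //; exact: leq_trans jk. Qed.

Lemma nearS k v w : near k.+1 v w <-> near k v w \/ exists2 u, adj v u & near k u w.
Proof.
split=> [[[|u p] [/= pp lp sp]]|[|[u vu h]]].
- by left; exists [::].
- by case/andP: pp => vu pp; right; exists u => //; exists p.
- exact: near_leq.
exact: near_trans (near_adj vu) h.
Qed.

Lemma near_sym k v w : near k v w -> near k w v.
Proof.
elim: k v w => [|k IH] v w.
  by case=> -[|u p] [_ lw sp] //; rewrite -lw; exact: near_refl.
case/nearS=> [/IH|[u vu /IH h]]; first exact: near_leq.
by rewrite -addn1; apply: near_trans h (near_adj _); rewrite adj_sym.
Qed.

Lemma near_connect k v w : near k v w -> connect adj v w.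
Proof. by case=> p [pp <- _]; apply/connectP; exists p. Qed.

Lemma near_split v p i : path adj v p -> (i <= size p)%N ->
  near i v (nth v (v :: p) i) /\ near (size p - i) (nth v (v :: p) i) (last v p).
Proof.
elim: p v i => [|u p IH] v [|i] //= pp si; try by split; [exact: near_refl|exists [::]].
  by split; [exact: near_refl|exists (u :: p)].
case/andP: pp => vu pp; have [h1 h2] := IH u i pp si.
rewrite (set_nth_default u) //; split=> //.
exact: near_trans (near_adj vu) h1.
Qed.

End Distance.

(** A set, unlike a list, depends neither on ports nor on the position of [v]; vertices seeing the
    same component thus gather the same value. *)
Definition gather (X : Type) (k : nat) (phi : forall N : network, N -> X)
    (N : network) (v : N) : set X :=
  [set x | exists w, near k v w /\ x = phi N w]%classic.

Lemma local_gather (X : Type) k (phi : forall N : network, N -> X) :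
  local phi -> local (fun N v => gather k phi v).
Proof.
move=> lphi; elim: k => [|k IH].
  apply: local_ext (local_map (fun x => [set x]%classic) lphi) => N v.
  apply/seteqP; split=> [x [w [[[|u p] [_ lw sp]] ->]]|x /= ->] //; first by rewrite -lw.
  by exists v; split=> //; exact: near_refl.
pose join (A : set X) (s : seq (set X)) : set X :=
  [set x | A x \/ exists i, (i < size s)%N /\ nth classical_sets.set0 s i x]%classic.
apply: local_ext (local_map2 join IH (local_neighbors IH)) => N v.
apply/seteqP; split=> [x [w [/nearS[vw|[u vu uw]] ->]]|x [[w [vw ->]]|[i [si]]]].
- by left; exists w.
- right; exists (index u (port v)); rewrite size_map index_mem mem_port vu; split=> //.
  rewrite (nth_map u) ?index_mem ?mem_port // nth_index ?mem_port //.
  by exists w.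
- by exists w; split=> //; exact: near_leq vw.
rewrite size_map in si.
have [u0 us] : exists u0 : N, u0 \in port v.
  by case: (port v) si => // u0 s _; exists u0; rewrite mem_head.
rewrite (nth_map u0) // => -[w [uw ->]]; exists w; split=> //.
apply/nearS; right; exists (nth u0 (port v) i) => //.
by rewrite -mem_port mem_nth.
Qed.

Section Components.
Variable L : nat.

(* The ball of radius [L] around [v] is the whole component of [v]. *)
Definition ball_full (N : network) (v : N) : bool :=
  `[< gather L.+1 (fun N (v : N) => ident v) v = gather L (fun N (v : N) => ident v) v >].

(** Asking for some center within distance [L], instead of [ball_full v], makes the answer constant
    on components; the diameter is then at most [2 * L]. *)
Definition small_component (N : network) (v : N) : bool :=
  `[< gather L ball_full v true >].

Definition neighborhood (N : network) (v : N) : nat * seq nat :=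
  (ident v, [seq ident u | u <- port v]).

Definition dominates_ids (d : set (nat * seq nat)) (s : seq nat) :=
  forall p, d p -> (p.1 \in s) || has (mem s) p.2.

(** [xget] chooses as a function of [d] alone, so vertices with the same [d] agree without
    communicating. The default is not reached once some list dominates [d]. *)
Definition optimal_ids (d : set (nat * seq nat)) : seq nat :=
  xget [::] [set s | dominates_ids d s /\
    forall s', dominates_ids d s' -> (size s <= size s')%N]%classic.

Definition final_set (M J : nat) (N : network) : {set N} :=
  [set v : N | if small_component v
   then ident v \in optimal_ids (gather (2 * L) neighborhood v)
   else v \in local_dominating adj M J].

Lemma local_final_set M J : local_set (final_set M J).
Proof.
have lball : local ball_full.
  exact: (local_map2 (fun a b => `[< a = b >])
    (local_gather L.+1 local_ident) (local_gather L local_ident)).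
have lsmall : local small_component.
  exact: (local_map (fun A : set bool => `[< A true >]) (local_gather L lball)).
have lnb : local neighborhood.
  exact: (local_map2 pair local_ident (local_neighbors local_ident)).
have lopt : local (fun N (v : N) =>
    ident v \in optimal_ids (gather (2 * L) neighborhood v)).
  exact: (local_map2 (fun i A => i \in optimal_ids A) local_ident
    (local_gather (2 * L) lnb)).
have lld := local_local_dominating M J.
apply: local_ext (local_map2 (fun b c : bool * bool => if b.1 then b.2 else c.1)
  (local_map2 pair lsmall lopt) (local_map2 pair lld lld)) => N v.
by rewrite inE.
Qed.

Variable N : network.
Implicit Types v w : N.

(** Identifiers being distinct, a ball that gains none at radius [L + 1] gains no vertex, and so is
    closed under adjacency. *)
Lemma ball_fullP v : ball_full v -> forall w, connect adj v w -> near L v w.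
Proof.
move=> /asboolP full w /connectP[p].
have step u u' : near L v u -> adj u u' -> near L v u'.
  move=> vu uu'; have : gather L.+1 (fun N (v : N) => ident v) v (ident u').
    exists u'; split=> //; rewrite -addn1; exact: near_trans vu (near_adj uu').
  by rewrite full => -[x [vx /ident_inj ->]].
suff ext u : near L v u -> path adj u p -> w = last u p -> near L v w.
  by apply: ext; exact: near_refl.
elim: p u => [|x p IH] u vu /=; first by move=> _ ->.
by case/andP=> ux pp lp; apply: (IH x) => //; exact: step vu ux.
Qed.

Lemma small_componentP v : small_component v ->
  forall w, connect adj v w -> small_component w /\ near (2 * L) v w.
Proof.
move=> /asboolP[z [vz /esym fz]] w vw.
have zw : near L z w.
  apply: ball_fullP fz _ _; apply: connect_trans _ vw.
  exact: near_connect (near_sym vz).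
split; first by apply/asboolP; exists z; split=> //; exact: near_sym.
by rewrite mul2n -addnn; exact: near_trans vz zw.
Qed.

Lemma connect_adjC : connect_sym (@adj N).
Proof. exact/sym_connect_sym/adj_sym. Qed.

Lemma small_component_eq v w : connect adj v w ->
  small_component v = small_component w.
Proof.
move=> vw; apply/idP/idP => h; first by have [] := small_componentP h vw.
by rewrite connect_adjC in vw; have [] := small_componentP h vw.
Qed.

Lemma small_gather v w : small_component v -> connect adj v w ->
  gather (2 * L) neighborhood v = gather (2 * L) neighborhood w.
Proof.
move=> sv vw; have sw : small_component w by rewrite -(small_component_eq vw).
apply/seteqP; split=> p [x [/near_connect h ->]]; exists x; split=> //.
  have [] // := small_componentP sw (_ : connect adj w x).
  by apply: connect_trans h; rewrite connect_adjC.
by have [] // := small_componentP sv (connect_trans vw h).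
Qed.

Lemma dominates_idsP v (S : seq nat) : small_component v ->
  dominates_ids (gather (2 * L) neighborhood v) S <->
  forall w, connect adj v w -> ident w \in S \/ exists2 u, adj w u & ident u \in S.
Proof.
move=> sv; split=> [dS w vw|h p [w [/near_connect vw ->]]].
  have dw : gather (2 * L) neighborhood v (neighborhood w).
    by exists w; split=> //; have [] := small_componentP sv vw.
  have /orP[wS|/hasP[i /mapP[u wu ->] uS]] := dS _ dw; first by left.
  by right; exists u; rewrite // -mem_port.
have [->//|[u wu us]] := h w vw; apply/orP; right; apply/hasP.
by exists (ident u) => //; apply: map_f; rewrite mem_port.
Qed.

Lemma optimal_idsP (d : set (nat * seq nat)) s0 : dominates_ids d s0 ->
  dominates_ids d (optimal_ids d) /\
  forall s, dominates_ids d s -> (size (optimal_ids d) <= size s)%N.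
Proof.
move=> hs0; rewrite /optimal_ids; case: xgetP => [s _ //|none].
have ex : exists n, `[< exists s, dominates_ids d s /\ size s = n >].
  by exists (size s0); apply/asboolP; exists s0.
have [n /asboolP[s [ds sn]] hn] := ex_minnP ex.
case: (none s); split=> // s' ds'; rewrite sn; apply: hn.
by apply/asboolP; exists s'.
Qed.

Lemma small_optimal v : small_component v ->
  dominates_ids (gather (2 * L) neighborhood v)
    (optimal_ids (gather (2 * L) neighborhood v)).
Proof.
move=> sv; have all_ids : dominates_ids (gather (2 * L) neighborhood v)
    [seq ident w | w <- enum N].
  by apply/dominates_idsP => // w _; left; apply: map_f; rewrite mem_enum.
by have [] := optimal_idsP all_ids.
Qed.

Lemma final_set_dominating M J : dominating (final_set M J N).
Proof.
apply/forallP => v; have [sv|sv] := boolP (small_component v).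
  have /dominates_idsP-/(_ sv v (connect0 _ _)) := small_optimal sv.
  case=> [vs|[u vu us]]; first by rewrite inE sv vs.
  have cvu : connect adj v u by exact: connect1.
  apply/orP; right; apply/existsP; exists u; rewrite inE vu andbT.
  by rewrite -(small_component_eq cvu) sv -(small_gather sv cvu).
have [vD|[w wD vw]] := local_dominating_dominates adj M J v.
  by rewrite inE (negPf sv) vD.
apply/orP; right; apply/existsP; exists w; rewrite inE vw andbT.
by rewrite -(small_component_eq (connect1 vw)) (negPf sv).
Qed.

Section OneComponent.
Variables (v0 : N) (D : {set N}).
Hypothesis D_dom : dominating D.

Let U := [set w | connect adj v0 w].

Lemma component_dominated u : u \in U ->
  u \in D :&: U \/ exists2 w, w \in D :&: U & adj u w.
Proof.
rewrite inE => vu; move/forallP/(_ u): D_dom => /orP[uD|/existsP[w /andP[wD uw]]].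
  by left; rewrite !inE uD vu.
right; exists w; rewrite // !inE wD /=; exact: connect_trans vu (connect1 uw).
Qed.

Lemma small_component_bound M J : small_component v0 ->
  (#|final_set M J N :&: U| <= #|D :&: U|)%N.
Proof.
move=> sv; set d := gather (2 * L) neighborhood v0.
have dD : dominates_ids d [seq ident w | w <- enum (D :&: U)].
  apply/dominates_idsP => // w vw; have wU : w \in U by rewrite inE.
  have [wD|[u uD wu]] := component_dominated wU; [left|right].
    by rewrite map_f ?mem_enum.
  by exists u; rewrite // map_f ?mem_enum.
have [_ /(_ _ dD)] := optimal_idsP dD; rewrite size_map -cardE; apply: leq_trans.
rewrite cardE -(size_map ident); apply: uniq_leq_size.
  by rewrite (map_inj_uniq (@ident_inj N)) enum_uniq.
move=> i /mapP[w]; rewrite mem_enum !inE => /andP[wF vw] ->.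
by move: wF; rewrite -(small_component_eq vw) sv -(small_gather sv vw).
Qed.

(** On a shortest path of length [L + 1] the vertices at positions [3 j] have distinct
    dominators. *)
Lemma large_component q : ~~ small_component v0 -> (3 * q <= L)%N ->
  (q <= #|D :&: U|)%N.
Proof.
move=> sv qL.
have [w vw nvw] : exists2 w, near L.+1 v0 w & ~ near L v0 w.
  apply: contrapT => h; case/negP: sv; apply/asboolP; exists v0; split.
    exact: near_refl.
  apply/esym/asboolP/seteqP; split=> i [w [vw ->]]; exists w; split=> //.
    by apply: contrapT => nvw; apply: h; exists w.
  exact: near_leq vw.
have [p [pp lp sp]] := vw.
have sz : size p = L.+1.
  apply/eqP; rewrite eqn_leq sp ltnNge; apply/negP => h.
  by apply: nvw; exists p.
pose x (j : 'I_q) := nth v0 (v0 :: p) (3 * j).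
have xj (j : 'I_q) : (3 * j <= size p)%N by have := ltn_ord j; lia.
have hx (j : 'I_q) : near (3 * j) v0 (x j) /\ near (L.+1 - 3 * j) (x j) w.
  by rewrite -lp -sz; exact: near_split pp (xj j).
have /choice[f hf] j : exists d, d \in D :&: U /\ near 1 (x j) d.
  have xU : x j \in U by rewrite inE; have [/near_connect] := hx j.
  have [xD|[d dD xd]] := component_dominated xU.
    by exists (x j); split=> //; exact: near_refl.
  by exists d; split=> //; exact: near_adj.
have finj : injective f.
  suff lt (j k : 'I_q) : (j < k)%N -> f j <> f k.
    move=> j k jk; apply/val_inj/eqP; have [/lt|/lt|//] := ltngtP j k => h.
      by case: h.
    by case: h.
  (* A common dominator would replace a stretch of length at least 3 by two steps, bringing [w]
     within distance [L]. *)
  move=> jk fjk; apply: nvw.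
  have [[_ nj] [_ nk]] := (hf j, hf k); have [[n1 _] [_ n2]] := (hx j, hx k).
  rewrite fjk in nj.
  have := near_trans n1 (near_trans nj (near_trans (near_sym nk) n2)).
  by apply: near_leq; have := xj k; rewrite sz; lia.
rewrite -[q]card_ord -(card_imset _ finj); apply/subset_leq_card/fintype.subsetP.
by move=> y /imsetP[j _ ->]; case: (hf j).
Qed.

End OneComponent.
End Components.

(** * Assembly over the components *)

Theorem corollary7p1 (R : realType) (g : nat) (eps : R) (heps : 0 < eps) :
  exists (C : nat) (A : local_algorithm),
    forall G : sgraph, euler_genus_at_most R g G ->
    forall (port : G -> seq G) (ident : G -> nat),
      port_numbering port -> injective ident ->
      let D := local_output A C port ident in
      dominating D /\
      #|D|%:R <= (25%:R + eps) * (domination_number G)%:R.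
Proof.
(* [q] is chosen so that [6 g <= eps q]; with [L = 3 q] a component that is not small needs at least
   [q] dominators. *)
pose q := Num.Def.archi_bound ((6 * g)%:R / eps).
pose L := (3 * q)%N; pose M := degree_bound g.
(* The packing takes [J = M], which makes the capacity exceed every initial load. *)
have MJ : (M <= 14 * 2 ^ M)%N by have := ltn_expl M (isT : (1 < 2)%N); lia.
have [C [out hout]] := local_final_set L M M.
exists C, (full_information out) => G genusG pt idt ptP idtP.
pose N := Network ptP idtP.
have sp : sparse g (@adj G) := genus_sparse genusG.
have -> : local_output (full_information out) C pt idt = final_set L M M N.
  rewrite full_information_output; apply/setP => v; rewrite inE.
  by rewrite (hout N v).
set F : {set G} := final_set L M M N.
split; first exact: (@final_set_dominating L N M M).
rewrite /domination_number; case: arg_minnP => [|D D_dom _].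
  by apply/forallP => v; rewrite inE.
pose comp (v : G) := fingraph.root adj v.
have adjC : connect_sym (@adj G) := @connect_adjC N.
(* The factor [comp r == r] keeps one representative per component, so that the ratio is compared
   component by component. *)
have split_card (A : {set G}) :
    #|A|%:R = \sum_r #|A :&: [set w | connect adj r w]|%:R * (comp r == r)%:R :> R.
  have -> : #|A| = (\sum_r #|A :&: [set w | connect adj r w]| * (comp r == r))%N.
    rewrite -sum1_card (partition_big comp xpredT) //=; apply: eq_bigr => r _.
    rewrite sum1_card; case: eqP => [rr|rr]; rewrite ?muln1 ?muln0.
      apply: eq_card => v; rewrite !inE; congr (_ && _).
      by rewrite -(root_connect adjC) -/(comp r) -/(comp v) rr eq_sym.
    apply: eq_card0 => v; apply/negbTE/negP => /andP[_ /eqP vr].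
    by apply: rr; rewrite -vr /comp (root_root adjC).
  by rewrite natr_sum; apply: eq_bigr => r _; rewrite natrM.
rewrite (split_card F) (split_card D) mulr_sumr; apply: ler_sum => r _.
rewrite mulrA ler_wpM2r ?ler0n //; set U := finset _.
have [sr|lr] := boolP (small_component L (r : N)).
  have := @small_component_bound L N r D D_dom M M sr; rewrite -/F -/U => h.
  apply: le_trans (_ : #|D :&: U|%:R <= _); first by rewrite ler_nat.
  by rewrite ler_peMl ?ler0n //; lra.
have large := @large_component L N r D D_dom q lr (leqnn _).
have FU : F :&: U = local_dominating adj M M :&: U.
  apply/setP => v; rewrite in_setI [RHS]in_setI.
  have [|] := boolP (v \in U); last by rewrite !andbF.
  rewrite inE => rv; rewrite !andbT inE.
  by rewrite -(@small_component_eq L N r v rv) (negPf lr).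
have adjS := @adj_sym G; have adjI := @adj_irr G.
have Ucl u v : u \in U -> adj u v -> v \in U.
  by rewrite !inE => ru uv; exact: connect_trans ru (connect1 uv).
have Udom := @component_dominated N r D D_dom.
have b12 := phase12_bound adjS adjI sp Ucl (subsetIr D U) Udom.
have b3 := phase3_bound adjS MJ adjI sp Ucl Udom.
have bound : (#|F :&: U| <= 25 * #|D :&: U| + 6 * g)%N.
  rewrite FU /local_dominating setIUl; apply: leq_trans (leq_card_setU _ _) _.
  rewrite (_ : 25 * _ + 6 * g = 11 * #|D :&: U| + 4 * g + (14 * #|D :&: U| + 2 * g))%N.
    exact: leq_add b12 b3.
  lia.
apply: le_trans (_ : (25 * #|D :&: U| + 6 * g)%:R <= _); first by rewrite ler_nat.
(* The additive [6 g] is at most [eps q], hence at most [eps] times the number of vertices of [D] in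
   the component. *)
rewrite natrD natrM [(_ + eps) * _]mulrDl lerD2l.
have /ltW : (6 * g)%:R / eps < q%:R by apply: archi_boundP; rewrite divr_ge0 // ltW.
rewrite ler_pdivrMr // => /le_trans; apply; rewrite mulrC.
by rewrite ler_pM2l // ler_nat.
Qed.
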